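(* Let $(C(S),\omega,\Omega_\gamma)$ be a toric almost Calabi--Yau cone of complex dimension $m$ over a toric Sasaki manifold $(S,g)$ whose Reeb field $\xi$ is generated by an element of $\mathfrak{g}$. Let $\zeta\in\mathfrak{g}$ and $c\in\mathbb{R}$ satisfy $\mathrm{Int}\,\Delta\cap H_{\zeta,c}\ne\emptyset$ and $\zeta\notin\mathfrak{z}_y$ for every $y\in\Delta\cap H_{\zeta,c}$. Let $I\subset\mathbb{R}$ be an open interval, $f:I\to\mathbb{R}$ and $\rho:I\to\mathbb{R}^+$ smooth with $\dot f$ nowhere vanishing, $\tau_0=(e^{i\nu^1},\dots,e^{i\nu^m})\in T^m$, $\tau(t)=\exp(f(t)\zeta)\cdot\tau_0$, and let $F:L_{\zeta,c}=C(S)^\sigma_{\zeta,c}\times I\to C(S)$ be the Lagrangian submanifold $F(p,t)=\rho(t)\cdot\tau(t)\cdot p$. Put $$N=\langle\zeta,\gamma\rangle=\sum_{k=1}^m\gamma_k\zeta^k,\qquad \theta=\sum_{k=1}^m\gamma_k\nu^k,\qquad \kappa(t)=\log\rho(t).$$ Assume that $\zeta=\xi$, and let $\theta_0\in\mathbb{R}$ be a constant. Then $F:L_{\zeta,c}\to C(S)$ is a special Lagrangian submanifold with phase $e^{i\theta_0}$ if and only if the function $$t\mapsto\mathrm{Im}\bigl(e^{i(\theta-\theta_0)}e^{N(\kappa(t)+if(t))}\bigr)$$ is constant on $I$.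
   Context: Cone and Sasaki structure. $C(S)=S\times\mathbb{R}^+$ with $\overline g=r^2g+dr^2$, $\dim S=2m-1$, $r$ the coordinate on $\mathbb{R}^+$. $\mathbb{R}^+$ acts by $\rho\cdot(s_0,r_0)=(s_0,\rho r_0)$. $(S,g)$ is Sasaki if there is a complex structure $J$ on $C(S)$ such that $(C(S),\overline g,J)$ is Kähler. The Reeb field is $\xi=J(r\partial/\partial r)$, $\eta(Y)=\overline g(\xi,Y)/r^2$, and the Kähler form is $\omega=\frac12d(r^2\eta)$, with $\overline g(X,Y)=\omega(X,JY)$. Toric. $S$ is toric if there is an effective holomorphic action of $T^m$ on $C(S)$ preserving $\overline g$ with $\pi(\tau\cdot p)=\tau\cdot\pi(p)$, $r(\tau\cdot p)=r(p)$, $\pi:C(S)\to S$ the projection. $T^m=(S^1)^m$, its Lie algebra is $\mathfrak{g}=\mathbb{R}^m$ with $\exp(v)=(e^{iv^1},\dots,e^{iv^m})$, and the integral lattice is $\mathbb{Z}_{\mathfrak g}=\mathbb{Z}^m$. $v\in\mathfrak{g}$ is identified with the vector field $v(p)=\frac{d}{dt}|_{t=0}\exp(tv)\cdot p$. It is always assumed that $\xi$ is generated by an element of $\mathfrak{g}$, also denoted $\xi$. Moment map. $\mu:C(S)\to\mathfrak{g}^*$, $\langle\mu(p),v\rangle=\frac12r^2(p)\eta(v(p))$, so $d\langle\mu,v\rangle=-\omega(v,\cdot)$. The image $\Delta=\mu(C(S))$ is a strongly convex good rational polyhedral cone $\{y\in\mathfrak{g}^*\mid\langle y,\lambda\rangle\ge0\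 \forall\lambda\in\Lambda\}\setminus\{0\}$, with $\Lambda=\{\lambda_1,\dots,\lambda_d\}\subset\mathbb{Z}_{\mathfrak g}$ a minimal set of primitive vectors. Real form. $T^m_{\mathbb{C}}\cong(\mathbb{C}^\times)^m\supset T^m$ acts holomorphically on the toric variety $C(S)$ with open dense orbit $U_0\cong(\mathbb{C}^\times)^m$. $\sigma$ is the canonical anti-holomorphic involution of $C(S)$, equal to $w\mapsto\overline w$ on $U_0$; its fixed point set $C(S)^\sigma$ is a real $m$-dimensional submanifold. $H_{\zeta,c}=\{y\in\mathfrak{g}^*\mid\langle y,\zeta\rangle=c\}$; $\mathfrak{z}_y=\mathrm{Span}_{\mathbb{R}}\{\lambda_i\mid\langle y,\lambda_i\rangle=0\}$ for $y\in\Delta$; $C(S)^\sigma_{\zeta,c}=\{p\in C(S)^\sigma\mid\langle\mu(p),\zeta\rangle=c\}$, a real $(m-1)$-dimensional submanifold under the conditions on $\zeta,c$. Almost Calabi--Yau. The canonical bundle of $C(S)$ is assumed trivial, equivalently there is $\gamma=(\gamma_1,\dots,\gamma_m)\in(\mathbb{Z}_{\mathfrak g})^*\cong\mathbb{Z}^m$ with $\langle\gamma,\lambda\rangle=1$ for all $\lambda\in\Lambda$. $\Omega_\gamma$ is the non-vanishing holomorphic $(m,0)$-form on $C(S)$ which on $U_0$ equals $\exp(\gamma_1z^1+\dots+\gamma_mz^m)\,dz^1\wedge\dots\wedge dz^m$ in logarithmic coordinates $e^{z^k}=w^k$. The function $\psi$ is defined by $e^{2m\psi}\frac{\omega^m}{m!}=(-1)^{\frac{m(m-1)}{2}}(\frac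 i2)^m\Omega_\gamma\wedge\overline{\Omega_\gamma}$. Lagrangian angle. For a Lagrangian immersion $F:L\to C(S)$, $\theta_F:L\to\mathbb{R}/\pi\mathbb{Z}$ is defined by $F^*\Omega_\gamma=e^{i\theta_F+mF^*\psi}dV_{F^*\overline g}$ ($dV$ up to sign, $L$ not assumed oriented). $F$ is special Lagrangian with phase $e^{i\theta_0}$ if $\theta_F\equiv\theta_0$ mod $\pi$, equivalently $F^*(\mathrm{Im}(e^{-i\theta_0}\Omega_\gamma))=0$. *)

(* Defs.v *)
From HB Require Import structures.
From mathcomp Require Import all_boot all_order all_algebra all_fingroup.
From mathcomp Require Import complex.
From mathcomp Require Import all_classical all_reals all_analysis.

Set Implicit Arguments.
Unset Strict Implicit.
Unset Printing Implicit Defensive.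

Import Order.TTheory GRing.Theory Num.Theory numFieldNormedType.Exports.

Local Open Scope classical_set_scope.
Local Open Scope ring_scope.
Local Open Scope complex_scope.

Section Smooth.
Variable R : realType.

Fixpoint Ck (V W : normedModType R) (k : nat) (U : set V) (f : V -> W) : Prop :=
  match k with
  | 0 => forall x, U x -> {for x, continuous f}
  | k'.+1 => (forall x, U x -> differentiable f x) /\
             (forall v : V, Ck k' U (fun x => 'D_v f x))
  end.

(* Meant for open [U]. *)
Definition smooth_on (V W : normedModType R) (U : set V) (f : V -> W) : Prop :=
  forall k, Ck k U f.

(* A manifold modelled on [V], carried by an open subset [carrier] of the
   topological space [T].  The atlas is indexed by the points: [chart x] is a
   chart defined on [dom x], which contains [x], and [chartV x] is its inverse.
   Every atlas contains a compatible one of this form.  The tangent space at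
   [x] is the model space [V], through the chart [chart x]. *)
Record manifold (V : normedModType R) (T : topologicalType) := Manifold {
  carrier : set T;
  dom : T -> set T;
  chart : T -> T -> V;
  chartV : T -> V -> T }.

Definition chart_img (V : normedModType R) (T : topologicalType)
    (M : manifold V T) (x : T) : set V := chart M x @` dom M x.

Definition is_manifold (V : normedModType R) (T : topologicalType)
    (M : manifold V T) : Prop :=
  open (carrier M) /\
  (forall x, carrier M x ->
    [/\ open (dom M x), dom M x x, dom M x `<=` carrier M &
        open (chart_img M x)] /\
    [/\ forall y, dom M x y -> chartV M x (chart M x y) = y,
        forall y, dom M x y -> {for y, continuous (chart M x)} &
        forall u, chart_img M x u -> {for u, continuous (chartV M x)}]) /\
  (forall x y, carrier M x -> carrier M y ->
    smooth_on (chart M x @` (dom M x `&` dom M y)) (chart M y \o chartV M x)).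

Definition triv_mfd (V : normedModType R) (U : set V) : manifold V V :=
  Manifold U (fun _ => U) (fun _ u => u) (fun _ u => u).

Definition prod_mfd (V1 V2 : normedModType R) (T1 T2 : topologicalType)
    (M1 : manifold V1 T1) (M2 : manifold V2 T2) :
    manifold (V1 * V2)%type (T1 * T2)%type :=
  Manifold (carrier M1 `*` carrier M2)
    (fun x => dom M1 x.1 `*` dom M2 x.2)
    (fun x y => (chart M1 x.1 y.1, chart M2 x.2 y.2))
    (fun x u => (chartV M1 x.1 u.1, chartV M2 x.2 u.2)).

Definition restr_mfd (V : normedModType R) (T : topologicalType)
    (M : manifold V T) (U : set T) : manifold V T :=
  Manifold (carrier M `&` U) (fun x => dom M x `&` U) (chart M) (chartV M).

Section Maps.
Variables (V1 V2 : normedModType R) (T1 T2 : topologicalType).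
Variables (M1 : manifold V1 T1) (M2 : manifold V2 T2).

Definition smooth_map (F : T1 -> T2) : Prop :=
  [/\ forall p, carrier M1 p -> carrier M2 (F p),
      forall p, carrier M1 p -> {for p, continuous F} &
      forall x y, carrier M1 x -> carrier M2 y ->
        smooth_on (chart M1 x @` (dom M1 x `&` F @^-1` dom M2 y))
                  (chart M2 y \o F \o chartV M1 x)].

(* The differential of [F] at [p], in the charts centred at [p] and [F p]. *)
Definition mderiv (F : T1 -> T2) (p : T1) (v : V1) : V2 :=
  'd (chart M2 (F p) \o F \o chartV M1 p) (chart M1 p p) v.

Definition holomorphic_map (J1 : T1 -> V1 -> V1) (J2 : T2 -> V2 -> V2)
    (F : T1 -> T2) : Prop :=
  smooth_map F /\
  forall p v, carrier M1 p -> mderiv F p (J1 p v) = J2 (F p) (mderiv F p v).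

Definition antiholomorphic_map (J1 : T1 -> V1 -> V1) (J2 : T2 -> V2 -> V2)
    (F : T1 -> T2) : Prop :=
  smooth_map F /\
  forall p v, carrier M1 p -> mderiv F p (J1 p v) = - J2 (F p) (mderiv F p v).
End Maps.

Section Tensors.
Variables (V : normedModType R) (T : topologicalType) (M : manifold V T).

Definition velocity (c : R -> T) (t : R) : V := mderiv (triv_mfd setT) M c t 1.

(* Tangent vectors to a submanifold [L] of [M], as velocities of smooth curves
   lying in [L]. *)
Definition tangent_to (L : set T) (q : T) (v : V) : Prop :=
  exists (e : R) (c : R -> T),
    [/\ 0 < e, smooth_map (triv_mfd [set t : R | `|t| < e]) M c,
        forall t, `|t| < e -> L (c t), c 0 = q & velocity c 0 = v].

(* Components of a 2-tensor [w] on the constant vectors [a], [b] in the chart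
   [chart M x], at the point of coordinates [u]. *)
Definition coord2 (w : T -> V -> V -> R) (x : T) (a b : V) (u : V) : R :=
  w (chartV M x u) (mderiv (triv_mfd setT) M (chartV M x) u a)
                   (mderiv (triv_mfd setT) M (chartV M x) u b).

Definition riemannian (g : T -> V -> V -> R) : Prop :=
  (forall p, carrier M p ->
    [/\ forall a u v w, g p (a *: u + v) w = a * g p u w + g p v w,
        forall u v, g p u v = g p v u &
        forall u, u != 0 -> 0 < g p u u]) /\
  (forall x a b, carrier M x -> smooth_on (chart_img M x) (coord2 g x a b)).

Definition closed2 (w : T -> V -> V -> R) : Prop :=
  forall x a b c u, carrier M x -> chart_img M x u ->
    'D_a (coord2 w x b c) u + 'D_b (coord2 w x c a) u
      + 'D_c (coord2 w x a b) u = 0.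
End Tensors.

Section Wedge.
Variables (K : fieldType) (V : Type).

(* Normalised so that (dx /\ dy) (e_x, e_y) = 1. *)
Definition wedge (p q : nat) (a : ('I_p -> V) -> K) (b : ('I_q -> V) -> K) :
    ('I_(p + q) -> V) -> K := fun v =>
  (p`! * q`!)%:R^-1 * \sum_(s : 'S_(p + q))
     (-1) ^+ s * a (fun i => v (s (lshift q i))) * b (fun j => v (s (rshift p j))).

Fixpoint wedge_exp (p : nat) (a : ('I_p -> V) -> K) (k : nat) :
    ('I_(k * p) -> V) -> K :=
  match k with
  | 0 => fun _ => 1
  | k'.+1 => wedge a (@wedge_exp p a k')
  end.

Definition form2 (w : V -> V -> K) : ('I_2 -> V) -> K :=
  fun v => w (v ord0) (v ord_max).
End Wedge.
Arguments wedge_exp {K V p} a k v : rename.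

(* C^m is the real normed space R^m x R^m of pairs (real part, imaginary
   part), since [R[i]] does not carry a [normedModType R] structure. *)
Definition Cn (m : nat) : normedModType R := ('rV[R]_m * 'rV[R]_m)%type.

Definition Jstd (V : normedModType R) (z : (V * V)%type) : (V * V)%type :=
  (- z.2, z.1).

Definition cval (m : nat) (w : Cn m) (k : 'I_m) : R[i] := w.1 0 k +i* w.2 0 k.

Definition mkCn (m : nat) (a : 'I_m -> R[i]) : Cn m :=
  (\row_k complex.Re (a k), \row_k complex.Im (a k)).

Definition cone1 (m : nat) : Cn m := mkCn (fun _ => 1).

Definition cmul (m : nat) (w w' : Cn m) : Cn m :=
  mkCn (fun k => cval w k * cval w' k).

Definition cconj (m : nat) (w : Cn m) : Cn m := mkCn (fun k => (cval w k)^*).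

Definition cexp (z : R[i]) : R[i] :=
  (expR (complex.Re z))%:C * (cos (complex.Im z) +i* sin (complex.Im z)).

Definition cexpv (m : nat) (z : Cn m) : Cn m := mkCn (fun k => cexp (cval z k)).

Definition texp (m : nat) (v : 'rV[R]_m) : Cn m := cexpv ((0, v) : Cn m).

Definition ctorus (m : nat) : set (Cn m) := [set w | forall k, cval w k != 0].

Definition torus (m : nat) : set (Cn m) := [set w | forall k, `|cval w k| = 1].

Definition dot (m : nat) (y v : 'rV[R]_m) : R := \sum_k y 0 k * v 0 k.

Definition int_vec (m : nat) (v : 'rV[int]_m) : 'rV[R]_m := map_mx intr v.

Section Kaehler.
Variables (V : normedModType R) (T : topologicalType) (M : manifold V T).
Variables (m : nat) (J : T -> V -> V).

Let std (V' : normedModType R) : (V' * V')%type -> (V' * V')%type -> (V' * V')%type :=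
  fun _ => @Jstd V'.

Definition holo_coord (U : set T) (z : T -> Cn m) : Prop :=
  [/\ open U, U `<=` carrier M, open (z @` U),
      holomorphic_map (restr_mfd M U) (triv_mfd setT) J (@std _) z &
      exists zV : Cn m -> T, smooth_map (triv_mfd (z @` U)) M zV /\
        forall p, U p -> zV (z p) = p].

Definition complex_structure : Prop :=
  (forall p, carrier M p ->
    (forall a u v, J p (a *: u + v) = a *: J p u + J p v) /\
    (forall v, J p (J p v) = - v)) /\
  (forall p, carrier M p -> exists U z, U p /\ holo_coord U z).

(* g(X, Y) = w(X, J Y) *)
Definition kahler_form (g : T -> V -> V -> R) (p : T) (u v : V) : R :=
  g p (J p u) v.

Definition kahler (g : T -> V -> V -> R) : Prop :=
  [/\ riemannian M g, complex_structure,
      forall p u v, carrier M p -> g p (J p u) (J p v) = g p u v &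
      closed2 M (kahler_form g)].

(* Om = h dz^1 /\ ... /\ dz^m in
   holomorphic coordinates. *)
Definition holo_volume_form (Om : T -> ('I_m -> V) -> R[i]) : Prop :=
  forall U z, holo_coord U z ->
    exists h : T -> R[i],
      holomorphic_map (restr_mfd M U) (triv_mfd setT) J (@std _)
        (fun q => (complex.Re (h q), complex.Im (h q)) : (R * R)%type) /\
      forall q, U q -> h q != 0 /\
        forall v : 'I_m -> V, Om q v =
          h q * \det (\matrix_(j, k) cval (mderiv M (triv_mfd setT) z q (v k)) j).

(* e^{2 m psi} w^m / m! = (-1)^{m(m-1)/2} (i/2)^m Om /\ conj Om, evaluated on
   the first 2m vectors of a sequence. *)
Definition acy_function (g : T -> V -> V -> R) (Om : T -> ('I_m -> V) -> R[i])
    (psi : T -> R) : Prop :=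
  forall p, carrier M p -> forall v : nat -> V,
    (expR ((2 * m)%:R * psi p) *
       (wedge_exp (form2 (kahler_form g p)) m (fun i : 'I_(m * 2) => v i) / (m`!)%:R))%:C
    = (-1) ^+ (m * (m - 1))./2 * ((0 +i* 1) / 2%:R) ^+ m *
      wedge (Om p) (fun u => (Om p u)^*) (fun i : 'I_(m + m) => v i).

(* [L] is an m-dimensional submanifold of an ambient manifold [N], and [F] is
   a map to [M] which is smooth on [N]; what is considered is F|_L : L -> M. *)
Variables (V' : normedModType R) (T' : topologicalType) (N : manifold V' T').

(* The dimension of [L] being m, half of that of [M], an immersion of [L] is
   Lagrangian when it pulls back the Kaehler form to 0. *)
Definition lagrangian_immersion (g : T -> V -> V -> R) (L : set T')
    (F : T' -> T) : Prop :=
  forall q, L q ->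
    (forall v, tangent_to N L q v -> mderiv N M F q v = 0 -> v = 0) /\
    (forall u v, tangent_to N L q u -> tangent_to N L q v ->
       kahler_form g (F q) (mderiv N M F q u) (mderiv N M F q v) = 0).

(* [th] represents theta_F(q) in R/(pi Z): F^* Om = e^{i th + m F^* psi} dV at
   q, the density dV being that of F^* g, defined up to sign. *)
Definition lagrangian_angle (g : T -> V -> V -> R)
    (Om : T -> ('I_m -> V) -> R[i]) (psi : T -> R) (L : set T') (F : T' -> T)
    (q : T') (th : R) : Prop :=
  forall v : 'I_m -> V', (forall k, tangent_to N L q (v k)) ->
    let w k := mderiv N M F q (v k) in
    exists b : bool, Om (F q) w =
      (-1) ^+ b * cexp ((m%:R * psi (F q)) +i* th) *
      (Num.sqrt (\det (\matrix_(j, k) g (F q) (w j) (w k))))%:C.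

Definition special_lagrangian (g : T -> V -> V -> R)
    (Om : T -> ('I_m -> V) -> R[i]) (psi : T -> R) (L : set T') (F : T' -> T)
    (th0 : R) : Prop :=
  lagrangian_immersion g L F /\
  exists theta : T' -> R, forall q, L q ->
    lagrangian_angle g Om psi L F q (theta q) /\
    exists k : int, theta q = th0 + k%:~R * pi.
End Kaehler.

Section Toric.
Variables (m : nat) (S : topologicalType).
Variable MS : manifold 'rV[R]_(2 * m - 1)%N S.
Let VC : normedModType R := ('rV[R]_(2 * m - 1)%N * R)%type.
Let CS := (S * R)%type.

(* C(S) = S x R^+, as an open subset of S x R; the second components of points
   and of tangent vectors are r and dr. *)
Definition cone_mfd : manifold VC CS :=
  prod_mfd MS (triv_mfd [set r : R | 0 < r]).

Definition cone_metric
    (g : S -> 'rV[R]_(2 * m - 1)%N -> 'rV[R]_(2 * m - 1)%N -> R)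
    (p : CS) (u v : VC) : R :=
  p.2 ^+ 2 * g p.1 u.1 v.1 + u.2 * v.2.

Definition dilation (a : R) (p : CS) : CS := (p.1, a * p.2).

Definition sasaki
    (g : S -> 'rV[R]_(2 * m - 1)%N -> 'rV[R]_(2 * m - 1)%N -> R)
    (J : CS -> VC -> VC) : Prop :=
  riemannian MS g /\ kahler cone_mfd m J (cone_metric g).

(* xi = J (r d/dr) *)
Definition reeb (J : CS -> VC -> VC) (p : CS) : VC := J p (0, p.2).

Definition contact_form
    (g : S -> 'rV[R]_(2 * m - 1)%N -> 'rV[R]_(2 * m - 1)%N -> R)
    (J : CS -> VC -> VC) (p : CS) (Y : VC) : R :=
  cone_metric g p (reeb J p) Y / p.2 ^+ 2.

Variable A : Cn m -> CS -> CS.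

(* [A] is the action of the complex torus on C(S) (used only for [w] in
   [ctorus m] and points of the cone), and [p0] the base point giving the
   identification w |-> w . p0 of the complex torus with the open orbit U_0. *)
Definition complex_torus_action (J : CS -> VC -> VC) (p0 : CS) : Prop :=
  let U0 := [set A w p0 | w in @ctorus m] in
  [/\ holomorphic_map (prod_mfd (triv_mfd (@ctorus m)) cone_mfd) cone_mfd
        (fun q v => (Jstd v.1, J q.2 v.2)) J (fun q => A q.1 q.2),
      forall p, carrier cone_mfd p -> A (cone1 m) p = p &
      forall w w' p, ctorus w -> ctorus w' -> carrier cone_mfd p ->
        A (cmul w w') p = A w (A w' p)] /\
  [/\ carrier cone_mfd p0, open U0, carrier cone_mfd `<=` closure U0 &
      forall w w', ctorus w -> ctorus w' -> A w p0 = A w' p0 -> w = w'].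

(* The action of T^m, obtained by restriction of [A], is effective and
   isometric, preserves r, and covers an action [a] on S. It is holomorphic
   since [A] is. *)
Definition toric
    (g : S -> 'rV[R]_(2 * m - 1)%N -> 'rV[R]_(2 * m - 1)%N -> R) : Prop :=
  [/\ forall t, torus t -> (forall p, carrier cone_mfd p -> A t p = p) ->
        t = cone1 m,
      forall t p u v, torus t -> carrier cone_mfd p ->
        cone_metric g (A t p) (mderiv cone_mfd cone_mfd (A t) p u)
                              (mderiv cone_mfd cone_mfd (A t) p v)
        = cone_metric g p u v,
      forall t p, torus t -> carrier cone_mfd p -> (A t p).2 = p.2 &
      exists a : Cn m -> S -> S, forall t p, torus t -> carrier cone_mfd p ->
        (A t p).1 = a t p.1].

(* The vector field generated by [v] in the Lie algebra R^m of T^m. *)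
Definition fundamental_field (v : 'rV[R]_m) (p : CS) : VC :=
  velocity cone_mfd (fun t => A (texp (t *: v)) p) 0.

Definition moment_map
    (g : S -> 'rV[R]_(2 * m - 1)%N -> 'rV[R]_(2 * m - 1)%N -> R)
    (J : CS -> VC -> VC) (mu : CS -> 'rV[R]_m) : Prop :=
  forall p v, carrier cone_mfd p ->
    dot (mu p) v = 2^-1 * p.2 ^+ 2 * contact_form g J p (fundamental_field v p).

Definition real_structure (J : CS -> VC -> VC) (p0 : CS) (sigma : CS -> CS) :
    Prop :=
  [/\ antiholomorphic_map cone_mfd cone_mfd J J sigma,
      forall p, carrier cone_mfd p -> sigma (sigma p) = p &
      forall w, ctorus w -> sigma (A w p0) = A (cconj w) p0].

(* C(S)^sigma_{zeta,c} *)
Definition real_level_set (sigma : CS -> CS) (mu : CS -> 'rV[R]_m)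
    (zeta : 'rV[R]_m) (c : R) : set CS :=
  [set p | [/\ carrier cone_mfd p, sigma p = p & dot (mu p) zeta = c]].

(* [Om] is Omega_gamma: on U_0, in the logarithmic coordinates
   z |-> exp(z) . p0, it is exp(gamma . z) dz^1 /\ ... /\ dz^m. *)
Definition toric_volume_form (J : CS -> VC -> VC) (p0 : CS)
    (gamma : 'rV[int]_m) (Om : CS -> ('I_m -> VC) -> R[i]) : Prop :=
  holo_volume_form cone_mfd J Om /\
  forall (z : Cn m) (u : 'I_m -> Cn m),
    let E y := A (cexpv y) p0 in
    Om (E z) (fun k => mderiv (triv_mfd setT) cone_mfd E z (u k)) =
      cexp (\sum_k (gamma 0 k)%:~R * cval z k) *
      \det (\matrix_(j, k) cval (u k) j).
End Toric.

Section Cones.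
Variables (m d : nat) (lam : 'I_d -> 'rV[int]_m).

Definition primitive (v : 'rV[int]_m) : Prop :=
  forall (k : int) (v' : 'rV[int]_m), v = k *: v' -> `|k| = 1.

Definition polyhedral_cone : set 'rV[R]_m :=
  [set y | forall i, 0 <= dot y (int_vec (lam i))].

(* No normal vector is redundant. *)
Definition minimal_normals : Prop :=
  forall j, exists y, dot y (int_vec (lam j)) < 0 /\
    forall i, i != j -> 0 <= dot y (int_vec (lam i)).

Definition strongly_convex : Prop :=
  forall y, polyhedral_cone y -> polyhedral_cone (- y) -> y = 0.

(* Linear combinations of the normals to the facets containing [y]. *)
Definition facet_comb (y : 'rV[R]_m) (a : 'I_d -> R) : 'rV[R]_m :=
  \sum_(i | dot y (int_vec (lam i)) == 0) a i *: int_vec (lam i).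

(* z_y *)
Definition facet_span (y : 'rV[R]_m) : set 'rV[R]_m :=
  [set v | exists a, v = facet_comb y a].

(* On each face, the normals to the facets containing it are linearly
   independent and generate all the lattice points of their real span. *)
Definition good_normals : Prop :=
  forall y, polyhedral_cone y -> y != 0 ->
    (forall a, facet_comb y a = 0 ->
       forall i, dot y (int_vec (lam i)) = 0 -> a i = 0) /\
    (forall v : 'rV[int]_m, facet_span y (int_vec v) ->
       exists b : 'I_d -> int, int_vec v = facet_comb y (fun i => (b i)%:~R)).

Definition good_cone (Delta : set 'rV[R]_m) : Prop :=
  [/\ forall i, primitive (lam i), minimal_normals, strongly_convex,
      good_normals & Delta = [set y | polyhedral_cone y /\ y != 0]].
End Cones.

End Smooth.

(* Main.v *)
(* In logarithmic coordinates the complex torus acts on the cone by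
   B z p = exp(z) . p, and F(p, t) = B (z t) p with
   z t = (kappa t) xi + i (f(t) xi + nu), since dilations are the action of the
   real multiples of xi.  The form Omega_gamma is multiplied by exp(gamma . z)
   under B z; at a real point, dF of a frame (u_k, s_k) is the image under B z of
   u_k + s_k (kappa' + i f') r d/dr, and its Omega_gamma-volume is
   (kappa' + i f') times a real number, because the u_k are real and orthogonal
   to both r d/dr and xi.  Hence, up to a real factor,
     F^* Omega_gamma = e^{i theta} (kappa' + i f') e^{N(kappa + i f)},
   and N (kappa' + i f') e^{N(kappa + i f)} is the derivative of
   e^{N(kappa + i f)}.  As gamma belongs to the moment cone, N > 0, so the special
   Lagrangian condition says that the imaginary part of
   e^{i(theta - theta_0)} e^{N(kappa + i f)} has zero derivative; for
   the necessity, the real factor is nonzero at some frame over each t. *)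

Require Import Defs.
From HB Require Import structures.
From mathcomp Require Import all_boot all_order all_algebra all_fingroup.
From mathcomp Require Import complex.
From mathcomp Require Import all_classical all_reals all_analysis.
From mathcomp Require Import ring lra zify.

Set Implicit Arguments.
Unset Strict Implicit.
Unset Printing Implicit Defensive.

Import Order.TTheory GRing.Theory Num.Theory numFieldNormedType.Exports.

Local Open Scope classical_set_scope.
Local Open Scope ring_scope.
Local Open Scope complex_scope.

(* [dom] alone denotes the domain of a MathComp morphism. *)
Local Notation mdom := Defs.dom.

(** * Wedge powers of a two-form on an isotropic frame *)

(** Orthogonality of real vectors to [xi] needs [sigma] to be an isometry, which is not part of its
    definition. On the open orbit, [sigma q] is the image of [q] under an element of the compact
    torus, and the differential of [sigma] conjugates the directions of the Lie algebra; this
    preserves the metric as soon as real and imaginary directions are orthogonal, that is, as soon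
    as the orbits of the compact torus are isotropic, which follows from closedness and homogeneity
    of the Kaehler form. Such identities hold on the open orbit and pass to the whole cone by
    density, hence the continuity statements below. Because eta(xi) = 1, the level set is contained
    in r^2 = 2c: its tangent vectors have no radial component, and c > 0. The Lagrangian angle
    prescribes the modulus of F^* Omega_gamma as well as its phase. The modulus comes from the
    equation defining [psi], evaluated on an isotropic frame followed by its image under [J]. The
    sign due to the ordering of this frame is never computed: it is recovered from the positivity of
    the product of Omega_gamma with its conjugate. *)

Section PermSum.
Variables p q : nat.

Definition perm_sum_fun (s : 'S_p) (t : 'S_q) (i : 'I_(p + q)) : 'I_(p + q) :=
  match fintype.split i with inl j => lshift q (s j) | inr j => rshift p (t j) end.

Lemma perm_sum_inj s t : injective (perm_sum_fun s t).
Proof.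
apply: (can_inj (g := perm_sum_fun s^-1%g t^-1%g)) => i; rewrite /perm_sum_fun.
case: (fintype.splitP i) => j ij /=.
  by rewrite (unsplitK (inl _)) permK; apply: val_inj.
by rewrite (unsplitK (inr _)) permK; apply: val_inj.
Qed.

Definition perm_sum s t : 'S_(p + q) := perm (@perm_sum_inj s t).

Lemma perm_suml s t j : perm_sum s t (lshift q j) = lshift q (s j).
Proof. by rewrite permE /perm_sum_fun (unsplitK (inl _)). Qed.

Lemma perm_sumr s t j : perm_sum s t (rshift p j) = rshift p (t j).
Proof. by rewrite permE /perm_sum_fun (unsplitK (inr _)). Qed.

(** The sign is the determinant of the permutation matrix, which is block diagonal here. *)
Lemma sign_perm_sum (K : comNzRingType) s t :
  (-1) ^+ perm_sum s t = (-1) ^+ s * (-1) ^+ t :> K.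
Proof.
rewrite -!det_perm -(det_ublock _ 0); congr (\det _).
apply/matrixP => i j; rewrite [LHS]mxE.
case: (split_ordP i) => i' ->; case: (split_ordP j) => j' ->;
  by rewrite ?(block_mxEul, block_mxEur, block_mxEdl, block_mxEdr) !mxE
    ?perm_suml ?perm_sumr eq_shift.
Qed.

End PermSum.

Section AlternatingSums.
Variable K : fieldType.
Hypothesis K0 : [pchar K] =i pred0.

(** Antisymmetrisation without a factorial: the normalisation of [wedge] then turns two such sums
    into a single one. *)
Definition altsum (V : Type) n (a : ('I_n -> V) -> K) (v : 'I_n -> V) : K :=
  \sum_(s : 'S_n) (-1) ^+ s * a (fun i => v (s i)).

(* The inner permutations of the two factors are absorbed into the outer one. *)
Lemma wedge_altsum (V : Type) p q (a : ('I_p -> V) -> K) (b : ('I_q -> V) -> K) :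
  wedge (altsum a) (altsum b) =
  altsum (fun v => a (fun i => v (lshift q i)) * b (fun i => v (rshift p i))).
Proof.
apply/funext => v; rewrite /wedge /altsum.
under eq_bigr => s _.
  rewrite -mulrA big_distrlr /= mulr_sumr.
  under eq_bigr => s1 _ do rewrite mulr_sumr.
  over.
rewrite exchange_big /=.
under eq_bigr => s1 _ do rewrite exchange_big /=.
set S := \sum_(s : 'S_(p + q)) _.
have -> : \sum_(s1 : 'S_p) \sum_(s2 : 'S_q) \sum_(s : 'S_(p + q))
    (-1) ^+ s * ((-1) ^+ s1 * a (fun i => v (s (lshift q (s1 i)))) *
                 ((-1) ^+ s2 * b (fun i => v (s (rshift p (s2 i)))))) =
    \sum_(s1 : 'S_p) \sum_(s2 : 'S_q) S.
  apply: eq_bigr => s1 _; apply: eq_bigr => s2 _.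
  rewrite /S [RHS](reindex_inj (mulgI (perm_sum s1 s2))) /=.
  apply: eq_bigr => s _.
  rewrite odd_permM signr_addb sign_perm_sum.
  rewrite (_ : (fun i => v ((perm_sum s1 s2 * s)%g (lshift q i))) =
               (fun i => v (s (lshift q (s1 i))))); last first.
    by apply/funext => i; rewrite permM perm_suml.
  rewrite (_ : (fun i => v ((perm_sum s1 s2 * s)%g (rshift p i))) =
               (fun i => v (s (rshift p (s2 i))))); last first.
    by apply/funext => i; rewrite permM perm_sumr.
  have swap (x y z u w : K) : x * (y * u * (z * w)) = y * z * x * (u * w) by ring.
  exact: swap.
rewrite !sumr_const !card_Sn -mulrnA -[S *+ _]mulr_natr natrM.
rewrite mulrA mulrAC -natrM mulnC mulVf ?mul1r//.
by move/pcharf0P: K0 => ->; rewrite muln_eq0 negb_or -!lt0n !fact_gt0.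
Qed.

Lemma form2_altsum (V : Type) (alpha : V -> V -> K) :
  form2 (fun x y => alpha x y - alpha y x) = altsum (form2 alpha).
Proof.
apply/funext => v; rewrite /form2 /altsum.
rewrite (bigD1 1%g) //= (bigD1 (tperm ord0 ord_max)) /=; last first.
  by apply/eqP => /(congr1 (fun s : 'S_2 => s ord0)); rewrite tpermL perm1.
rewrite odd_perm1 expr0 mul1r !perm1 odd_tperm expr1 tpermL tpermR mulN1r.
rewrite big1 ?addr0// => s /andP[s1 st].
suff: s = 1%g \/ s = tperm ord0 ord_max by case=> e; rewrite e eqxx in s1 st.
have ord2 (i : 'I_2) : i = ord0 \/ i = ord_max.
  by case: i => [[|[|//]] ?]; [left|right]; apply: val_inj.
have sne : s ord0 != s ord_max by rewrite (inj_eq perm_inj).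
case: (ord2 (s ord0)) => e0; case: (ord2 (s ord_max)) => e1.
- by rewrite e0 e1 in sne.
- left; apply/permP => i; rewrite perm1.
  by case: (ord2 i) => ->.
- right; apply/permP => i.
  by case: (ord2 i) => ->; rewrite ?tpermL ?tpermR.
- by rewrite e0 e1 in sne.
Qed.

Fixpoint pair_prod (V : Type) (alpha : V -> V -> K) k : ('I_(k * 2) -> V) -> K :=
  match k with
  | 0 => fun=> 1
  | k'.+1 => fun v => form2 alpha (fun i => v (lshift (k' * 2) i)) *
               pair_prod alpha (fun i => v (rshift 2 i))
  end.

(** The iterated wedge collapses to one sum over permutations of a product over consecutive pairs of
    arguments, as in the formula for a Pfaffian. *)
Lemma wedge_exp_altsum (V : Type) (alpha : V -> V -> K) (k : nat) :
  @wedge_exp K V 2 (form2 (fun x y => alpha x y - alpha y x)) k =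
  altsum (@pair_prod V alpha k).
Proof.
elim: k => [|k IH] /=; last by rewrite IH form2_altsum wedge_altsum.
apply/funext => v; rewrite /altsum (bigD1 1%g) //= big1 ?addr0.
  by rewrite odd_perm1 mul1r.
by move=> s; rewrite (_ : s = 1%g) ?eqxx//; apply/permP => -[].
Qed.

(** Naturality under pullback; it serves to replace the vectors of a frame by their indices, on
    which a two-form is just a matrix. *)
Lemma wedge_exp_comp (V V' : Type) (f : V' -> V) (w : V -> V -> K) (k : nat)
    (v : 'I_(k * 2) -> V') :
  @wedge_exp K V 2 (form2 w) k (fun i => f (v i)) =
  @wedge_exp K V' 2 (form2 (fun x y => w (f x) (f y))) k v.
Proof.
elim: k v => //= k IH v; rewrite /wedge; congr (_ * _).
by apply: eq_bigr => s _; rewrite IH.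
Qed.

Lemma even_ord_proof k (i : 'I_k) : (i * 2 < k * 2)%N.
Proof. by rewrite ltn_mul2r /=. Qed.

Lemma odd_ord_proof k (i : 'I_k) : ((i * 2).+1 < k * 2)%N.
Proof. by have := ltn_ord i; lia. Qed.

Lemma pair_prodE (V : Type) (alpha : V -> V -> K) k (v : 'I_(k * 2) -> V) :
  pair_prod alpha v =
  \prod_(i < k) alpha (v (Ordinal (even_ord_proof i))) (v (Ordinal (odd_ord_proof i))).
Proof.
elim: k v => [|k IH] v /=; first by rewrite big_ord0.
rewrite big_ord_recl IH /form2; congr (alpha (v _) (v _) * _); try exact: val_inj.
by apply: eq_bigr => i _; congr (alpha (v _) (v _)); apply: val_inj => /=.
Qed.

End AlternatingSums.

Section SquareDet.
Variable K : fieldType.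

Definition fun_mx m (phi : {ffun 'I_m -> 'I_m}) : 'M[K]_m :=
  \matrix_(i, j) (phi i == j)%:R.

(** A map that is not injective gives two equal rows; the others are the m! permutations, of
    determinant 1 or -1. *)
Lemma sum_sqr_det_fun_mx m : \sum_(phi : {ffun 'I_m -> 'I_m}) \det (fun_mx phi) ^+ 2 = (m`!)%:R.
Proof.
rewrite (bigID (fun phi : {ffun 'I_m -> 'I_m} => injectiveb phi)) /=.
rewrite [X in _ + X]big1 ?addr0; last first.
  move=> phi /injectivePn[i [j ij e]].
  by rewrite (determinant_alternate ij) ?expr0n//= => k; rewrite !mxE e.
rewrite -(card_Sn m) -sum1_card natr_sum.
rewrite (reindex (fun s : 'S_m => pval s)) /=; last first.
  exists (fun f => insubd (1%g : 'S_m) f) => [s _|f]; first by rewrite valKd.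
  by rewrite inE => fi; rewrite insubdK.
apply: eq_big => [s|s _]; first by rewrite inE; apply/injectiveP => x y; rewrite pvalE; exact: perm_inj.
rewrite (_ : fun_mx _ = perm_mx s) ?det_perm ?sqrr_sign//.
by apply/matrixP => i j; rewrite !mxE -pvalE.
Qed.

(* Writing the off-diagonal block as a sum of rank one terms, every choice of
   one term per factor contributes the determinant of a block diagonal matrix. *)
Lemma altsum_offdiag m (B : 'M[K]_m) :
  \sum_(s : 'S_(m + m)) (-1) ^+ s *
    \prod_(i < m) (block_mx 0 B 0 0 : 'M[K]_(m + m)) (s (lshift m i)) (s (rshift m i))
  = (m`!)%:R * \det B.
Proof.
pose P j (a : 'I_(m + m)) : K := (lshift m j == a)%:R.
pose Q j (b : 'I_(m + m)) : K := row_mx 0 B j b.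
have PQ a b : (block_mx 0 B 0 0 : 'M[K]_(m + m)) a b = \sum_(j < m) P j a * Q j b.
  rewrite /P /Q; case: (split_ordP a) => a' ->.
    rewrite (bigD1 a') //= eqxx mul1r big1 ?addr0; last first.
      by move=> j ja; rewrite eq_shift (negbTE ja) mul0r.
    case: (split_ordP b) => b' ->.
      by rewrite block_mxEul row_mxEl.
    by rewrite block_mxEur row_mxEr.
  rewrite big1; last by move=> j _; rewrite eq_shift mul0r.
  case: (split_ordP b) => b' ->.
    by rewrite block_mxEdl mxE.
  by rewrite block_mxEdr mxE.
under eq_bigr => s _.
  under eq_bigr => i _ do rewrite PQ.
  rewrite bigA_distr_bigA /= mulr_sumr; over.
rewrite exchange_big /= -sum_sqr_det_fun_mx mulr_suml; apply: eq_bigr => phi _.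
transitivity (\det (block_mx (fun_mx phi) 0 0 (fun_mx phi *m B))); last first.
  by rewrite det_ublock det_mulmx mulrA.
apply: eq_bigr => s _; congr (_ * _).
rewrite big_split_ord /= -big_split /=; apply: eq_bigr => i _.
rewrite /P /Q; congr (_ * _).
  case: (split_ordP (s (lshift m i))) => k ->; rewrite eq_shift.
    by rewrite block_mxEul mxE.
  by rewrite block_mxEur mxE.
case: (split_ordP (s (rshift m i))) => k ->.
  by rewrite block_mxEdl row_mxEl !mxE.
rewrite block_mxEdr row_mxEr [RHS]mxE (bigD1 (phi i)) //= mxE eqxx mul1r big1 ?addr0//.
by move=> j; rewrite mxE eq_sym => /negbTE ->; rewrite mul0r.
Qed.

(** Relabelling the slots composes every permutation with a fixed one, at the cost of a sign that
    depends on [q] only. The relabelling is needed because a wedge power pairs the slots 2i and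
    2i+1, whereas the blocks pair i and m+i. *)
Lemma altsum_offdiag_sign n m (q : 'I_(m + m) -> 'I_n) (e : n = (m + m)%N) :
  injective q ->
  exists b : bool, forall B : 'M[K]_m,
  \sum_(s : 'S_n) (-1) ^+ s *
    \prod_(i < m) (block_mx 0 B 0 0 : 'M[K]_(m + m))
      (cast_ord e (s (q (lshift m i)))) (cast_ord e (s (q (rshift m i))))
  = (-1) ^+ b * ((m`!)%:R * \det B).
Proof.
subst n => qi; exists (odd_perm (perm qi)) => B.
rewrite -altsum_offdiag mulr_sumr.
rewrite (reindex_inj (mulgI (perm qi)^-1%g)) /=; apply: eq_bigr => s _.
rewrite odd_permM odd_permV signr_addb -mulrA; congr (_ * (_ * _)).
apply: eq_bigr => i _; rewrite !cast_ord_id !permM.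
by rewrite -[q (lshift m i)](permE qi) -[q (rshift m i)](permE qi) !permK.
Qed.

End SquareDet.

Section UnitaryFrame.
Variables (R : realType) (m : nat) (V : Type).

Lemma pchar_real : [pchar R] =i pred0.
Proof. exact: pchar_num. Qed.

Lemma pchar_complex : [pchar R[i]] =i pred0.
Proof. exact: pchar_num. Qed.

(** When both halves of the frame are isotropic, the matrix of the form is the antisymmetrisation of
    its upper right block. The sign comes from the interleaving of the two halves and is fixed
    before the form and the frame. *)
Lemma wedge_exp_isotropic : exists b : bool, forall (w : V -> V -> R) (v : nat -> V) (B : 'M[R]_m),
  (forall j k : 'I_m, w (v j) (v k) = 0) ->
  (forall j k : 'I_m, w (v (m + j)%N) (v (m + k)%N) = 0) ->
  (forall j k : 'I_m, w (v j) (v (m + k)%N) = B j k) ->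
  (forall j k : 'I_m, w (v (m + k)%N) (v j) = - B j k) ->
  @wedge_exp R V 2 (form2 w) m (fun i : 'I_(m * 2) => v i) = (-1) ^+ b * ((m`!)%:R * \det B).
Proof.
have e : (m * 2 = m + m)%N by lia.
pose q (i : 'I_(m + m)) : 'I_(m * 2) := match fintype.split i with
  | inl j => Ordinal (even_ord_proof j) | inr j => Ordinal (odd_ord_proof j) end.
have ql j : q (lshift m j) = Ordinal (even_ord_proof j) by rewrite /q (unsplitK (inl _)).
have qr j : q (rshift m j) = Ordinal (odd_ord_proof j) by rewrite /q (unsplitK (inr _)).
have qi : injective q.
  move=> i j; case: (split_ordP i) => i' ->; case: (split_ordP j) => j' ->;
    rewrite ?ql ?qr => /(congr1 val) /= ij; try lia; congr (_ _ _); apply: val_inj => /=; lia.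
have [b Hb] := altsum_offdiag_sign R e qi.
exists b => w v B w00 w11 w01 w10.
pose al (i j : 'I_(m + m)) : R := (block_mx 0 B 0 0 : 'M[R]_(m + m)) i j.
rewrite -Hb (wedge_exp_comp (fun i : 'I_(m + m) => v i) w (fun i => cast_ord e i)).
rewrite (_ : (fun x y : 'I_(m + m) => w (v x) (v y)) = fun x y => al x y - al y x).
  rewrite wedge_exp_altsum ?pchar_real//; last exact: pchar_real.
  apply: eq_bigr => s _; rewrite pair_prodE; congr (_ * _); apply: eq_bigr => i _.
  by rewrite ql qr.
apply/funext => x; apply/funext => y; rewrite /al.
case: (split_ordP x) => x' ->; case: (split_ordP y) => y' -> /=.
- by rewrite !block_mxEul !mxE subr0 w00.
- by rewrite block_mxEur block_mxEdl !mxE subr0 w01.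
- by rewrite block_mxEur block_mxEdl !mxE sub0r w10.
- by rewrite !block_mxEdr !mxE subr0 w11.
Qed.

(** The second half of the frame is i times the first for the complex coordinates, and -i times the
    first for their conjugates, so the wedge is one determinant with four proportional blocks. *)
Lemma wedge_volume_form (h : R[i]) (zeta : 'I_m -> V -> R[i]) (v : nat -> V)
    (Om := fun u : 'I_m -> V => h * \det (\matrix_(j, k) zeta j (u k))) :
  (forall j (k : 'I_m), zeta j (v (m + k)%N) = 'i * zeta j (v k)) ->
  wedge Om (fun u => (Om u)^*) (fun i : 'I_(m + m) => v i) =
  (- 2%:R * 'i) ^+ m * (Om (fun k : 'I_m => v k) * (Om (fun k : 'I_m => v k))^*).
Proof.
move=> zJ.
have OmE : Om = altsum (fun u => h * \prod_j zeta j (u j)).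
  apply/funext => u; rewrite /Om /altsum mulr_sumr; apply: eq_bigr => s _.
  by rewrite mulrCA; congr (_ * (_ * _)); apply: eq_bigr => i _; rewrite mxE.
have OmcE : (fun u => (Om u)^*) = altsum (fun u => h^* * \prod_j (zeta j (u j))^*).
  apply/funext => u; rewrite OmE /altsum rmorph_sum; apply: eq_bigr => s _.
  by rewrite !rmorphM rmorphXn rmorphN1 rmorph_prod.
rewrite OmcE {1}OmE wedge_altsum; last exact: pchar_complex.
pose Z := \matrix_(j, k < m) zeta j (v k).
pose Zc : 'M[R[i]]_m := \matrix_(j, k < m) (zeta j (v k))^*.
have dZc : \det Zc = (\det Z)^*.
  rewrite -[RHS]det_map_mx; congr (\det _); apply/matrixP => i j; by rewrite !mxE.
transitivity (h * h^* * \det (block_mx Z ('i *: Z) Zc (- 'i *: Zc))).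
  rewrite /altsum mulr_sumr; apply: eq_bigr => s _.
  rewrite [in RHS]mulrCA; congr (_ * _).
  rewrite big_split_ord /= mulrACA; congr (_ * (_ * _)); apply: eq_bigr => i _.
    case: (split_ordP (s (lshift m i))) => k ->.
      by rewrite block_mxEul mxE.
    by rewrite block_mxEur !mxE zJ.
  case: (split_ordP (s (rshift m i))) => k ->.
    by rewrite block_mxEdl mxE.
  by rewrite block_mxEdr !mxE zJ rmorphM /= conjCi.
(* Row reduction of the 2 by 2 matrix with rows (1, i) and (1, -i); its lower right pivot -2i
   produces the constant. *)
have -> : block_mx Z ('i *: Z) Zc (- 'i *: Zc) =
    block_mx Z 0 0 Zc *m (block_mx 1%:M 0 1%:M 1%:M *m
      block_mx 1%:M ('i *: 1%:M) 0 (- 2%:R * 'i *: 1%:M)).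
  rewrite !mulmx_block !mul1mx !mulmx0 !mul0mx !addr0 !add0r !mulmx1.
  congr block_mx; rewrite ?mulmx1 -?scalemxAr ?mulmx1//.
  by rewrite -scalerDl -scalemxAr mulmx1; congr (_ *: _); ring.
rewrite !det_mulmx !det_ublock det_lblock !det1 !mul1r detZ det1 mulr1 dZc /Om.
rewrite rmorphM /= -/Z; ring.
Qed.

End UnitaryFrame.

(** * Gram determinants and rank one perturbations *)

Section Gram.
Variable R : realType.

(** The quadratic form of the combination is positive off the origin as long as the identity has
    positive weight, which excludes a kernel vector. *)
Lemma mulmx_gram_gt0 m (B : 'M[R]_m) (s : R) :
  (forall x : 'rV[R]_m, 0 <= (x *m B *m x^T) 0 0) -> 0 <= s -> s < 1 ->
  \det ((1 - s)%:M + s *: B) != 0.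
Proof.
move=> B0 s0 s1; apply/negP => /det0P[x x0].
move=> /(congr1 (fun y => (y *m x^T) 0 0)); rewrite mul0mx [RHS]mxE.
rewrite mulmxDr mulmxDl mxE mul_mx_scalar -scalemxAr -!scalemxAl.
rewrite [X in X + _]mxE [X in _ + X]mxE.
apply/eqP; rewrite gt_eqF// ltr_pwDl//; last by rewrite mulr_ge0.
rewrite mulr_gt0 ?subr_gt0// mxE.
have [k xk] : exists k, x 0 k != 0.
  apply/existsP; apply: contraNT x0 => /existsPn x0; apply/eqP/rowP => k.
  by rewrite mxE; apply/eqP/negPn; exact: x0.
rewrite (bigD1 k) //= mxE ltr_pwDl//; first by rewrite -expr2 exprn_even_gt0.
by apply: sumr_ge0 => j _; rewrite mxE -expr2 sqr_ge0.
Qed.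

(* The segment from the identity to [B] consists of nonsingular matrices, except
   possibly at its end [B]. *)
Lemma det_gram_ge0 m (B : 'M[R]_m) :
  (forall x : 'rV[R]_m, 0 <= (x *m B *m x^T) 0 0) -> 0 <= \det B.
Proof.
move=> B0; rewrite leNgt; apply/negP => detB.
(* The determinant along the segment is a polynomial in the parameter: a negative value at 1 would
   force a root in between. *)
pose P : {poly R} := \det (\matrix_(i, j) ((1 - 'X) * (i == j)%:R%:P + 'X * (B i j)%:P)).
have PE s : P.[s] = \det ((1 - s)%:M + s *: B).
  rewrite /P -horner_evalE -det_map_mx; congr (\det _).
  apply/matrixP => i j; rewrite !mxE /= horner_evalE !hornerE.
  by case: eqP => _; rewrite ?mulr1n ?mulr0n ?mulr1 ?mulr0.
have P0 : 0 < P.[0] by rewrite PE subr0 scale0r addr0 det1.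
have P1 : P.[1] < 0 by rewrite PE subrr scale1r raddf0 add0r.
have [|s] := @poly_ivt _ (- P) 0 1 ler01.
  by rewrite !hornerN oppr_le0 oppr_ge0 !ltW.
move=> /andP[s0]; rewrite le_eqVlt => /predU1P[->|s1] /rootP.
  by rewrite hornerN => /eqP; rewrite oppr_eq0 lt_eqF.
by apply/eqP; rewrite hornerN oppr_eq0 PE mulmx_gram_gt0.
Qed.

(** The matrix determinant lemma, from the two Schur complements of the block matrix with blocks 1,
    l, -b, 1. *)
Lemma det_rank1 (K : fieldType) m (b : 'cV[K]_m) (l : 'rV[K]_m) :
  \det (1%:M + b *m l) = 1 + (l *m b) 0 0.
Proof.
have e1 : block_mx 1%:M (- l) 0 1%:M *m block_mx 1%:M l (- b) 1%:M =
    block_mx (1%:M + l *m b) 0 (- b) 1%:M :> 'M[K]_(1 + m).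
  rewrite mulmx_block !mul1mx !mulmx1 !mul0mx !add0r mulNmx mulmxN opprK.
  by rewrite addrN.
have e2 : block_mx 1%:M 0 b 1%:M *m block_mx 1%:M l (- b) 1%:M =
    block_mx 1%:M l 0 (1%:M + b *m l) :> 'M[K]_(1 + m).
  rewrite mulmx_block !mul1mx !mulmx1 !mul0mx !addr0 addrN.
  by rewrite [b *m l + _]addrC.
have := congr1 determinant e1; rewrite det_mulmx det_ublock det_lblock !det1 !mul1r mulr1.
have := congr1 determinant e2; rewrite det_mulmx det_ublock det_lblock !det1 !mul1r => -> ->.
by rewrite det_mx11 !mxE eqxx.
Qed.

(** The matrix 1 + c b l fixes every column killed by [l]; the constant [c] is chosen so that it
    also sends [b] to z b, and then its determinant is z. *)
Lemma det_scale_direction (K : fieldType) m (U : 'M[K]_m) (b : 'cV[K]_m) (l s : 'rV[K]_m)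
    (z : K) : l *m U = 0 -> (l *m b) 0 0 != 0 ->
  \det (U + z *: (b *m s)) = z * \det (U + b *m s).
Proof.
move=> lU lb; set c := ((z - 1) / (l *m b) 0 0).
have -> : U + z *: (b *m s) = (1%:M + (c *: b) *m l) *m (U + b *m s).
  rewrite mulmxDl mul1mx mulmxDr -!mulmxA lU mulmx0 add0r -addrA; congr (_ + _).
  rewrite (mulmxA l) [l *m b]mx11_scalar mul_scalar_mx -scalemxAr -scalemxAl scalerA.
  by rewrite /c mulrC divfK// -{2}[b *m s]scale1r -scalerDl addrC subrK.
rewrite det_mulmx det_rank1 -scalemxAr mxE /c divfK//.
by rewrite addrC subrK.
Qed.
End Gram.

(** * The modulus of a complex volume form on an isotropic frame *)

Section UnitaryFrameNorm.
Variables (R : realType) (m : nat) (V : Type).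

Lemma half_i_double (C : numClosedFieldType) : 'i / 2%:R * (- 2%:R * 'i) = 1 :> C.
Proof.
by rewrite mulNr mulrN mulrA mulfVK ?pnatr_eq0// -expr2 sqrCi opprK.
Qed.

(** Positivity replaces the computation of the two signs: a wrong total sign is only possible when D
    = 0. *)
Lemma sign_nonneg n (b : bool) (D : R) : 0 <= D ->
  0 <= (-1) ^+ n * ((-1) ^+ b * D)%:C -> (-1) ^+ n * ((-1) ^+ b * D)%:C = D%:C.
Proof.
move=> D0; rewrite -signr_odd.
have neg : 0 <= - D%:C -> - D%:C = D%:C.
  rewrite oppr_ge0 (lecR D 0) => D0'.
  have -> : D = 0 by apply/eqP; rewrite eq_le D0 D0'.
  by rewrite oppr0.
case: (odd n); case: b; rewrite ?expr0 ?expr1 ?mulN1r ?mul1r// !rmorphN /= ?opprK//.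
Qed.

(** The equation defining the conformal factor [r] is evaluated on the frame x followed by J x,
    where one side is the determinant of [B] up to sign and the other a squared modulus. *)
Lemma norm_volume_form (w : V -> V -> R) (J : V -> V) (h : R[i])
    (zeta : 'I_m -> V -> R[i]) (r : R) (x0 : V) (x : 'I_m -> V) (B : 'M[R]_m)
    (Om := fun u : 'I_m -> V => h * \det (\matrix_(j, k) zeta j (u k))) :
  (forall v : nat -> V,
    (expR ((2 * m)%:R * r) *
       (@wedge_exp R V 2 (form2 w) m (fun i : 'I_(m * 2) => v i) / (m`!)%:R))%:C
    = (-1) ^+ (m * (m - 1))./2 * ((0 +i* 1) / 2%:R) ^+ m *
      wedge Om (fun u => (Om u)^*) (fun i : 'I_(m + m) => v i)) ->
  (forall j u, zeta j (J u) = 'i * zeta j u) ->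
  (forall j k, w (x j) (x k) = 0) ->
  (forall j k, w (J (x j)) (J (x k)) = 0) ->
  (forall j k, w (x j) (J (x k)) = B j k) ->
  (forall j k, w (J (x k)) (x j) = - B j k) ->
  (forall y : 'rV[R]_m, 0 <= (y *m B *m y^T) 0 0) ->
  Om x * (Om x)^* = (expR (m%:R * r) ^+ 2 * \det B)%:C.
Proof.
move=> acy zJ w00 w11 w01 w10 B0.
have [b Hb] := wedge_exp_isotropic R m V.
(* The value [x0] only fills the indices from 2m on, which neither side reads. *)
pose v n := if (insub n : option 'I_m) is Some k then x k else
            if (insub (n - m)%N : option 'I_m) is Some k then J (x k) else x0.
have vl (k : 'I_m) : v k = x k by rewrite /v valK.
have vr (k : 'I_m) : v (m + k)%N = J (x k).
  by rewrite /v insubN ?addKn ?valK// -leqNgt leq_addr.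
have := acy v; rewrite (Hb w v B); last 4 first.
- by move=> j k; rewrite !vl.
- by move=> j k; rewrite !vr.
- by move=> j k; rewrite vl vr.
- by move=> j k; rewrite vl vr.
rewrite wedge_volume_form; last by move=> j k; rewrite vl vr zJ.
have -> : h * \det (\matrix_(j, k) zeta j (v k)) = Om x.
  by congr (_ * \det _); apply/matrixP => j k; rewrite !mxE vl.
rewrite [X in _ = X](mulrA _ ((- 2%:R * 'i) ^+ m)) -(mulrA _ (_ ^+ m) (_ ^+ m)) -exprMn.
rewrite (_ : (0 +i* 1) / 2%:R * (- 2%:R * 'i) = 1 :> R[i]); last first.
  by rewrite complexiE half_i_double.
rewrite expr1n mulr1 => /(congr1 (fun z : R[i] => (-1) ^+ (m * (m - 1))./2 * z)).
rewrite signrMK => E.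
have m0 : (m`!)%:R != 0 :> R by rewrite pnatr_eq0 -lt0n fact_gt0.
have eE : expR ((2 * m)%:R * r) * ((-1) ^+ b * ((m`!)%:R * \det B) / (m`!)%:R) =
    (-1) ^+ b * (expR (m%:R * r) ^+ 2 * \det B).
  rewrite [X in _ * (X / _)]mulrCA mulrAC divff// mul1r mulrCA; congr (_ * (_ * _)).
  by rewrite -expRM_natl natrM mulrA.
rewrite eE in E.
have : (0 : R[i]) <= Om x * (Om x)^* by rewrite mul_conjC_ge0.
move: E => <-; apply: sign_nonneg.
by rewrite mulr_ge0 ?exprn_ge0 ?expR_ge0// det_gram_ge0.
Qed.
End UnitaryFrameNorm.

(** * Calculus in finite-dimensional spaces *)

Section Calculus.
Variable R : realType.
Implicit Types U V W : normedModType R.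

Lemma near_eq_diff V W (f g : V -> W) (x : V) : (\near x, f x = g x) ->
  differentiable f x -> differentiable g x /\ 'd g x = 'd f x :> (V -> W).
Proof.
move=> fg df.
have E : g \o shift x = cst (g x) + 'd f x +o_ 0 id.
  apply/eqaddoP => e e0 /=.
  have := diff_locally df => /eqaddoP/(_ e e0).
  have fg0 : \forall y \near 0, f (y + x) = g (y + x).
    have := near_shift 0 x (fun y => f y = g y); rewrite /= => fgx.
    rewrite fgx in fg; apply: filterS fg => y /=; by rewrite subr0.
  apply: filter_app; near=> y => /=.
  by rewrite /= !fctE /= (near fg0 y)// (nbhs_singleton fg).
have dg : 'd g x = 'd f x :> (V -> W) by apply: diff_unique => //; exact: diff_continuous.
split=> //; apply/diff_locallyP; rewrite dg; split=> //; exact: diff_continuous.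
Unshelve. all: by end_near. Qed.

(** Continuous linear maps, characterised as those equal to their own differential everywhere; this
    form applies to a plain function and directly gives its derivatives. *)
Definition clinear V W (f : V -> W) : Prop :=
  forall x, differentiable f x /\ 'd f x = f :> (V -> W).

Lemma clinear_linear V W (f : {linear V -> W}) : continuous f -> clinear f.
Proof.
by move=> fc x; split; [exact: linear_differentiable|exact: diff_lin].
Qed.

Lemma clinear_continuous V W (f : V -> W) : clinear f -> continuous f.
Proof. by move=> lf x; apply: differentiable_continuous; have [] := lf x. Qed.

Lemma clinear_comp V W U (f : V -> W) (g : W -> U) :
  clinear f -> clinear g -> clinear (g \o f).
Proof.
move=> lf lg x; have [df dfE] := lf x; have [dg dgE] := lg (f x).
by split; [exact: differentiable_comp|rewrite diff_comp// dgE dfE].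
Qed.

(** A finite spanning family with continuous linear coordinates. [Ck] differentiates along fixed
    directions, while the chain rule produces a direction depending on the point; it has to be
    expanded in such a family. *)
Class findim V : Prop := Findim { findim_ex :
  exists n (e : 'I_n -> V) (l : 'I_n -> V -> R),
    (forall i, clinear (l i)) /\ forall v, v = \sum_i l i v *: e i }.

Lemma clinear_fst V W : clinear (@fst V W).
Proof.
have fc : continuous (@fst V W) by move=> x; exact: cvg_fst.
exact: (@clinear_linear _ _ (@fst V W : {linear _ -> _}) fc).
Qed.

Lemma clinear_snd V W : clinear (@snd V W).
Proof.
have fc : continuous (@snd V W) by move=> x; exact: cvg_snd.
exact: (@clinear_linear _ _ (@snd V W : {linear _ -> _}) fc).
Qed.

Lemma clinear_id V : clinear (@id V).
Proof. by move=> x; split; [exact: ex_diff|exact: diff_val]. Qed.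

Lemma clinear_scalel V (w : V) : clinear (fun a : R => a *: w).
Proof. by move=> x; split; [exact: ex_diff|exact: diff_val]. Qed.

Lemma clinear_pair V W U (f : V -> W) (g : V -> U) :
  clinear f -> clinear g -> clinear (fun x => (f x, g x)).
Proof.
move=> lf lg x; have [df dfE] := lf x; have [dg dgE] := lg x.
by split; [exact: differentiable_pair|rewrite diff_pair// dgE dfE].
Qed.

Lemma clinear0 V W : clinear (fun _ : V => 0 : W).
Proof. by move=> x; split; [exact: differentiable_cst|exact: diff_cst]. Qed.

Lemma clinear_coord m n i j : clinear (fun M : 'M[R]_(m, n) => M i j).
Proof.
move=> M; split; first exact: differentiable_coord.
have @f : {linear 'M[R]_(m, n) -> R}.
  by exists (fun N : 'M[R]_(_, _) => N i j); do 2![eexists]; do ?[constructor];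
     rewrite ?mxE// => ? *; rewrite ?mxE//; move=> ?; rewrite !mxE.
rewrite (_ : (fun _ => _) = f) //; apply: diff_lin; exact/coord_continuous.
Qed.

Global Instance findim_prod V W : findim V -> findim W -> findim (V * W)%type.
Proof.
move=> [[n [e [l [ll el]]]]] [[n' [e' [l' [ll' el']]]]].
split; exists (n + n')%N.
exists (fun i => match fintype.split i with inl j => (e j, 0) | inr j => (0, e' j) end).
exists (fun i => match fintype.split i with inl j => l j \o fst | inr j => l' j \o snd end).
split.
  move=> i; case: fintype.split => j.
    exact: (clinear_comp (@clinear_fst V W) (ll j)).
  exact: (clinear_comp (@clinear_snd V W) (ll' j)).
move=> [v w]; rewrite big_split_ord /=.
under eq_bigr => i _ do rewrite (unsplitK (inl _)) /=.
under [X in _ + X]eq_bigr => i _ do rewrite (unsplitK (inr _)) /=.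
rewrite [RHS]surjective_pairing /= !raddf_sum /=.
rewrite [X in (_ + X, _)]big1 ?addr0; last by move=> i _; rewrite scaler0.
rewrite [X in (_, X + _)]big1 ?add0r; last by move=> i _; rewrite scaler0.
by rewrite -el -el'.
Qed.

Global Instance findim_real : findim R.
Proof.
split; exists 1, (fun=> 1), (fun=> id); split => [i|v]; first exact: clinear_id.
by rewrite big_ord1 /GRing.scale /= mulr1.
Qed.

Global Instance findim_rV n : findim 'rV[R]_n.
Proof.
split; exists n, (fun i => delta_mx 0 i), (fun i (v : 'rV[R]_n) => v 0 i).
by split => [i|v]; [exact: clinear_coord|exact: row_sum_delta].
Qed.

Lemma open_near V (U : set V) x : open U -> U x -> \forall y \near x, U y.
Proof. by move=> oU Ux; apply: open_nbhs_nbhs. Qed.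

Lemma Ck_ext V W k (U : set V) (f g : V -> W) : open U ->
  (forall x, U x -> f x = g x) -> Ck k U f -> Ck k U g.
Proof.
move=> oU; elim: k f g => [|k IH] f g fg /=.
  move=> fc x Ux.
  have fgx : \forall y \near x, g y = f y.
    by apply: filterS (open_near oU Ux) => y /fg.
  have gx : g x = f x := nbhs_singleton fgx.
  change (g @ x --> g x); rewrite gx; apply: cvg_trans (fc x Ux).
  by apply: near_eq_cvg; apply: filterS fgx => y ->.
move=> [df Df]; split.
  move=> x Ux; apply: (near_eq_diff _ (df x Ux)).1.
  by apply: filterS (open_near oU Ux) => y /fg.
move=> v; apply: IH (Df v) => x Ux; apply: near_eq_derive.
by apply: filterS (open_near oU Ux) => y /fg.
Qed.

Lemma Ck_sub V W k (U U' : set V) (f : V -> W) : U' `<=` U -> Ck k U f -> Ck k U' f.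
Proof.
move=> UU; elim: k f => [|k IH] f /=; first by move=> fc x /UU/fc.
by move=> [df Df]; split=> [x /UU/df|v]; [|exact: IH].
Qed.

Lemma Ck_local V W k (U : set V) (f : V -> W) :
  (forall x, U x -> exists U' : set V, U' x /\ Ck k U' f) -> Ck k U f.
Proof.
elim: k f => [|k IH] f /= Uf.
  by move=> x /Uf[U' [U'x]]; apply.
split=> [x /Uf[U' [U'x []]]|v]; first by move=> + _; apply.
by apply: IH => x /Uf[U' [U'x [_ Df]]]; exists U'.
Qed.

Lemma CkS V W k (U : set V) (f : V -> W) : Ck k.+1 U f -> Ck k U f.
Proof.
elim: k f => [|k IH] f /=.
  by move=> [df _] x Ux; apply: differentiable_continuous; exact: df.
by move=> [df Df]; split=> // v; exact: IH.
Qed.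

Lemma Ck_continuous V W k (U : set V) (f : V -> W) x : U x -> Ck k U f -> {for x, continuous f}.
Proof. by move=> Ux; elim: k => [|k IH /CkS]//; exact. Qed.

Lemma Ck_cst V W k (U : set V) (w : W) : Ck k U (fun=> w).
Proof.
elim: k w => [|k IH] w /=; first by move=> x _; exact: cst_continuous.
split=> [x _|v]; first exact: differentiable_cst.
have -> : (fun x => 'D_v (fun _ : V => w) x) = fun=> 0; last exact: IH.
by apply/funext => x; exact: derive_cst.
Qed.

Lemma Ck_clinear V W k (U : set V) (f : V -> W) : clinear f -> Ck k U f.
Proof.
case: k => [|k] lf /=; first by move=> x _; exact: clinear_continuous.
split=> [x _|v]; first by have [] := lf x.
rewrite (_ : (fun x => _) = fun=> f v); first exact: Ck_cst.
by apply/funext => x; have [df dfE] := lf x; rewrite deriveE// dfE.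
Qed.

Lemma CkD V W k (U : set V) (f g : V -> W) : open U ->
  Ck k U f -> Ck k U g -> Ck k U (fun x => f x + g x).
Proof.
move=> oU; elim: k f g => [|k IH] f g /=.
  by move=> fc gc x Ux; apply: continuousD; [exact: fc|exact: gc].
move=> [df Df] [dg Dg]; split=> [x Ux|v].
  by apply: differentiableD; [exact: df|exact: dg].
apply: Ck_ext (IH _ _ (Df v) (Dg v)) => // x Ux.
by rewrite -deriveD//; apply: diff_derivable; [exact: df|exact: dg].
Qed.

Lemma Ck_sum V W k (U : set V) n (f : 'I_n -> V -> W) : open U ->
  (forall i, Ck k U (f i)) -> Ck k U (fun x => \sum_i f i x).
Proof.
move=> oU; elim: n f => [|n IH] f fk.
  by apply: Ck_ext (Ck_cst k U 0) => // x _; rewrite big_ord0.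
apply: (Ck_ext (f := fun x => f ord0 x + \sum_i f (lift ord0 i) x)) => //.
  by move=> x _; rewrite big_ord_recl.
by apply: CkD => //; apply: IH.
Qed.

Lemma CkM V k (U : set V) (f g : V -> R) : open U ->
  Ck k U f -> Ck k U g -> Ck k U (fun x => f x * g x).
Proof.
move=> oU; elim: k f g => [|k IH] f g /=.
  by move=> fc gc x Ux; apply: continuousM; [exact: fc|exact: gc].
move=> [df Df] [dg Dg]; split=> [x Ux|v].
  by apply: differentiableM; [exact: df|exact: dg].
have fk : Ck k U f by exact: CkS.
have gk : Ck k U g by exact: CkS.
apply: Ck_ext (CkD oU (IH _ _ fk (Dg v)) (IH _ _ gk (Df v))) => // x Ux.
by rewrite -deriveM//; apply: diff_derivable; [exact: df|exact: dg].
Qed.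

Lemma Ck_lcomp V W W' k (U : set V) (f : V -> W) (l : W -> W') : open U ->
  clinear l -> Ck k U f -> Ck k U (fun x => l (f x)).
Proof.
move=> oU ll; elim: k f => [|k IH] f /=.
  by move=> fc x Ux; apply: continuous_comp; [exact: fc|exact: clinear_continuous].
move=> [df Df]; split=> [x Ux|v].
  by apply: differentiable_comp; [exact: df|have [] := ll (f x)].
apply: Ck_ext (IH _ (Df v)) => // x Ux.
have [dl dlE] := ll (f x); have dfx := df x Ux.
rewrite !deriveE//; last exact: (differentiable_comp dfx dl).
by rewrite (diff_comp dfx dl) /= dlE.
Qed.

Lemma Ck_pair V W W' k (U : set V) (f : V -> W) (g : V -> W') : open U ->
  Ck k U f -> Ck k U g -> Ck k U (fun x => (f x, g x)).
Proof.
move=> oU fk gk.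
have l1 : clinear (fun w : W => (w, 0 : W')).
  exact: clinear_pair (@clinear_id W) (@clinear0 W W').
have l2 : clinear (fun w : W' => (0 : W, w)).
  exact: clinear_pair (@clinear0 W' W) (@clinear_id W').
apply: Ck_ext (CkD oU (Ck_lcomp oU l1 fk) (Ck_lcomp oU l2 gk)) => // x _.
by rewrite /= -[_ + _]/(f x + 0, 0 + g x) addr0 add0r.
Qed.

Lemma CkZ V W {WF : findim W} k (U : set V) (a : V -> R) (f : V -> W) : open U ->
  Ck k U a -> Ck k U f -> Ck k U (fun x => a x *: f x).
Proof.
move=> oU ak fk; have [[n [e [l [ll el]]]]] := WF.
apply: (Ck_ext (f := fun x => \sum_i (a x * l i (f x)) *: e i)) => //.
  move=> x _; rewrite [in RHS](el (f x)) scaler_sumr.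
  by apply: eq_bigr => i _; rewrite scalerA.
apply: Ck_sum => // i.
by apply: (Ck_lcomp oU (@clinear_scalel W (e i))); apply: CkM => //; exact: Ck_lcomp.
Qed.

Lemma derive_basis V W n (e : 'I_n -> V) (l : 'I_n -> V -> R) (g : V -> W) x v :
  (forall v, v = \sum_i l i v *: e i) -> differentiable g x ->
  'D_v g x = \sum_i l i v *: 'D_(e i) g x.
Proof.
move=> el dg; rewrite deriveE// [in LHS](el v) linear_sum; apply: eq_bigr => i _.
by rewrite linearZ deriveE.
Qed.

(** The derivative of the composite is the sum over i of the i-th coordinate of ['D_v f] times
    ['D_(e i) g] composed with [f]: the directions are now fixed, so the induction hypothesis
    applies to each term. *)
Lemma Ck_comp V V' W {VF : findim V'} {WF : findim W} k (U : set V) (U' : set V')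
    (f : V -> V') (g : V' -> W) : open U -> (forall x, U x -> U' (f x)) ->
  Ck k U f -> Ck k U' g -> Ck k U (fun x => g (f x)).
Proof.
move=> oU UU'; elim: k f g UU' => [|k IH] f g UU' /=.
  by move=> fc gc x Ux; apply: continuous_comp; [exact: fc|apply: gc; exact: UU'].
move=> [df Df] [dg Dg].
have dgf x : U x -> differentiable (g \o f) x.
  by move=> Ux; apply: differentiable_comp; [exact: df|apply: dg; exact: UU'].
split=> // v; have [[n [e [l [ll el]]]]] := VF.
apply: (Ck_ext (f := fun x => \sum_i l i ('D_v f x) *: 'D_(e i) g (f x))) => //.
  move=> x Ux; have dfx := df x Ux; have dgx := dg _ (UU' x Ux).
  rewrite -(derive_basis _ el)// !deriveE//; last exact: dgf.
  by have /(congr1 (@^~ v)) /= := diff_comp dfx dgx.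
apply: Ck_sum => // i; apply: CkZ => //.
  by apply: Ck_lcomp => //.
by apply: (IH f ('D_(e i) g) UU') => //; apply: CkS; split.
Qed.

Lemma derive_real (W : normedModType R) (f : R -> W) v x : differentiable f x ->
  'D_v f x = v *: 'D_1 f x.
Proof.
by move=> df; rewrite !deriveE// -[in LHS](mulr1 v) -[v * 1]/(v *: 1) linearZ.
Qed.

Lemma Ck_expR k (U : set R) : Ck k U expR.
Proof.
apply: (@Ck_sub _ _ _ setT) => //.
have dexp (x : R) : differentiable expR x by apply/derivable1_diffP; exact: derivable_expR.
elim: k => [|k IH] /=; first by move=> x _; exact: continuous_expR.
split=> // v; apply: (Ck_ext (f := fun x => v * expR x)) => //.
- exact: openT.
- by move=> x _; rewrite derive_real// derive_val.
- by apply: CkM => //; [exact: openT|exact: Ck_cst].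
Qed.

Lemma Ck_trigo k : Ck k setT (@cos R) /\ Ck k setT (@sin R).
Proof.
have dcos (x : R) : differentiable (@cos R) x by apply/derivable1_diffP; exact: derivable_cos.
have dsin (x : R) : differentiable (@sin R) x by apply/derivable1_diffP; exact: derivable_sin.
elim: k => [|k [IHc IHs]] /=.
  by split=> x _; [exact: continuous_cos|exact: continuous_sin].
split; split=> // v.
  apply: (Ck_ext (f := fun x => (- v) * sin x)) => //.
  - exact: openT.
  - by move=> x _; rewrite derive_real// derive_val /GRing.scale /= mulrN mulNr.
  - by apply: CkM => //; [exact: openT|exact: Ck_cst].
apply: (Ck_ext (f := fun x => v * cos x)) => //.
- exact: openT.
- by move=> x _; rewrite derive_real// derive_val.
- by apply: CkM => //; [exact: openT|exact: Ck_cst].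
Qed.

(** * Symmetry of second derivatives *)

Lemma derive_line V W (f : V -> W) (a y : V) (s : R) : differentiable f (s *: a + y) ->
  is_derive s 1 (fun t : R => f (t *: a + y)) ('D_a f (s *: a + y)).
Proof.
move=> df.
have ll : is_diff s (fun t : R => t *: a + y) ( *:%R ^~ a).
  have -> : (fun t : R => t *: a + y) = ( *:%R ^~ a) + cst y by [].
  by apply: is_diff_eq; rewrite addr0.
have dl : differentiable (fun t : R => t *: a + y) s by [].
have dfl : differentiable (f \o (fun t : R => t *: a + y)) s.
  exact: differentiable_comp dl df.
split; first exact: diff_derivable dfl.
rewrite (deriveE _ dfl) (diff_comp dl df) /= deriveE//.
by congr ('d f _ _); rewrite diff_val scale1r.
Qed.

(** The mean value theorem along [a] turns the second difference into an increment of ['D_a f],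
    which is estimated by two first order expansions of ['D_a f] at [x]. *)
Lemma second_difference V (U : set V) (f : V -> R) (x a b : V) (eps : R) :
  open U -> U x -> Ck 2 U f -> 0 < eps -> exists2 d, 0 < d &
  forall h, 0 < h < d ->
  `|(f (h *: a + (h *: b + x)) - f (h *: a + x)) - (f (h *: b + x) - f x)
     - h ^+ 2 * 'D_b ('D_a f) x| <= eps * h ^+ 2.
Proof.
move=> oU Ux [df /(_ a) [dDf _]] e0; set G := 'D_a f.
have dG : differentiable G x by exact: dDf.
(* A displacement u a + v b with u, v in [0, h] has norm at most h C; the summand 1 keeps C
   positive. With tolerance eps / (2 C), each of the two expansions costs eps h / 2. *)
pose C := `|a| + `|b| + 1; have C0 : 0 < C by rewrite ltr_wpDl// addr_ge0.
have /eqaddoP/(_ (eps / (2 * C))) := diff_locally dG.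
rewrite divr_gt0// ?mulr_gt0// => /(_ isT) near1.
have near2 : \forall y \near 0, U (y + x).
  have := near_shift 0 x U; rewrite /= => Ux'.
  have := open_near oU Ux; rewrite Ux'; apply: filterS => y /=; by rewrite subr0.
have [d /= d0 dP] := (@nbhs_ballP _ _ (0 : V) _).1 (filterI near1 near2).
exists (d / C); first by rewrite divr_gt0.
move=> h /andP[h0 hd].
have in_C (u v : R) : 0 <= u <= h -> 0 <= v <= h -> `|u *: a + v *: b| <= h * C.
  move=> /andP[u0 uh] /andP[v0 vh]; apply: le_trans (ler_normD _ _) _.
  rewrite !normrZ !ger0_norm// /C !mulrDr mulr1 -[leLHS]addr0.
  by apply: lerD; [apply: lerD; exact: ler_wpM2r|exact: ltW].
have in_d (u v : R) : 0 <= u <= h -> 0 <= v <= h -> `|u *: a + v *: b| < d.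
  by move=> uh vh; apply: le_lt_trans (in_C u v uh vh) _; rewrite -ltr_pdivlMr.
have inU u v : 0 <= u <= h -> 0 <= v <= h -> U (u *: a + (v *: b + x)).
  move=> uh vh; rewrite addrA; apply: (dP _ _).2.
  by rewrite -ball_normE /= sub0r normrN in_d.
have hh : 0 <= h <= h by rewrite lexx ltW.
have h00 : (0 : R) <= (0 : R) <= h by apply/andP; split; [exact: lexx|exact: ltW].
pose g s := f (s *: a + (h *: b + x)) - f (s *: a + x).
have inU0 s : 0 <= s <= h -> U (s *: a + x).
  by move=> sh; have := inU s 0 sh h00; rewrite scale0r add0r.
have dg s : 0 <= s <= h -> is_derive s 1 g (G (s *: a + (h *: b + x)) - G (s *: a + x)).
  move=> sh; apply: is_deriveB; apply: derive_line; apply: df; [exact: inU|exact: inU0].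
have [||c] := @MVT R g (fun s => G (s *: a + (h *: b + x)) - G (s *: a + x)) 0 h h0.
- by move=> s; rewrite in_itv /= => /andP[s0 sh]; apply: dg; rewrite !ltW.
- apply: continuous_in_subspaceT => s; rewrite inE /= in_itv /= => sh.
  have [dgs _] := dg s sh.
  by apply: differentiable_continuous; apply/derivable1_diffP.
rewrite in_itv /= => /andP[c0 ch]; rewrite /g scale0r !add0r subr0 => ->.
have c0h : 0 <= c <= h by rewrite !ltW.
have E u v : 0 <= u <= h -> 0 <= v <= h ->
    `|G (u *: a + (v *: b + x)) - (G x + 'd G x (u *: a + v *: b))| <=
    eps / 2 * h.
  move=> uh vh; have uvd := in_d u v uh vh.
  have [] := dP (u *: a + v *: b); first by rewrite -ball_normE /= sub0r normrN.
  rewrite /= !fctE /= addrA => + _; move=> /le_trans; apply.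
  rewrite invfM mulrA -!mulrA ler_pM2l// ler_pM2l// ler_pdivrMl//.
  by rewrite mulrC in_C.
have := E c h c0h hh; have := E c 0 c0h h00.
have dGL : 'd G x (c *: a + h *: b) = 'd G x (c *: a) + h * 'd G x b.
  by rewrite linearD (linearZ _ b).
rewrite scale0r add0r addr0 dGL -/G (deriveE _ dG).
have swap (p q u v y : R) : (p - q) * h - h ^+ 2 * y =
  h * ((p - (u + (v + h * y))) - (q - (u + v))) by ring.
rewrite (swap _ _ (G x) ('d G x (c *: a))) => E1 E2.
rewrite normrM (gtr0_norm h0) expr2 mulrCA ler_pM2l//.
apply: le_trans (ler_normB _ _) _.
by rewrite (splitr eps) mulrDl lerD.
Qed.

(** The second difference is symmetric in [a] and [b], so after division by h^2 it approximates both
    mixed derivatives. *)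
Lemma derive_swap_real V (U : set V) (f : V -> R) (x a b : V) :
  open U -> U x -> Ck 2 U f -> 'D_a ('D_b f) x = 'D_b ('D_a f) x.
Proof.
move=> oU Ux fk; apply/eqP; rewrite -subr_eq0 -normr_le0; apply/ler_addgt0Pl => e e0.
have e20 : 0 < e / 2 by rewrite divr_gt0.
have [d1 d10 H1] := second_difference a b oU Ux fk e20.
have [d2 d20 H2] := second_difference b a oU Ux fk e20.
pose h := Num.min d1 d2 / 2.
have m0 : 0 < Num.min d1 d2 by rewrite lt_min d10.
have h0 : 0 < h by rewrite divr_gt0.
have : h < Num.min d1 d2 by rewrite /h ltr_pdivrMr// ltr_pMr// ltr1n.
rewrite lt_min => /andP[h1 h2].
have := H1 h; rewrite h0 => /(_ h1) {}H1; have := H2 h; rewrite h0 => /(_ h2) {}H2.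
rewrite addr0 -(ler_pM2r (exprn_gt0 2 h0)).
rewrite -[X in `|_| * X](ger0_norm (exprn_ge0 2 (ltW h0))) -normrM.
rewrite [X in _ <= X * _](splitr e) [leRHS]mulrDl.
apply: le_trans (lerD H1 H2); apply: le_trans (ler_normB _ _).
rewrite le_eqVlt; apply/orP; left; apply/eqP; congr (`|_|).
have -> : h *: b + (h *: a + x) = h *: a + (h *: b + x) by rewrite addrCA.
have swap (p q u v y z k : R) :
  (p - q) * k = y - u - (v - z) - k * q - (y - v - (u - z) - k * p) by ring.
exact: swap.
Qed.

Lemma derive_swap V W {WF : findim W} (U : set V) (f : V -> W) (x a b : V) :
  open U -> U x -> Ck 2 U f -> 'D_a ('D_b f) x = 'D_b ('D_a f) x.
Proof.
move=> oU Ux fk; have [[n [e [l [ll el]]]]] := WF.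
suff H i : l i ('D_a ('D_b f) x) = l i ('D_b ('D_a f) x).
  by apply: etrans (el _) _; apply: etrans _ (esym (el _)); apply: eq_bigr => i _; rewrite H.
have lD (g : V -> W) y v : differentiable g y -> l i ('D_v g y) = 'D_v (fun z => l i (g z)) y.
  move=> dg; have [dl dlE] := ll i (g y).
  rewrite !deriveE//; last exact: differentiable_comp dg dl.
  by have /(congr1 (@^~ v)) /= -> := diff_comp dg dl; rewrite dlE.
have [df Df] := fk.
have near_lD v : \near x, l i ('D_v f x) = 'D_v (fun z => l i (f z)) x.
  by apply: filterS (open_near oU Ux) => y Uy; apply: lD; exact: df.
rewrite !lD; [|by have [dDf _] := Df a; exact: dDf|by have [dDf _] := Df b; exact: dDf].
rewrite (near_eq_derive _ (near_lD b)) (near_eq_derive _ (near_lD a)).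
apply: (derive_swap_real _ _ oU Ux); exact: Ck_lcomp.
Qed.

End Calculus.

(** * Maps between manifolds *)

Section Atlas.
Variable R : realType.
Variables (V : normedModType R) (T : topologicalType) (M : manifold V T).
Hypothesis HM : is_manifold M.

Lemma open_carrier : open (carrier M). Proof. by case: HM. Qed.

Section AtPoint.
Variable x : T.
Hypothesis Mx : carrier M x.

Lemma open_dom : open (mdom M x). Proof. by have [_ [/(_ x Mx)[[]]]] := HM. Qed.
Lemma dom_refl : mdom M x x. Proof. by have [_ [/(_ x Mx)[[]]]] := HM. Qed.
Lemma dom_carrier y : mdom M x y -> carrier M y.
Proof. by have [_ [/(_ x Mx)[[_ _ + _]]] _ _] := HM; apply. Qed.
Lemma open_chart_img : open (chart_img M x). Proof. by have [_ [/(_ x Mx)[[]]]] := HM. Qed.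
Lemma chartK y : mdom M x y -> chartV M x (chart M x y) = y.
Proof. by move=> yx; have [_ [/(_ x Mx)[_ [cV _ _]] _]] := HM; exact: cV. Qed.
Lemma chart_continuous y : mdom M x y -> {for y, continuous (chart M x)}.
Proof. by move=> yx; have [_ [/(_ x Mx)[_ [_ cV _]] _]] := HM; exact: cV. Qed.
Lemma chartV_continuous u : chart_img M x u -> {for u, continuous (chartV M x)}.
Proof. by move=> ux; have [_ [/(_ x Mx)[_ [_ _ cV]] _]] := HM; exact: cV. Qed.

Lemma chart_imgP u : chart_img M x u -> mdom M x (chartV M x u) /\ chart M x (chartV M x u) = u.
Proof. by move=> [y yx <-]; rewrite chartK. Qed.

Lemma chart_img_chart y : mdom M x y -> chart_img M x (chart M x y).
Proof. by move=> yx; exists y. Qed.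

Lemma chartV_cvg y : mdom M x y -> chartV M x @ chart M x y --> y.
Proof.
move=> yx; have cV : {for chart M x y, continuous (chartV M x)}.
  exact/chartV_continuous/chart_img_chart.
by have := cV : chartV M x @ chart M x y --> _; rewrite (chartK yx).
Qed.

Lemma chart_image_open (Q : set T) : open (mdom M x `&` Q) -> open (chart M x @` (mdom M x `&` Q)).
Proof.
move=> oQ; rewrite openE => u [y [yx Qy] <-{u}].
have ux := chart_img_chart yx.
have nQ : \forall v \near chart M x y, (mdom M x `&` Q) (chartV M x v).
  by apply: (chartV_cvg yx); exact: open_nbhs_nbhs.
have nU := open_nbhs_nbhs (conj open_chart_img ux).
rewrite /interior; apply: filterS (filterI nQ nU) => v [vQ /chart_imgP[_ <-]].
by exists (chartV M x v).
Qed.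

Lemma near_chartV (O : set T) : open O -> O x -> \forall u \near chart M x x, O (chartV M x u).
Proof.
move=> oO Ox; apply: (chartV_cvg dom_refl).
exact: open_nbhs_nbhs.
Qed.

End AtPoint.
End Atlas.

Section OpenPreimage.
Variables (T T' : topologicalType).

Lemma open_setI_preimage (O : set T) (Q : set T') (F : T -> T') : open O -> open Q ->
  (forall p, O p -> {for p, continuous F}) -> open (O `&` F @^-1` Q).
Proof.
move=> oO oQ Fc; rewrite openE => p [Op Qp]; rewrite /interior; apply: filterI.
  exact: open_nbhs_nbhs.
by apply: (Fc p Op); exact: open_nbhs_nbhs.
Qed.

Lemma open_setM (A : set T) (B : set T') : open A -> open B -> open (A `*` B).
Proof.
move=> oA oB.
rewrite (_ : A `*` B = (setT `&` @fst T T' @^-1` A) `&` @snd T T' @^-1` B); last first.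
  by rewrite setTI.
have fc : continuous (@fst T T') by move=> x; exact: cvg_fst.
have sc : continuous (@snd T T') by move=> x; exact: cvg_snd.
by rewrite setTI; apply: openI; apply: open_comp => // *.
Qed.

End OpenPreimage.

Section Differential.
Variable R : realType.
Variables (V1 V2 V3 : normedModType R) (T1 T2 T3 : topologicalType).
Variables (M1 : manifold V1 T1) (M2 : manifold V2 T2) (M3 : manifold V3 T3).

(** Differentiability in the charts centred at [p] and [F p]. Continuity is included because it
    keeps [F] inside the chart domain of [F p] near [p], where the coordinate expression is
    meaningful. *)
Definition mdiff (F : T1 -> T2) p : Prop :=
  {for p, continuous F} /\ differentiable (chart M2 (F p) \o F \o chartV M1 p) (chart M1 p p).

Hypothesis HM1 : is_manifold M1.

Lemma mderivP F p a u v : mderiv M1 M2 F p (a *: u + v) = a *: mderiv M1 M2 F p u + mderiv M1 M2 F p v.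
Proof. exact: linearP. Qed.
Lemma mderivD F p u v : mderiv M1 M2 F p (u + v) = mderiv M1 M2 F p u + mderiv M1 M2 F p v.
Proof. exact: linearD. Qed.
Lemma mderivZ F p a u : mderiv M1 M2 F p (a *: u) = a *: mderiv M1 M2 F p u.
Proof. exact: linearZ. Qed.
Lemma mderivN F p u : mderiv M1 M2 F p (- u) = - mderiv M1 M2 F p u.
Proof. exact: linearN. Qed.
Lemma mderiv0 F p : mderiv M1 M2 F p 0 = 0.
Proof. exact: linear0. Qed.
Lemma mderiv_sum F p I (r : seq I) (P : pred I) f :
  mderiv M1 M2 F p (\sum_(i <- r | P i) f i) = \sum_(i <- r | P i) mderiv M1 M2 F p (f i).
Proof. exact: linear_sum. Qed.

Lemma near_mderiv (F G : T1 -> T2) p O : carrier M1 p -> open O -> O p ->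
  (forall q, O q -> F q = G q) -> mdiff F p ->
  mdiff G p /\ mderiv M1 M2 G p = mderiv M1 M2 F p.
Proof.
move=> Mp oO Op FG [Fc dF].
have FGn : \forall q \near p, G q = F q.
  by apply: filterS (open_nbhs_nbhs (conj oO Op)) => q /FG.
have FGp : F p = G p by rewrite (FG p).
have nFG : \forall u \near chart M1 p p, (chart M2 (F p) \o F \o chartV M1 p) u =
      (chart M2 (G p) \o G \o chartV M1 p) u.
  by rewrite -FGp; apply: filterS (near_chartV HM1 Mp oO Op) => u /= /FG ->.
have [dG dGE] := near_eq_diff nFG dF.
split; last by apply/funext => v; rewrite /mderiv dGE.
split=> //; change (G @ p --> G p); rewrite -FGp; apply: cvg_trans Fc.
by apply: near_eq_cvg; apply: filterS FGn => q ->.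
Qed.

Hypothesis HM2 : is_manifold M2.

(** Near [p], the chart centred at [F p] and its inverse cancel between the coordinate expressions
    of the two maps. *)
Lemma mderiv_comp (F : T1 -> T2) (G : T2 -> T3) p : carrier M1 p -> carrier M2 (F p) ->
  mdiff F p -> {for F p, continuous G} ->
  differentiable (chart M3 (G (F p)) \o G \o chartV M2 (F p)) (chart M2 (F p) (F p)) ->
  [/\ {for p, continuous (G \o F)},
    differentiable (chart M3 (G (F p)) \o (G \o F) \o chartV M1 p) (chart M1 p p) &
    forall v, mderiv M1 M3 (G \o F) p v = mderiv M2 M3 G (F p) (mderiv M1 M2 F p v)].
Proof.
move=> Mp MFp [Fc dF] Gc dG.
have cp : chartV M1 p (chart M1 p p) = p by apply: chartK => //; exact: dom_refl.
pose h := (chart M3 (G (F p)) \o G \o chartV M2 (F p)) \o (chart M2 (F p) \o F \o chartV M1 p).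
have dG' : differentiable (chart M3 (G (F p)) \o G \o chartV M2 (F p))
    ((chart M2 (F p) \o F \o chartV M1 p) (chart M1 p p)) by rewrite /= cp.
have dh : differentiable h (chart M1 p p) by exact: differentiable_comp dF dG'.
have nh : \forall u \near chart M1 p p, h u = (chart M3 (G (F p)) \o (G \o F) \o chartV M1 p) u.
  have cV := chartV_cvg HM1 Mp (dom_refl HM1 Mp).
  have Fc' : (F \o chartV M1 p) @ chart M1 p p --> F p by exact: cvg_comp cV Fc.
  have nF : \forall u \near chart M1 p p, mdom M2 (F p) (F (chartV M1 p u)).
    apply: Fc'; apply: open_nbhs_nbhs.
    by split; [exact: (open_dom HM2 MFp)|exact: (dom_refl HM2 MFp)].
  by apply: filterS nF => u /= uF; rewrite /h /= (chartK HM2 MFp).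
have [dc dcE] := near_eq_diff nh dh.
split=> //; first exact: continuous_comp Fc Gc.
move=> v; rewrite /mderiv dcE (diff_comp dF dG') /=.
by rewrite cp.
Qed.

End Differential.

Section SmoothMaps.
Variable R : realType.
Variables (V1 V2 V3 : normedModType R) (T1 T2 T3 : topologicalType).
Variables (M1 : manifold V1 T1) (M2 : manifold V2 T2) (M3 : manifold V3 T3).
Hypotheses (HM1 : is_manifold M1) (HM2 : is_manifold M2) (HM3 : is_manifold M3).

Lemma smooth_mdiff (F : T1 -> T2) p : smooth_map M1 M2 F -> carrier M1 p -> mdiff M1 M2 F p.
Proof.
move=> [FM Fc Fs] Mp; split; first exact: Fc.
have [+ _] := Fs p (F p) Mp (FM p Mp) 1; apply.
by exists p => //; split; [exact: dom_refl|exact: (dom_refl HM2 (FM p Mp))].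
Qed.

Lemma smooth_chart_open (F : T1 -> T2) x (O : set T1) (Q : set T2) : carrier M1 x ->
  (forall p, carrier M1 p -> {for p, continuous F}) -> open O -> open Q ->
  open (mdom M1 x `&` O `&` F @^-1` Q).
Proof.
move=> Mx Fc oO oQ; apply: open_setI_preimage => //.
  by apply: openI => //; exact: open_dom.
by move=> p [/(dom_carrier HM1 Mx) /Fc].
Qed.

Lemma smooth_map_comp {F2 : findim V2} {F3 : findim V3} (F : T1 -> T2) (G : T2 -> T3) :
  smooth_map M1 M2 F -> smooth_map M2 M3 G -> smooth_map M1 M3 (G \o F).
Proof.
move=> [FM Fc Fs] [GM Gc Gs].
have GFc p : carrier M1 p -> {for p, continuous (G \o F)}.
  by move=> Mp; apply: continuous_comp; [exact: Fc|apply: Gc; exact: FM].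
split=> //; first by move=> p /FM/GM.
move=> x y Mx My k; apply: Ck_local => u [p [px GFp] <-{u}].
have Mp := dom_carrier HM1 Mx px; have MFp := FM p Mp; set z := F p in MFp.
pose D := mdom M1 x `&` (F @^-1` mdom M2 z `&` (G \o F) @^-1` mdom M3 y).
have oD : open D.
  rewrite /D setIA; apply: open_setI_preimage => //.
  - rewrite -[mdom M1 x]setIT; apply: smooth_chart_open => //; first exact: openT.
    exact: (open_dom HM2 MFp).
  - exact: open_dom.
  - by move=> q [/(dom_carrier HM1 Mx) /GFc].
have oU : open (chart M1 x @` D) by exact: (chart_image_open HM1 Mx oD).
exists (chart M1 x @` D); split.
  by exists p => //; split=> //; split=> //; exact: (dom_refl HM2 MFp).
apply: (Ck_ext (f := fun u => (chart M3 y \o G \o chartV M2 z) ((chart M2 z \o F \o chartV M1 x) u))) => //.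
  move=> u [q [qx [Fq GFq]] <-{u}] /=.
  by rewrite (chartK HM1 Mx qx) (chartK HM2 MFp Fq).
apply: (Ck_comp (U' := chart M2 z @` (mdom M2 z `&` G @^-1` mdom M3 y))) => //.
- move=> u [q [qx [Fq GFq]] <-{u}] /=.
  by rewrite (chartK HM1 Mx qx); exists (F q).
- by apply: Ck_sub (Fs x z Mx MFp k) => u [q [qx [Fq GFq]] <-{u}]; exists q.
- exact: Gs.
Qed.

Lemma mderiv_smooth_comp (F : T1 -> T2) (G : T2 -> T3) p v :
  smooth_map M1 M2 F -> smooth_map M2 M3 G -> carrier M1 p ->
  mderiv M1 M3 (G \o F) p v = mderiv M2 M3 G (F p) (mderiv M1 M2 F p v).
Proof.
move=> Fs Gs Mp; have [FM _ _] := Fs; have [GM Gc Gd] := Gs; have MFp := FM p Mp.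
have [_ _ ->//] := mderiv_comp HM1 HM2 Mp MFp (smooth_mdiff Fs Mp) (Gc _ MFp)
  (match Gd _ _ MFp (GM _ MFp) 1 with conj dG _ => dG _
     (ex_intro2 _ _ (F p) (conj (dom_refl HM2 MFp) (dom_refl HM3 (GM _ MFp))) erefl) end).
Qed.

Lemma smooth_map_pair (F : T1 -> T2) (G : T1 -> T3) :
  smooth_map M1 M2 F -> smooth_map M1 M3 G ->
  smooth_map M1 (prod_mfd M2 M3) (fun p => (F p, G p)).
Proof.
move=> [FM Fc Fs] [GM Gc Gs]; split.
- by move=> p Mp; split; [exact: FM|exact: GM].
- by move=> p Mp; apply: cvg_pair; [exact: Fc|exact: Gc].
move=> x y Mx [My1 My2] k /=.
set D := mdom M1 x `&` _.
have oD : open D.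
  rewrite (_ : D = mdom M1 x `&` (F @^-1` mdom M2 y.1) `&` (G @^-1` mdom M3 y.2)).
    apply: open_setI_preimage => //.
    - rewrite -[mdom M1 x]setIT; apply: smooth_chart_open => //; first exact: openT.
      exact: (open_dom HM2 My1).
    - exact: (open_dom HM3 My2).
    - by move=> q [/(dom_carrier HM1 Mx) /Gc].
  by rewrite -setIA.
apply: (Ck_pair (f := chart M2 y.1 \o F \o chartV M1 x) (g := chart M3 y.2 \o G \o chartV M1 x)).
- exact: (chart_image_open HM1 Mx oD).
- by apply: Ck_sub (Fs x y.1 Mx My1 k) => u [q [qx [Fq Gq]] <-]; exists q.
- by apply: Ck_sub (Gs x y.2 Mx My2 k) => u [q [qx [Fq Gq]] <-]; exists q.
Qed.

Lemma mderiv_pair (F : T1 -> T2) (G : T1 -> T3) p v :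
  mdiff M1 M2 F p -> mdiff M1 M3 G p ->
  mderiv M1 (prod_mfd M2 M3) (fun p => (F p, G p)) p v =
  (mderiv M1 M2 F p v, mderiv M1 M3 G p v).
Proof.
move=> [Fc dF] [Gc dG]; rewrite /mderiv.
by have /(congr1 (@^~ v)) /= := diff_pair dF dG.
Qed.

Lemma mdiff_pair (F : T1 -> T2) (G : T1 -> T3) p :
  mdiff M1 M2 F p -> mdiff M1 M3 G p ->
  mdiff M1 (prod_mfd M2 M3) (fun p => (F p, G p)) p.
Proof.
by move=> [Fc dF] [Gc dG]; split; [exact: cvg_pair|exact: differentiable_pair].
Qed.

End SmoothMaps.

Section Constructions.
Variable R : realType.

Lemma triv_is_manifold (V : normedModType R) (U : set V) : open U -> is_manifold (triv_mfd U).
Proof.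
move=> oU; split=> //; split.
  move=> x Ux; split; split=> //.
  - rewrite (_ : chart_img _ x = U)//; apply/seteqP; split=> [u [v Uv <-]//|u Uu].
    by exists u.
  - by move=> u _; exact: cvg_id.
  - by move=> u _; exact: cvg_id.
move=> x y Ux Uy k /=.
apply: (@Ck_clinear R _ _ k _ id); exact: clinear_id.
Qed.

Lemma restr_is_manifold (V : normedModType R) (T : topologicalType) (M : manifold V T) (O : set T) :
  is_manifold M -> open O -> is_manifold (restr_mfd M O).
Proof.
move=> HM oO; split; first by apply: openI => //; exact: open_carrier.
split.
  move=> x [Mx Ox].
  have oD : open (mdom M x `&` O) by apply: openI => //; exact: open_dom.
  split; split.
  - exact: oD.
  - by split=> //; exact: dom_refl.
  - by move=> y [yx Oy]; split=> //; exact: dom_carrier yx.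
  - exact: chart_image_open.
  - by move=> y [yx _]; exact: (chartK HM Mx).
  - by move=> y [yx _]; exact: (chart_continuous HM Mx).
  - move=> u [y [yx _] <-]; apply: (chartV_continuous HM Mx).
    exact: chart_img_chart.
move=> x y [Mx Ox] [My Oy] k; have [_ [_ /(_ x y Mx My k)]] := HM.
by apply: Ck_sub => u [q [[qx _] [qy _]] <-]; exists q.
Qed.

Lemma prod_is_manifold (V1 V2 : normedModType R) (T1 T2 : topologicalType)
    (M1 : manifold V1 T1) (M2 : manifold V2 T2) {F1 : findim V1} {F2 : findim V2} :
  is_manifold M1 -> is_manifold M2 -> is_manifold (prod_mfd M1 M2).
Proof.
move=> HM1 HM2.
have chartP x (Mx : carrier (prod_mfd M1 M2) x) u : chart_img (prod_mfd M1 M2) x u <->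
    chart_img M1 x.1 u.1 /\ chart_img M2 x.2 u.2.
  split=> [[p [p1 p2] <-]|[[p1 p1x e1] [p2 p2x e2]]] /=.
    by split; apply: chart_img_chart.
  by exists (p1, p2) => //=; rewrite e1 e2 -surjective_pairing.
split.
  by apply: open_setM; exact: open_carrier.
split.
  move=> x [Mx1 Mx2]; split; split.
  - by apply: open_setM; exact: open_dom.
  - by split; exact: dom_refl.
  - by move=> y [/(dom_carrier HM1 Mx1) ? /(dom_carrier HM2 Mx2)].
  - rewrite (_ : chart_img _ x = chart_img M1 x.1 `*` chart_img M2 x.2).
      by apply: open_setM; exact: open_chart_img.
    by apply/seteqP; split=> u /(chartP x (conj Mx1 Mx2)).
  - by move=> [y1 y2] [/= y1x y2x]; rewrite (chartK HM1 Mx1)// (chartK HM2 Mx2).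
  - move=> y [y1x y2x]; apply: cvg_pair.
      by apply: cvg_comp cvg_fst _; exact: (chart_continuous HM1 Mx1).
    by apply: cvg_comp cvg_snd _; exact: (chart_continuous HM2 Mx2).
  - move=> u /(chartP x (conj Mx1 Mx2))[u1 u2]; apply: cvg_pair.
      by apply: cvg_comp cvg_fst _; exact: (chartV_continuous HM1 Mx1).
    by apply: cvg_comp cvg_snd _; exact: (chartV_continuous HM2 Mx2).
move=> x y [Mx1 Mx2] [My1 My2] k.
have [_ [_ /(_ x.1 y.1 Mx1 My1 k) Ck1]] := HM1.
have [_ [_ /(_ x.2 y.2 Mx2 My2 k) Ck2]] := HM2.
have oD1 : open (chart M1 x.1 @` (mdom M1 x.1 `&` mdom M1 y.1)).
  by apply: (chart_image_open HM1 Mx1); apply: openI; exact: open_dom.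
have oD2 : open (chart M2 x.2 @` (mdom M2 x.2 `&` mdom M2 y.2)).
  by apply: (chart_image_open HM2 Mx2); apply: openI; exact: open_dom.
set D := _ @` _.
have DE : D = (chart M1 x.1 @` (mdom M1 x.1 `&` mdom M1 y.1)) `*`
              (chart M2 x.2 @` (mdom M2 x.2 `&` mdom M2 y.2)).
  apply/seteqP; split=> [u [p [[p1 p2] [q1 q2]] <-]|u [[p [px py] e1] [q [qx qy] e2]]] /=.
    by split; [exists p.1|exists p.2].
  by exists (p, q) => //=; rewrite e1 e2 -surjective_pairing.
have oD : open D by rewrite DE; exact: open_setM.
apply: (Ck_pair oD (f := fun u => (chart M1 y.1 \o chartV M1 x.1) u.1)
                   (g := fun u => (chart M2 y.2 \o chartV M2 x.2) u.2)).
  apply: (Ck_comp oD _ _ Ck1); first by rewrite DE => u [].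
  apply: Ck_clinear; exact: clinear_fst.
apply: (Ck_comp oD _ _ Ck2); first by rewrite DE => u [].
apply: Ck_clinear; exact: clinear_snd.
Qed.

End Constructions.

Section BasicMaps.
Variable R : realType.
Variables (V1 V2 : normedModType R) (T1 T2 : topologicalType).
Variables (M1 : manifold V1 T1) (M2 : manifold V2 T2).
Hypotheses (HM1 : is_manifold M1) (HM2 : is_manifold M2).

Lemma smooth_map_cst q : carrier M2 q -> smooth_map M1 M2 (fun=> q).
Proof.
move=> Mq; split=> //; first by move=> p _; exact: cst_continuous.
by move=> x y Mx My k; exact: Ck_cst.
Qed.

Lemma mderiv_cst q p v : mderiv M1 M2 (fun=> q) p v = 0.
Proof.
rewrite /mderiv (_ : _ \o _ = cst (chart M2 q q))//.
by have /(congr1 (@^~ v)) := @diff_cst R V1 V2 (chart M2 q q) (chart M1 p p).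
Qed.

Lemma smooth_map_id : smooth_map M1 M1 id.
Proof.
split=> //; first by move=> p _; exact: cvg_id.
move=> x y Mx My k; have [_ [_ /(_ x y Mx My k)]] := HM1.
by apply: Ck_sub => u [p [px py] <-]; exists p.
Qed.

Lemma mderiv_id p v : carrier M1 p -> mderiv M1 M1 id p v = v.
Proof.
move=> Mp; rewrite /mderiv.
have n1 : \forall u \near chart M1 p p, id u = (chart M1 p \o id \o chartV M1 p) u.
  apply: filterS (open_nbhs_nbhs (conj (open_chart_img HM1 Mp) (chart_img_chart (dom_refl HM1 Mp)))).
  by move=> u /(chart_imgP HM1 Mp)[].
have [_ ->] := near_eq_diff n1 (clinear_id (chart M1 p p)).1.
by rewrite (clinear_id (chart M1 p p)).2.
Qed.

Lemma smooth_map_fst {F1 : findim V1} {F2 : findim V2} : smooth_map (prod_mfd M1 M2) M1 fst.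
Proof.
split=> [p []//|p _|x y [Mx1 Mx2] My k]; first exact: cvg_fst.
have [_ [_ /(_ x.1 y Mx1 My k) Ck1]] := HM1.
set D := _ @` _.
have DE : D = (chart M1 x.1 @` (mdom M1 x.1 `&` mdom M1 y)) `*` chart_img M2 x.2.
  apply/seteqP; split=> [u [p [[p1 p2] py] <-]|u [[p [px py] e1] [q qx e2]]] /=.
    by split; [exists p.1|exists p.2].
  by exists (p, q) => //=; rewrite e1 e2 -surjective_pairing.
have oD : open D.
  rewrite DE; apply: open_setM; last exact: open_chart_img.
  by apply: (chart_image_open HM1 Mx1); apply: openI; exact: open_dom.
apply: (Ck_comp oD _ _ Ck1); first by rewrite DE => u [].
by apply: Ck_clinear; exact: clinear_fst.
Qed.

Lemma smooth_map_snd {F1 : findim V1} {F2 : findim V2} : smooth_map (prod_mfd M1 M2) M2 snd.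
Proof.
split=> [p []//|p _|x y [Mx1 Mx2] My k]; first exact: cvg_snd.
have [_ [_ /(_ x.2 y Mx2 My k) Ck2]] := HM2.
set D := _ @` _.
have DE : D = chart_img M1 x.1 `*` (chart M2 x.2 @` (mdom M2 x.2 `&` mdom M2 y)).
  apply/seteqP; split=> [u [p [[p1 p2] py] <-]|u [[p px e1] [q [qx qy] e2]]] /=.
    by split; [exists p.1|exists p.2].
  by exists (p, q) => //=; rewrite e1 e2 -surjective_pairing.
have oD : open D.
  rewrite DE; apply: open_setM; first exact: open_chart_img.
  by apply: (chart_image_open HM2 Mx2); apply: openI; exact: open_dom.
apply: (Ck_comp oD _ _ Ck2); first by rewrite DE => u [].
by apply: Ck_clinear; exact: clinear_snd.
Qed.

Lemma mderiv_fst p v : carrier (prod_mfd M1 M2) p -> mderiv (prod_mfd M1 M2) M1 fst p v = v.1.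
Proof.
move=> [Mp1 Mp2]; rewrite /mderiv /=.
have lf := clinear_fst (chart M1 p.1 p.1, chart M2 p.2 p.2).
have oD : open (chart_img M1 p.1 `*` setT : set (V1 * V2)).
  by apply: open_setM; [exact: open_chart_img|exact: openT].
have n1 : \forall u \near (chart M1 p.1 p.1, chart M2 p.2 p.2),
    @fst V1 V2 u = (chart M1 p.1 \o fst \o (fun u => (chartV M1 p.1 u.1, chartV M2 p.2 u.2))) u.
  apply: filterS (open_nbhs_nbhs (conj oD _)).
    by move=> u [h _]; rewrite /=; have [_ ->] := chart_imgP HM1 Mp1 h.
  by split=> //=; apply: chart_img_chart; exact: dom_refl.
have [_ ->] := near_eq_diff n1 lf.1.
by rewrite lf.2.
Qed.

Lemma mderiv_snd p v : carrier (prod_mfd M1 M2) p -> mderiv (prod_mfd M1 M2) M2 snd p v = v.2.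
Proof.
move=> [Mp1 Mp2]; rewrite /mderiv /=.
have lf := clinear_snd (chart M1 p.1 p.1, chart M2 p.2 p.2).
have oD : open (setT `*` chart_img M2 p.2 : set (V1 * V2)).
  by apply: open_setM; [exact: openT|exact: open_chart_img].
have n1 : \forall u \near (chart M1 p.1 p.1, chart M2 p.2 p.2),
    @snd V1 V2 u = (chart M2 p.2 \o snd \o (fun u => (chartV M1 p.1 u.1, chartV M2 p.2 u.2))) u.
  apply: filterS (open_nbhs_nbhs (conj oD _)).
    by move=> u [_ h]; rewrite /=; have [_ ->] := chart_imgP HM2 Mp2 h.
  by split=> //=; apply: chart_img_chart; exact: dom_refl.
have [_ ->] := near_eq_diff n1 lf.1.
by rewrite lf.2.
Qed.

Lemma smooth_map_triv (U : set V1) (U' : set V2) (f : V1 -> V2) :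
  open U -> (forall x, U x -> U' (f x)) -> smooth_on U f ->
  smooth_map (triv_mfd U) (triv_mfd U') f.
Proof.
move=> oU UU' fs; split=> //; first by move=> p Up; exact: (Ck_continuous Up (fs 0)).
by move=> x y _ _ k; apply: Ck_sub (fs k) => u [p [Up _] <-].
Qed.

Lemma smooth_map_triv_sub (U U' : set V1) (F : V1 -> T2) : U' `<=` U ->
  smooth_map (triv_mfd U) M2 F -> smooth_map (triv_mfd U') M2 F.
Proof.
move=> UU [FM Fc Fs]; split; [by move=> p /UU/FM|by move=> p /UU/Fc|].
move=> x y Ux My k; apply: Ck_sub (Fs x y (UU _ Ux) My k).
by move=> u [p [Up py] <-]; exists p => //; split=> //; exact: UU.
Qed.

Lemma smooth_map_chartV x : carrier M1 x -> smooth_map (triv_mfd (chart_img M1 x)) M1 (chartV M1 x).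
Proof.
move=> Mx; split.
- by move=> u /(chart_imgP HM1 Mx)[/(dom_carrier HM1 Mx)].
- by move=> u; exact: chartV_continuous.
move=> u y ux My k; have [_ [_ /(_ x y Mx My k)]] := HM1.
apply: Ck_sub => w [w' [w'x w'y] <-].
by have [h e] := chart_imgP HM1 Mx w'x; rewrite /= -e; exists (chartV M1 x w').
Qed.

(** Tangent vectors at [x] are read in the chart centred at [x] itself; at other points of its
    domain this differential is a change of charts. *)
Lemma mderiv_chartV x v : carrier M1 x -> mderiv (triv_mfd setT) M1 (chartV M1 x) (chart M1 x x) v = v.
Proof.
by move=> Mx; have := mderiv_id v Mx; rewrite /mderiv /= (chartK HM1 Mx (dom_refl HM1 Mx)).
Qed.

End BasicMaps.

Lemma sum_fctE (R : realType) (V : normedModType R) n (f : 'I_n -> V -> R) :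
  (fun x => \sum_i f i x) = \sum_i f i.
Proof. by apply/funext => x; rewrite fct_sumE. Qed.

(** * Pullback of two-tensors *)

Section Tensors.
Variable R : realType.
Variables (V : normedModType R) (T : topologicalType) (M : manifold V T).
Hypothesis HM : is_manifold M.
Context {FV : findim V}.
Variable (w : T -> V -> V -> R).

Definition bilinear2 := forall p, carrier M p ->
  (forall a u v z, w p (a *: u + v) z = a * w p u z + w p v z) /\
  (forall a u v z, w p z (a *: u + v) = a * w p z u + w p z v).

Hypothesis wb : bilinear2.

Lemma bilinear2_suml p n (a : 'I_n -> R) (e : 'I_n -> V) z : carrier M p ->
  w p (\sum_i a i *: e i) z = \sum_i a i * w p (e i) z.
Proof.
move=> Mp; have [wl _] := wb Mp.
have w0 : w p 0 z = 0.
  have := wl 1 0 0 z; rewrite scaler0 addr0 mul1r => /eqP.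
  by rewrite -subr_eq0 opprD addNKr oppr_eq0 => /eqP.
elim: n a e => [|n IH] a e; first by rewrite !big_ord0.
by rewrite !big_ord_recl wl IH.
Qed.

Lemma bilinear2_sumr p n (a : 'I_n -> R) (e : 'I_n -> V) z : carrier M p ->
  w p z (\sum_i a i *: e i) = \sum_i a i * w p z (e i).
Proof.
move=> Mp; have [_ wr] := wb Mp.
have w0 : w p z 0 = 0.
  have := wr 1 0 0 z; rewrite scaler0 addr0 mul1r => /eqP.
  by rewrite -subr_eq0 opprD addNKr oppr_eq0 => /eqP.
elim: n a e => [|n IH] a e; first by rewrite !big_ord0.
by rewrite !big_ord_recl wr IH.
Qed.

Lemma bilinear2_sum p n (a b : 'I_n -> R) (e : 'I_n -> V) : carrier M p ->
  w p (\sum_i a i *: e i) (\sum_i b i *: e i) = \sum_i \sum_j a i * b j * w p (e i) (e j).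
Proof.
move=> Mp; rewrite bilinear2_suml//; apply: eq_bigr => i _.
by rewrite bilinear2_sumr// mulr_sumr; apply: eq_bigr => j _; rewrite mulrA.
Qed.

Section Pullback.
Variables (W : normedModType R) (U : set W) (G : W -> T).
Context {FW : findim W}.
Hypotheses (oU : open U) (Gs : smooth_map (triv_mfd U) M G).

(** The components of the pullback of [w] by [G] on constant vectors; [coord2] is the case where [G]
    is an inverse chart. *)
Definition pull2 (a b : W) (u : W) : R :=
  w (G u) (mderiv (triv_mfd setT) M G u a) (mderiv (triv_mfd setT) M G u b).

Lemma open_chart_dom x : carrier M x -> open (U `&` G @^-1` mdom M x).
Proof.
by have [_ Gc _] := Gs; move=> Mx; apply: open_setI_preimage => //; exact: open_dom.
Qed.

Lemma smooth_chart_map x : carrier M x -> smooth_on (U `&` G @^-1` mdom M x) (chart M x \o G).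
Proof.
have [_ Gc Gd] := Gs; move=> Mx k; apply: Ck_local => u [Uu Gu].
exists (U `&` G @^-1` mdom M x); split => //.
by apply: Ck_sub (Gd u x Uu Mx k) => v [Uv Gv]; exists v.
Qed.

(** The left side is read in the chart centred at [G u], which moves with [u]. Going through one
    fixed chart separates an ordinary derivative from the change of charts, and makes the dependence
    on [u] differentiable. *)
Lemma mderiv_triv_chart x u a : carrier M x -> U u -> mdom M x (G u) ->
  mderiv (triv_mfd setT) M G u a =
  mderiv (triv_mfd setT) M (chartV M x) (chart M x (G u)) ('D_a (chart M x \o G) u).
Proof.
move=> Mx Uu Gu; pose O := U `&` G @^-1` mdom M x.
have oO : open O by exact: open_chart_dom.
have Ou : O u by [].
have HO : is_manifold (triv_mfd O) by exact: triv_is_manifold.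
have HC : is_manifold (triv_mfd (chart_img M x)) by apply/triv_is_manifold/open_chart_img.
have s1 : smooth_map (triv_mfd O) (triv_mfd (chart_img M x)) (chart M x \o G).
  apply: smooth_map_triv => //; first by move=> v [Uv Gv]; exact: chart_img_chart.
  exact: smooth_chart_map.
have s2 := smooth_map_chartV HM Mx.
have s12 : smooth_map (triv_mfd O) M (chartV M x \o (chart M x \o G)).
  exact: (smooth_map_comp HO HC HM s1 s2).
have [_ E] := near_mderiv HO Ou oO Ou (G := G) (fun q h => chartK HM Mx (h.2))
    (smooth_mdiff HO HM s12 Ou).
change (mderiv (triv_mfd O) M G u a = mderiv (triv_mfd setT) M (chartV M x)
  (chart M x (G u)) ('D_a (chart M x \o G) u)).
rewrite E; apply: etrans (mderiv_smooth_comp HO HC HM a s1 s2 Ou) _.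
rewrite deriveE//.
by have [+ _] := smooth_chart_map Mx 1; apply.
Qed.

Lemma pull2_chart n (e : 'I_n -> V) (l : 'I_n -> V -> R) x u a b :
  (forall v, v = \sum_i l i v *: e i) -> carrier M x -> U u -> mdom M x (G u) ->
  pull2 a b u = \sum_i \sum_j l i ('D_a (chart M x \o G) u) * l j ('D_b (chart M x \o G) u) *
     coord2 M w x (e i) (e j) (chart M x (G u)).
Proof.
move=> el Mx Uu Gu; rewrite /pull2 !(mderiv_triv_chart _ Mx Uu Gu).
rewrite {1}(el ('D_a _ u)) {1}(el ('D_b _ u)) !mderiv_sum.
under eq_bigr => i _ do rewrite mderivZ.
under [X in w _ _ X]eq_bigr => i _ do rewrite mderivZ.
rewrite bilinear2_sum; last by apply: (dom_carrier HM Mx).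
by rewrite /coord2 (chartK HM Mx Gu).
Qed.

Lemma pull2_Ck k a b :
  (forall x a b, carrier M x -> Ck k (chart_img M x) (coord2 M w x a b)) ->
  Ck k U (pull2 a b).
Proof.
move=> wk; apply: Ck_local => u Uu; have [GM _ _] := Gs; have MGu := GM u Uu.
set x := G u in MGu; pose O := U `&` G @^-1` mdom M x.
have oO : open O by exact: open_chart_dom.
exists O; split; first by split=> //; exact: (dom_refl HM MGu).
have [[n [e [l [ll el]]]]] := FV.
apply: Ck_ext; [exact: oO|by move=> v [Uv Gv]; rewrite (pull2_chart _ _ el MGu Uv Gv)|].
have dk c : Ck k O ('D_c (chart M x \o G)).
  by have [_] := smooth_chart_map MGu k.+1; apply.
apply: Ck_sum => // i; apply: Ck_sum => // j; apply: CkM => //.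
  by apply: CkM => //; exact: Ck_lcomp.
apply: (Ck_comp oO _ (smooth_chart_map MGu k) (wk x (e i) (e j) MGu)).
by move=> v [Uv Gv]; exact: chart_img_chart.
Qed.

Lemma derive_pull2 x u a b c (g := chart M x \o G) :
  (forall x a b, carrier M x -> Ck 1 (chart_img M x) (coord2 M w x a b)) ->
  carrier M x -> U u -> mdom M x (G u) ->
  'D_a (pull2 b c) u =
  coord2 M w x ('D_a ('D_b g) u) ('D_c g u) (g u) +
  coord2 M w x ('D_b g u) ('D_a ('D_c g) u) (g u) +
  'D_('D_a g u) (coord2 M w x ('D_b g u) ('D_c g u)) (g u).
Proof.
move=> wk Mx Uu Gu; pose O := U `&` G @^-1` mdom M x.
have oO : open O by exact: open_chart_dom.
have Ou : O u by [].
have [[n [e [l [ll el]]]]] := FV.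
have nP : \forall v \near u, pull2 b c v = \sum_i \sum_j l i ('D_b g v) * l j ('D_c g v) *
     coord2 M w x (e i) (e j) (g v).
  by apply: filterS (open_near oO Ou) => v [Uv Gv]; exact: pull2_chart.
have [dg Dg] := smooth_chart_map Mx 2.
have dgu : differentiable g u by exact: dg.
have dDg d : differentiable ('D_d g) u by have [+ _] := Dg d; apply.
have gI : chart_img M x (g u) by exact: chart_img_chart.
have dw v1 v2 : differentiable (coord2 M w x v1 v2) (g u).
  by have [+ _] := wk x v1 v2 Mx; apply.
have Dl i d : is_derive u a (fun v => l i ('D_d g v)) (l i ('D_a ('D_d g) u)).
  have [dl dlE] := ll i ('D_d g u).
  have dc := differentiable_comp (dDg d) dl.
  split; first exact: diff_derivable.
  by rewrite deriveE// (diff_comp (dDg d) dl) /= dlE deriveE.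
have Dw v1 v2 : is_derive u a (fun v => coord2 M w x v1 v2 (g v))
    ('D_('D_a g u) (coord2 M w x v1 v2) (g u)).
  have dc := differentiable_comp dgu (dw v1 v2).
  split; first exact: diff_derivable.
  by rewrite deriveE// (diff_comp dgu (dw v1 v2)) /= !deriveE.
have Dsum : is_derive u a (fun v => \sum_i \sum_j l i ('D_b g v) * l j ('D_c g v) *
     coord2 M w x (e i) (e j) (g v))
  (\sum_i \sum_j
   (l i ('D_a ('D_b g) u) * l j ('D_c g u) * coord2 M w x (e i) (e j) (g u) +
    l i ('D_b g u) * l j ('D_a ('D_c g) u) * coord2 M w x (e i) (e j) (g u) +
    l i ('D_b g u) * l j ('D_c g u) * 'D_('D_a g u) (coord2 M w x (e i) (e j)) (g u))).
  rewrite sum_fctE; apply: is_derive_sum => i; rewrite sum_fctE; apply: is_derive_sum => j.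
  apply: is_derive_eq (is_deriveM (is_deriveM (Dl i b) (Dl j c)) (Dw (e i) (e j))) _.
  rewrite /GRing.scale /=.
  have swap (p q r s t z : R) : p * q * z + r * (p * s + q * t) =
      t * q * r + p * s * r + p * q * z by ring.
  exact: swap.
rewrite (near_eq_derive _ nP) derive_val.
have coordE v1 v2 v : chart_img M x v -> coord2 M w x v1 v2 v =
    \sum_i \sum_j l i v1 * l j v2 * coord2 M w x (e i) (e j) v.
  move=> /(chart_imgP HM Mx)[/(dom_carrier HM Mx) vM _].
  rewrite {1}/coord2 {1}(el v1) {1}(el v2) !mderiv_sum.
  under eq_bigr => i _ do rewrite mderivZ.
  under [X in w _ _ X]eq_bigr => i _ do rewrite mderivZ.
  by rewrite bilinear2_sum.
rewrite [X in _ = X + _ + _]coordE// [X in _ = _ + X + _]coordE//.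
have -> : 'D_('D_a g u) (coord2 M w x ('D_b g u) ('D_c g u)) (g u) =
    \sum_i \sum_j l i ('D_b g u) * l j ('D_c g u) *
      'D_('D_a g u) (coord2 M w x (e i) (e j)) (g u).
  have nc : \forall v \near g u, coord2 M w x ('D_b g u) ('D_c g u) v =
      \sum_i \sum_j l i ('D_b g u) * l j ('D_c g u) * coord2 M w x (e i) (e j) v.
    by apply: filterS (open_near (open_chart_img HM Mx) gI) => v; exact: coordE.
  rewrite (near_eq_derive _ nc) sum_fctE.
  have : is_derive (g u) ('D_a g u) (\sum_i (fun v => \sum_j l i ('D_b g u) * l j ('D_c g u) * coord2 M w x (e i) (e j) v)) (\sum_i \sum_j l i ('D_b g u) * l j ('D_c g u) *
      'D_('D_a g u) (coord2 M w x (e i) (e j)) (g u)).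
    apply: is_derive_sum => i; rewrite sum_fctE; apply: is_derive_sum => j.
    have dij : is_derive (g u) ('D_a g u) (coord2 M w x (e i) (e j))
       ('D_('D_a g u) (coord2 M w x (e i) (e j)) (g u)).
      by apply: derivableP; exact: diff_derivable.
    exact: (is_deriveZ (l i ('D_b g u) * l j ('D_c g u)) dij).
  by move=> [_ ->].
rewrite -!big_split; apply: eq_bigr => i _ /=.
by rewrite -!big_split.
Qed.

(** The exterior derivative commutes with pullback: the terms with second derivatives of [G] cancel
    in pairs, by symmetry of these derivatives and antisymmetry of [w], and the rest is closedness
    of [w] on the image vectors. *)
Lemma closed2_pull2 a b c u :
  (forall p u v, carrier M p -> w p v u = - w p u v) ->
  (forall x a b, carrier M x -> Ck 1 (chart_img M x) (coord2 M w x a b)) ->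
  closed2 M w -> U u ->
  'D_a (pull2 b c) u + 'D_b (pull2 c a) u + 'D_c (pull2 a b) u = 0.
Proof.
move=> wa wk wc Uu; have [GM _ _] := Gs; have MGu := GM u Uu.
set x := G u in MGu; have xx : mdom M x x by exact: dom_refl.
pose O := U `&` G @^-1` mdom M x.
have oO : open O by exact: open_chart_dom.
have Ou : O u by [].
rewrite !(derive_pull2 _ _ _ wk MGu Uu xx) -/x.
set g := chart M x \o G; have gu : g u = chart M x x by [].
have gI : chart_img M x (g u) by exact: chart_img_chart.
have swp := derive_swap _ _ oO Ou (smooth_chart_map MGu 2).
rewrite (swp FV b a) (swp FV c a) (swp FV c b).
have anti v1 v2 : coord2 M w x v2 v1 (g u) = - coord2 M w x v1 v2 (g u).
  by rewrite /coord2 wa// gu chartK.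
have := wc x ('D_a g u) ('D_b g u) ('D_c g u) (g u) MGu gI.
rewrite (anti ('D_a ('D_c g) u) ('D_b g u)) (anti ('D_a ('D_b g) u) ('D_c g u)).
rewrite (anti ('D_b ('D_c g) u) ('D_a g u)).
have swap (p q r s t z : R) : s + t + z = 0 ->
   p + (- q) + s + (r + (- p) + t) + (q + (- r) + z) = 0 by lra.
exact: swap.
Qed.

End Pullback.
Lemma pull2_comp (W W' : normedModType R) (G : W' -> T) (y : W -> W')
    n (e : 'I_n -> W') (l : 'I_n -> W' -> R) u (a b : W') :
  (forall v, v = \sum_i l i v *: e i) -> carrier M (G (y u)) ->
  pull2 G a b (y u) = \sum_i \sum_j l i a * l j b * pull2 G (e i) (e j) (y u).
Proof.
move=> el MG; rewrite {1}/pull2 {1}(el a) {1}(el b) !mderiv_sum.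
under eq_bigr => i _ do rewrite mderivZ.
under [X in w _ _ X]eq_bigr => i _ do rewrite mderivZ.
by rewrite bilinear2_sum.
Qed.

End Tensors.

Lemma clinear_opp (R : realType) (V : normedModType R) : clinear (@GRing.opp V).
Proof.
have h (x : V) : is_diff x (-%R : V -> V) (-%R) := is_diffN (is_diff_id x).
by move=> x; split; [exact: ex_diff|exact: diff_val].
Qed.

(** * Kaehler and holomorphic volume forms *)

Section KahlerForm.
Variable R : realType.
Variables (V : normedModType R) (T : topologicalType) (M : manifold V T) (m : nat).
Hypothesis HM : is_manifold M.
Context {FV : findim V}.
Variables (J : T -> V -> V) (g : T -> V -> V -> R).
Hypothesis K : kahler M m J g.

Global Instance findim_Cn : findim (Cn R m).
Proof. exact: findim_prod. Qed.

Lemma metric_bilinear : bilinear2 M g.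
Proof.
have [[gb _] _ _ _] := K; move=> p Mp; have [gl gs _] := gb p Mp; split=> // a u v z.
by rewrite gs gl (gs z u) (gs z v).
Qed.

Lemma kahler_form_bilinear : bilinear2 M (kahler_form J g).
Proof.
have [_ [Jl _] _ _] := K; move=> p Mp; have [wl wr] := metric_bilinear Mp.
by split=> a u v z; rewrite /kahler_form ?wr// (Jl p Mp).1 wl.
Qed.

Lemma kahler_form_anti p u v : carrier M p -> kahler_form J g p v u = - kahler_form J g p u v.
Proof.
have [[gb _] [Jl _] gJ _] := K; move=> Mp; have [gl gs _] := gb p Mp.
have [wl wr] := metric_bilinear Mp.
rewrite /kahler_form -gJ// (Jl p Mp).2 gs.
have := wr (-1) v 0 (J p u); rewrite scaleN1r addr0 => ->.
have := wr 1 0 0 (J p u); rewrite scaler0 addr0 mul1r; lra.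
Qed.

(** The chain rule on both composites of [z] with its inverse, each being the identity on an open
    set. *)
Lemma holo_coord_inverse U z : holo_coord M J U z -> exists zV : Cn R m -> T,
  [/\ smooth_map (triv_mfd (z @` U)) M zV, forall p, U p -> zV (z p) = p,
  (forall q v, U q -> mderiv (triv_mfd setT) M zV (z q) (mderiv M (triv_mfd setT) z q v) = v) &
  forall q v, U q -> mderiv M (triv_mfd setT) z q (mderiv (triv_mfd setT) M zV (z q) v) = v].
Proof.
move=> [oU UM ozU [zs zh] [zV [zVs zVK]]]; exists zV.
have HU : is_manifold (restr_mfd M U) by exact: restr_is_manifold.
have HZ : is_manifold (triv_mfd (z @` U)) by exact: triv_is_manifold.
have HC : is_manifold (triv_mfd (setT : set (Cn R m))) by apply/triv_is_manifold/openT.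
have zs' : smooth_map (restr_mfd M U) (triv_mfd (z @` U)) z.
  have [z1 z2 z3] := zs; split=> //; first by move=> p [Mp Up]; exists p.
  move=> x y Mx My k; apply: Ck_sub (z3 x y Mx I k) => u [p [px pz] <-].
  by exists p.
split=> // q v Uq.
  have MUq : carrier (restr_mfd M U) q by split => //; exact: UM.
  have := mderiv_smooth_comp HU HZ HM v zs' zVs MUq.
  have [_ E] := near_mderiv HU MUq oU Uq zVK
    (smooth_mdiff HU HM (smooth_map_comp HU HZ HM zs' zVs) MUq).
  move: (mderiv_id HM v (UM q Uq)).
  change (mderiv M M id q v) with (mderiv (restr_mfd M U) M id q v).
  by rewrite E => e1 e2; exact: etrans (esym e2) e1.
have zUq : (z @` U) (z q) by exists q.
have zVK' : forall y, (z @` U) y -> z (zV y) = y by move=> y [p Up <-]; rewrite zVK.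
have zVs' : smooth_map (triv_mfd (z @` U)) (restr_mfd M U) zV.
  have [z1 z2 z3] := zVs; split=> //.
    by move=> p [p' Up' <-]; rewrite zVK//; split=> //; exact: UM.
  move=> x y Mx [My _] k; apply: Ck_sub (z3 x y Mx My k) => u [p [px [pz pz']] <-].
  by exists p.
have := mderiv_smooth_comp HZ HU HC v zVs' zs zUq.
have [_ E] := near_mderiv HZ zUq ozU zUq zVK'
    (smooth_mdiff HZ HC (smooth_map_comp HZ HU HC zVs' zs) zUq).
move: (mderiv_id HC v (I : carrier (triv_mfd setT) (z q))).
change (mderiv (triv_mfd setT) (triv_mfd setT) id (z q) v) with
  (mderiv (triv_mfd (z @` U)) (triv_mfd setT) id (z q) v).
rewrite E => e1 e2; have := etrans (esym e2) e1.
by rewrite zVK.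
Qed.

(** The regularity of [J] comes from holomorphic coordinates, where [J] is the constant map [Jstd]:
    there the Kaehler form is the metric with one argument rotated by a constant map. *)
Lemma kahler_form_smooth x a b k : carrier M x ->
  Ck k (chart_img M x) (coord2 M (kahler_form J g) x a b).
Proof.
have [[gb gs] [Jl Jz] gJ _] := K.
move=> Mx; apply: Ck_local => u0 u0x.
have [p0x cp0] := chart_imgP HM Mx u0x; have Mp0 := dom_carrier HM Mx p0x.
have [U [z [Up0 Uz]]] := Jz _ Mp0.
have [zV [zVs zVK dK1 dK2]] := holo_coord_inverse Uz.
have [oU UM ozU [zs zh] _] := Uz.
have HU : is_manifold (restr_mfd M U) by exact: restr_is_manifold.
have HZ : is_manifold (triv_mfd (z @` U)) by exact: triv_is_manifold.
have HC : is_manifold (triv_mfd (setT : set (Cn R m))) by apply/triv_is_manifold/openT.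
pose D := chart_img M x `&` chartV M x @^-1` U.
have oD : open D.
  apply: open_setI_preimage => //; first exact: open_chart_img.
  by move=> u; exact: chartV_continuous.
have HD : is_manifold (triv_mfd D) by exact: triv_is_manifold.
have cs : smooth_map (triv_mfd D) (restr_mfd M U) (chartV M x).
  have [c1 c2 c3] := smooth_map_chartV HM Mx; split.
  - by move=> u [ux uU]; split=> //; exact: c1.
  - by move=> u [ux uU]; exact: c2.
  move=> v y [vx vU] [My _] k'; apply: Ck_sub (c3 v y vx My k') => u [p [[px _] [py _]] <-].
  by exists p.
pose y := z \o chartV M x.
have ys := smooth_map_comp HD HU HC cs zs.
have yk k' : Ck k' D y.
  have [_ _ /(_ u0 0 (conj u0x Up0) I k')] := ys.
  by apply: Ck_sub => u uD; exists u.
exists D; split=> //.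
have [[n [e [l [ll el]]]]] := findim_Cn.
have key u v : D u -> mderiv (triv_mfd setT) M (chartV M x) u v =
    mderiv (triv_mfd setT) M zV (y u) ('D_v y u).
  move=> [ux uU].
  have := mderiv_smooth_comp HD HU HC v cs zs (conj ux uU).
  have dy : differentiable y u by have [+ _] := yk 1; apply.
  rewrite -[mderiv _ _ _ _ _]/('d y u v) -deriveE// => ->.
  by rewrite dK1.
have J_zV q v : U q -> J q (mderiv (triv_mfd setT) M zV (z q) v) =
    mderiv (triv_mfd setT) M zV (z q) (Jstd v).
  move=> Uq; apply: etrans (esym (dK1 q _ Uq)) _; congr (mderiv _ _ _ _ _).
  apply: etrans (zh q _ (conj (UM _ Uq) Uq)) _; congr (Jstd _).
  exact: dK2.
have E u : D u -> coord2 M (kahler_form J g) x a b u =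
    \sum_i \sum_j l i (Jstd ('D_a y u)) * l j ('D_b y u) * pull2 M g zV (e i) (e j) (y u).
  move=> Du; have [ux uU] := Du.
  have yu : zV (y u) = chartV M x u by rewrite /y /= zVK.
  rewrite /coord2 /kahler_form !key// J_zV//.
  transitivity (pull2 M g zV (Jstd ('D_a y u)) ('D_b y u) (y u)).
    by rewrite /pull2 /y /= zVK.
  apply: pull2_comp => //; first exact: metric_bilinear.
  by rewrite /y /= zVK//; exact: UM.
apply: (Ck_ext oD (fun u Du => esym (E u Du))).
have lJ : clinear (@Jstd R 'rV[R]_m).
  have l1 := clinear_comp (@clinear_snd R 'rV[R]_m 'rV[R]_m) (@clinear_opp R 'rV[R]_m).
  exact: clinear_pair l1 (@clinear_fst R 'rV[R]_m 'rV[R]_m).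
have Dy v : Ck k D ('D_v y) by have [_] := yk k.+1; apply.
apply: Ck_sum => // i; apply: Ck_sum => // j; apply: CkM => //.
  apply: CkM => //; last exact: Ck_lcomp.
  apply: Ck_lcomp => //; exact: Ck_lcomp.
apply: (Ck_comp oD _ (yk k) (U' := z @` U)).
  by move=> u [ux uU]; exists (chartV M x u).
apply: pull2_Ck => //; first exact: metric_bilinear.
by move=> *; exact: gs.
Qed.

End KahlerForm.

Lemma near_eq_continuous (T T' : topologicalType) (f g : T -> T') x :
  (\near x, f x = g x) -> {for x, continuous f} -> {for x, continuous g}.
Proof.
move=> fg fc; change (g @ x --> g x); rewrite -(nbhs_singleton fg).
by apply: cvg_trans fc; exact: near_eq_cvg.
Qed.

(** * Continuity of complex-valued functions and of volume forms *)

Section ComplexContinuity.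
Variables (R : realType) (W : normedModType R) (U : set W).

(** Stated on real and imaginary parts, since the density argument is applied to each of these real
    functions. *)
Definition complex_continuous (f : W -> R[i]) : Prop :=
  forall u, U u -> {for u, continuous (fun x => complex.Re (f x))} /\
                   {for u, continuous (fun x => complex.Im (f x))}.

Lemma complex_continuous_cst c : complex_continuous (fun=> c).
Proof. by move=> u _; split; exact: cst_continuous. Qed.

Lemma complex_continuous_ext f g : (forall u, f u = g u) ->
  complex_continuous f -> complex_continuous g.
Proof. by move=> /funext ->. Qed.

Lemma complex_continuousD f g : complex_continuous f -> complex_continuous g ->
  complex_continuous (fun u => f u + g u).
Proof.
move=> fc gc u Uu; have [f1 f2] := fc u Uu; have [g1 g2] := gc u Uu.
split; [rewrite (_ : (fun x => _) = (fun x => complex.Re (f x)) \+ (fun x => complex.Re (g x)))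
       |rewrite (_ : (fun x => _) = (fun x => complex.Im (f x)) \+ (fun x => complex.Im (g x)))].
- exact: continuousD.
- by apply/funext => x /=; rewrite raddfD.
- exact: continuousD.
- by apply/funext => x /=; rewrite raddfD.
Qed.

Lemma complex_continuousM f g : complex_continuous f -> complex_continuous g ->
  complex_continuous (fun u => f u * g u).
Proof.
move=> fc gc u Uu; have [f1 f2] := fc u Uu; have [g1 g2] := gc u Uu.
have ReM (x y : R[i]) : complex.Re (x * y) =
  complex.Re x * complex.Re y - complex.Im x * complex.Im y by case: x; case: y.
have ImM (x y : R[i]) : complex.Im (x * y) =
  complex.Re x * complex.Im y + complex.Im x * complex.Re y by case: x; case: y.
split.
  rewrite (_ : (fun x => _) = (fun x => complex.Re (f x)) \* (fun x => complex.Re (g x)) \-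
                              (fun x => complex.Im (f x)) \* (fun x => complex.Im (g x))).
    by apply: continuousB; exact: continuousM.
  by apply/funext => x; rewrite ReM.
rewrite (_ : (fun x => _) = (fun x => complex.Re (f x)) \* (fun x => complex.Im (g x)) \+
                            (fun x => complex.Im (f x)) \* (fun x => complex.Re (g x))).
  by apply: continuousD; exact: continuousM.
by apply/funext => x; rewrite ImM.
Qed.

Lemma complex_continuous_sum I (r : seq I) (P : pred I) (f : I -> W -> R[i]) :
  (forall i, complex_continuous (f i)) ->
  complex_continuous (fun u => \sum_(i <- r | P i) f i u).
Proof.
move=> fc; elim: r => [|i r IH].
  by apply: complex_continuous_ext (complex_continuous_cst _) => u; rewrite big_nil.
case Pi: (P i); last by apply: complex_continuous_ext IH => u; rewrite big_cons Pi.
by apply: complex_continuous_ext (complex_continuousD (fc i) IH) => u; rewrite big_cons Pi.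
Qed.

Lemma complex_continuous_prod I (r : seq I) (P : pred I) (f : I -> W -> R[i]) :
  (forall i, complex_continuous (f i)) ->
  complex_continuous (fun u => \prod_(i <- r | P i) f i u).
Proof.
move=> fc; elim: r => [|i r IH].
  by apply: complex_continuous_ext (complex_continuous_cst _) => u; rewrite big_nil.
case Pi: (P i); last by apply: complex_continuous_ext IH => u; rewrite big_cons Pi.
by apply: complex_continuous_ext (complex_continuousM (fc i) IH) => u; rewrite big_cons Pi.
Qed.

Lemma complex_continuous_det n (f : 'I_n -> 'I_n -> W -> R[i]) :
  (forall i j, complex_continuous (f i j)) ->
  complex_continuous (fun u => \det (\matrix_(i, j) f i j u)).
Proof.
move=> fc; rewrite /determinant; apply: complex_continuous_sum => s.
apply: complex_continuousM; first exact: complex_continuous_cst.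
apply: complex_continuous_prod => i.
by apply: complex_continuous_ext (fc i (s i)) => u; rewrite mxE.
Qed.

End ComplexContinuity.

Section VolumeForm.
Variable R : realType.
Variables (V : normedModType R) (T : topologicalType) (M : manifold V T) (m : nat).
Hypothesis HM : is_manifold M.
Context {FV : findim V}.
Variables (J : T -> V -> V) (Om : T -> ('I_m -> V) -> R[i]).
Hypotheses (JM : complex_structure M m J) (Omh : holo_volume_form M J Om).
Variables (W : normedModType R) (U : set W) (G : W -> T).
Hypotheses (oU : open U) (Gs : smooth_map (triv_mfd U) M G).

(** In holomorphic coordinates the value is a holomorphic coefficient times a determinant of first
    derivatives. Continuity is enough to extend identities from the open orbit. *)
Lemma volume_form_continuous (a : 'I_m -> W) :
  complex_continuous U (fun u => Om (G u) (fun k => mderiv (triv_mfd setT) M G u (a k))).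
Proof.
move=> u0 Uu0; have [GM Gc Gd] := Gs; have MG := GM u0 Uu0.
have [U' [z [U'p Uz]]] := JM.2 _ MG; have [oU' U'M ozU [zs zh] _] := Uz.
have [h [[hs _] OmE]] := Omh Uz.
have HU : is_manifold (restr_mfd M U') by exact: restr_is_manifold.
have HC : is_manifold (triv_mfd (setT : set (Cn R m))) by apply/triv_is_manifold/openT.
pose O := U `&` G @^-1` U'.
have oO : open O by apply: open_setI_preimage.
have Ou0 : O u0 by [].
have HO : is_manifold (triv_mfd O) by exact: triv_is_manifold.
have Gs' : smooth_map (triv_mfd O) (restr_mfd M U') G.
  split.
  - by move=> u [Uu Gu]; split=> //; exact: GM.
  - by move=> u [Uu Gu]; exact: Gc.
  move=> v y [Uv _] [My _] k; apply: Ck_sub (Gd v y Uv My k) => u [p [[Up _] [py _]] <-].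
  by exists p.
have ys := smooth_map_comp HO HU HC Gs' zs.
have yk k : Ck k O (z \o G).
  have [_ _ /(_ u0 0 Ou0 I k)] := ys _ _.
  by apply: Ck_sub => u uO; exists u.
have E u : O u -> Om (G u) (fun k => mderiv (triv_mfd setT) M G u (a k)) =
    h (G u) * \det (\matrix_(j, k) cval ('D_(a k) (z \o G) u) j).
  move=> Ou; have [_ ->] := OmE (G u) Ou.2; congr (_ * \det _); apply/matrixP => j k.
  rewrite !mxE; congr (cval _ _); apply: etrans (esym (mderiv_smooth_comp HO HU HC (a k) Gs' zs Ou)) _.
  rewrite deriveE//; by have [+ _] := yk 1; apply.
have : complex_continuous O (fun u => h (G u) * \det (\matrix_(j, k) cval ('D_(a k) (z \o G) u) j)).
  apply: complex_continuousM.
    move=> u [Uu Gu]; have hc := (let: And3 _ c _ := hs in c) (G u) (conj (U'M _ Gu) Gu).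
    have hGc := continuous_comp (Gc u Uu) hc.
    split.
      exact: (continuous_comp hGc (@cvg_fst _ _ _ _ _)).
    exact: (continuous_comp hGc (@cvg_snd _ _ _ _ _)).
  apply: complex_continuous_det => i j u Ou.
  have Dc : {for u, continuous ('D_(a j) (z \o G))} by have [_ +] := yk 1; apply.
  split.
    apply: (continuous_comp (continuous_comp Dc _) (@coord_continuous _ _ _ 0 i _)); exact: cvg_fst.
  apply: (continuous_comp (continuous_comp Dc _) (@coord_continuous _ _ _ 0 i _)); exact: cvg_snd.
move=> /(_ u0 Ou0)[c1 c2].
have nE : \forall u \near u0, h (G u) * \det (\matrix_(j, k) cval ('D_(a k) (z \o G) u) j) =
   Om (G u) (fun k => mderiv (triv_mfd setT) M G u (a k)).
  by apply: filterS (open_near oO Ou0) => u /E.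
have near_c (q : R[i] -> R) : {for u0, continuous (fun u => q (h (G u) * \det (\matrix_(j, k) cval ('D_(a k) (z \o G) u) j)))} ->
   {for u0, continuous (fun u => q (Om (G u) (fun k => mderiv (triv_mfd setT) M G u (a k))))}.
  by apply: near_eq_continuous; apply: filterS nE => u ->.
by split; exact: near_c.
Qed.

End VolumeForm.

(** * The complex exponential *)

Section ComplexExp.
Variable R : realType.
Implicit Types z w : R[i].

Lemma cexpD z w : cexp (z + w) = cexp z * cexp w.
Proof.
case: z => a b; case: w => c d; rewrite /cexp /= expRD cosD sinD.
by apply/eqP; rewrite eq_complex /=; apply/andP; split; apply/eqP; ring.
Qed.

Lemma cexp0 : cexp 0 = 1 :> R[i].
Proof. by rewrite /cexp /= expR0 cos0 sin0 mul1r. Qed.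

Lemma cexp_neq0 z : cexp z != 0.
Proof.
apply/eqP => z0; have := cexpD z (- z); rewrite subrr cexp0 z0 mul0r.
by move/eqP; rewrite oner_eq0.
Qed.

Lemma cexp_conj z : cexp z^* = (cexp z)^*.
Proof.
case: z => a b; rewrite /cexp /= cosN sinN.
by apply/eqP; rewrite eq_complex /=; apply/andP; split; apply/eqP; ring.
Qed.

Lemma norm_cexp_imaginary y : `|cexp (0 +i* y)| = 1 :> R[i].
Proof.
apply/eqP; rewrite -(@eqrXn2 _ 2)// expr1n.
rewrite /cexp /= expR0 mul1r sqr_normc.
by rewrite eq_complex /= -(cos2Dsin2 y); apply/andP; split; apply/eqP; ring.
Qed.

Lemma sin_intpi (k : int) : sin (k%:~R * pi) = 0 :> R.
Proof.
have N n : sin (n%:R * pi) = 0 :> R.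
  by elim: n => [|n IH]; rewrite ?mul0r ?sin0// -natr1 mulrDl mul1r sinDpi IH oppr0.
by case: k => n; rewrite ?NegzE ?rmorphN /= ?mulNr ?sinN ?N ?oppr0.
Qed.

Lemma Im_cexp_derive (x y : R -> R) (x' y' t : R) : is_derive t 1 x x' -> is_derive t 1 y y' ->
  is_derive t 1 (fun t => complex.Im (cexp (x t +i* y t)))
    (complex.Im ((x' +i* y') * cexp (x t +i* y t))).
Proof.
move=> dx dy.
have de : is_derive t 1 (expR \o x) (expR (x t) * x') := is_derive1_comp (is_derive_expR (x t)) dx.
have ds : is_derive t 1 (sin \o y) (cos (y t) * y') := is_derive1_comp (is_derive_sin (y t)) dy.
rewrite (_ : (fun t => _) = (expR \o x) * (sin \o y)); last first.
  by apply/funext => u; rewrite /cexp /= mul0r addr0.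
apply: is_derive_eq (is_deriveM de ds) _.
rewrite /cexp /= /GRing.scale /=; ring.
Qed.

(** Polar form, with argument plus or minus arccos (a / r) according to the sign of the imaginary
    part; it gives logarithmic coordinates to every point of the open orbit. *)
Lemma cexp_surj z : z != 0 -> exists w, cexp w = z.
Proof.
case: z => a b ab0; pose r := Num.sqrt (a ^+ 2 + b ^+ 2).
have r2 : r ^+ 2 = a ^+ 2 + b ^+ 2 by rewrite sqr_sqrtr// addr_ge0// sqr_ge0.
have r0 : 0 < r.
  rewrite sqrtr_gt0 lt_def addr_ge0 ?sqr_ge0// andbT paddr_eq0 ?sqr_ge0//.
  by rewrite !sqrf_eq0 -(eq_complex (a +i* b) 0).
have ar : -1 <= a / r <= 1.
  rewrite -ler_norml normrM normfV (gtr0_norm r0) ler_pdivrMr// mul1r.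
  rewrite -(ler_pXn2r (ltn0Sn 1)) ?nnegrE ?normr_ge0 ?(ltW r0)//.
  by rewrite -normrX ger0_norm ?sqr_ge0// r2 lerDl sqr_ge0.
pose t := acos (a / r); have ct : cos t = a / r by exact: acosK.
have st : sin t = `|b| / r.
  rewrite sin_acos// expr_div_n.
  have -> : 1 - a ^+ 2 / r ^+ 2 = (`|b| / r) ^+ 2.
    rewrite expr_div_n -normrX ger0_norm ?sqr_ge0//.
    by rewrite -[1](divff (lt0r_neq0 (exprn_gt0 2 r0))) -mulrBl r2 addrC addKr.
  by rewrite sqrtr_sqr ger0_norm// divr_ge0// ltW.
have rK (x : R) : r * (x / r) = x by rewrite mulrC divfK// gt_eqF.
case: (lerP 0 b) => b0.
  exists (ln r +i* t); rewrite /cexp /= lnK ?posrE// ct st ger0_norm//.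
  by apply/eqP; rewrite eq_complex /= !mul0r subr0 addr0 !rK !eqxx.
exists (ln r +i* (- t)); rewrite /cexp /= lnK ?posrE// cosN sinN ct st ltr0_norm//.
by apply/eqP; rewrite eq_complex /= !mul0r subr0 addr0 mulNr opprK !rK !eqxx.
Qed.

End ComplexExp.

Section ComplexVectors.
Variables (R : realType) (m : nat).
Implicit Types z w : Cn R m.

Lemma Cn_eqP z w : (forall k, cval z k = cval w k) -> z = w.
Proof.
case: z => a b; case: w => c d e; congr (_, _); apply/rowP => k.
  by have /(congr1 (@complex.Re R)) := e k.
by have /(congr1 (@complex.Im R)) := e k.
Qed.

Lemma cval_mkCn (a : 'I_m -> R[i]) k : cval (mkCn a) k = a k.
Proof. by rewrite /cval !mxE; case: (a k). Qed.

Lemma cvalD z w k : cval (z + w) k = cval z k + cval w k.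
Proof. by rewrite /cval !mxE. Qed.

Lemma cvalZ (a : R) z k : cval (a *: z) k = a%:C * cval z k.
Proof. by rewrite /cval !mxE; apply/eqP; rewrite eq_complex /= !mul0r subr0 addr0 !eqxx. Qed.

Lemma cval_Jstd z k : cval (Jstd z) k = 'i * cval z k.
Proof.
rewrite /cval !mxE; apply/eqP; rewrite -complexiE eq_complex /=.
by rewrite !mul0r !mul1r sub0r add0r !eqxx.
Qed.

Lemma cval0 k : cval (0 : Cn R m) k = 0.
Proof. by rewrite /cval !mxE. Qed.

Lemma cexpvD z w : cexpv (z + w) = cmul (cexpv z) (cexpv w).
Proof. by apply: Cn_eqP => k; rewrite !cval_mkCn cvalD cexpD. Qed.

Lemma cexpv0 : cexpv (0 : Cn R m) = cone1 R m.
Proof. by apply: Cn_eqP => k; rewrite !cval_mkCn cval0 cexp0. Qed.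

Lemma ctorus_cexpv z : ctorus (cexpv z).
Proof. by move=> k; rewrite cval_mkCn cexp_neq0. Qed.

Lemma torus_cexpv (y : 'rV[R]_m) : torus (cexpv ((0, y) : Cn R m)).
Proof. by move=> k; rewrite cval_mkCn /cval /= mxE norm_cexp_imaginary. Qed.

Definition cbar z : Cn R m := (z.1, - z.2).

Lemma cval_cbar z k : cval (cbar z) k = (cval z k)^*.
Proof. by rewrite /cval /= mxE. Qed.

Lemma cconj_cexpv z : cconj (cexpv z) = cexpv (cbar z).
Proof. by apply: Cn_eqP => k; rewrite !cval_mkCn cval_cbar cexp_conj. Qed.

Lemma cexpv_surj w : ctorus w -> exists z, cexpv z = w.
Proof.
move=> wt; have [f fE] := fin_all_exists (fun k => cexp_surj (wt k)).
by exists (mkCn f); apply: Cn_eqP => k; rewrite !cval_mkCn fE.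
Qed.

Lemma ctorus_open : open (@ctorus R m).
Proof.
rewrite openE => w wt; rewrite /interior /=.
apply: (@filter_forall (Cn R m) 'I_m (fun k w' => cval w' k != 0) (nbhs w)) => k.
pose q (w : Cn R m) := w.1 0 k * w.1 0 k + w.2 0 k * w.2 0 k.
have qE (w' : Cn R m) : (q w' != 0) = (cval w' k != 0).
  rewrite eq_complex /= /q paddr_eq0 -?expr2 ?sqr_ge0// !sqrf_eq0.
  by [].
have l1 : clinear (fun z : Cn R m => z.1 0 k).
  exact: (clinear_comp (@clinear_fst R 'rV[R]_m 'rV[R]_m) (@clinear_coord R 1 m 0 k)).
have l2 : clinear (fun z : Cn R m => z.2 0 k).
  exact: (clinear_comp (@clinear_snd R 'rV[R]_m 'rV[R]_m) (@clinear_coord R 1 m 0 k)).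
have qc : {for w, continuous q}.
  apply: (@Ck_continuous _ _ _ 0 setT) => //; have o : open [set: Cn R m] by exact: openT.
  by apply: CkD => //; apply: CkM => //; exact: Ck_clinear.
have : \forall w' \near w, q w' != 0.
  apply: (qc [set x | x != 0]); apply: open_nbhs_nbhs; split; last by rewrite /= qE.
  exact: open_neq.
by apply: filterS => w'; rewrite qE.
Qed.

Lemma cexpv_smooth : smooth_on setT (@cexpv R m).
Proof.
move=> k; have o : open [set: Cn R m] by exact: openT.
have l1 i : clinear (fun z : Cn R m => z.1 0 i).
  exact: (clinear_comp (@clinear_fst R 'rV[R]_m 'rV[R]_m) (@clinear_coord R 1 m 0 i)).
have l2 i : clinear (fun z : Cn R m => z.2 0 i).
  exact: (clinear_comp (@clinear_snd R 'rV[R]_m 'rV[R]_m) (@clinear_coord R 1 m 0 i)).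
apply: (Ck_ext (f := fun z : Cn R m => \sum_i
  ((expR (z.1 0 i) * cos (z.2 0 i)) *: ((delta_mx 0 i, 0) : Cn R m) +
   (expR (z.1 0 i) * sin (z.2 0 i)) *: ((0, delta_mx 0 i) : Cn R m)))) => //.
  move=> z _; rewrite [LHS]surjective_pairing /= !raddf_sum /=.
  rewrite /cexpv /mkCn; congr (_, _); rewrite [RHS]row_sum_delta; apply: eq_bigr => i _;
    by rewrite !mxE /cexp /= !mul0r ?subr0 ?addr0 scaler0 ?addr0 ?add0r.
apply: Ck_sum => // i.
have Ce : Ck k setT (fun z : Cn R m => expR (z.1 0 i)).
  exact: (Ck_comp o (U' := setT) (fun _ _ => I) (Ck_clinear _ _ (l1 i)) (Ck_expR _ _)).
have Cc : Ck k setT (fun z : Cn R m => cos (z.2 0 i)).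
  exact: (Ck_comp o (U' := setT) (fun _ _ => I) (Ck_clinear _ _ (l2 i)) (Ck_trigo R k).1).
have Cs : Ck k setT (fun z : Cn R m => sin (z.2 0 i)).
  exact: (Ck_comp o (U' := setT) (fun _ _ => I) (Ck_clinear _ _ (l2 i)) (Ck_trigo R k).2).
by apply: CkD => //; apply: CkZ => //; (try exact: Ck_cst); exact: CkM.
Qed.

Lemma diff_cexpv z a : 'd (@cexpv R m) z a = cmul (cexpv z) a.
Proof.
have dE : differentiable (@cexpv R m) z by have [+ _] := cexpv_smooth 1; apply.
have l1 i : clinear (fun z : Cn R m => z.1 0 i).
  exact: (clinear_comp (@clinear_fst R 'rV[R]_m 'rV[R]_m) (@clinear_coord R 1 m 0 i)).
have l2 i : clinear (fun z : Cn R m => z.2 0 i).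
  exact: (clinear_comp (@clinear_snd R 'rV[R]_m 'rV[R]_m) (@clinear_coord R 1 m 0 i)).
have L (l : Cn R m -> R) : clinear l -> l ('d (@cexpv R m) z a) = 'D_a (l \o @cexpv R m) z.
  move=> ll; have [dl dlE] := ll (cexpv z).
  rewrite deriveE; last exact: differentiable_comp.
  by rewrite (diff_comp dE dl) /= dlE.
have Dlin (l : Cn R m -> R) : clinear l -> is_derive z a l (l a).
  move=> ll; have [dl dlE] := ll z; split; first exact: diff_derivable.
  by rewrite deriveE// dlE.
have Dcomp (l : Cn R m -> R) (f : R -> R) f' : clinear l -> is_derive (l z) 1 f f' ->
    is_derive z a (f \o l) (l a * f').
  move=> ll [df fE]; have df' : differentiable f (l z) by exact/derivable1_diffP.
  have [dl dlE] := ll z; have dfl := differentiable_comp dl df'.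
  split; first exact: diff_derivable.
  by rewrite deriveE// (diff_comp dl df') /= dlE -deriveE// derive_real// fE.
apply: Cn_eqP => i; rewrite cval_mkCn.
have e1 := Dcomp _ _ _ (l1 i) (is_derive_expR (z.1 0 i)).
have e2 := Dcomp _ _ _ (l2 i) (is_derive_cos (z.2 0 i)).
have e3 := Dcomp _ _ _ (l2 i) (is_derive_sin (z.2 0 i)).
have [_ D1] := is_deriveM e1 e2; have [_ D2] := is_deriveM e1 e3.
rewrite {1}/cval (L _ (l1 i)) (L _ (l2 i)).
have -> : (fun z : Cn R m => z.1 0 i) \o @cexpv R m =
    (expR \o (fun z : Cn R m => z.1 0 i)) * (cos \o (fun z : Cn R m => z.2 0 i)).
  by apply/funext => y; rewrite /= !mxE /cexp /= mul0r subr0.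
have -> : (fun z : Cn R m => z.2 0 i) \o @cexpv R m =
    (expR \o (fun z : Cn R m => z.1 0 i)) * (sin \o (fun z : Cn R m => z.2 0 i)).
  by apply/funext => y; rewrite /= !mxE /cexp /= mul0r addr0.
rewrite D1 D2 cval_mkCn /cexp /cval /GRing.scale /=.
by apply/eqP; rewrite eq_complex /=; apply/andP; split; apply/eqP; ring.
Qed.

Lemma diff_cexpv_Jstd z a : 'd (@cexpv R m) z (Jstd a) = Jstd ('d (@cexpv R m) z a).
Proof.
rewrite !diff_cexpv; apply: Cn_eqP => k.
by rewrite cval_Jstd !cval_mkCn cval_Jstd mulrCA.
Qed.

Definition cdelta (k : 'I_m) : Cn R m := mkCn (fun j => (j == k)%:R).

Lemma cval_cdelta j k : cval (cdelta k) j = (j == k)%:R.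
Proof. exact: cval_mkCn. Qed.

(** Compatibility with [Jstd] makes a real-linear functional complex linear. This is the passage
    from vectors given as pairs of real rows to complex matrices, whose determinants enter the
    volume form. *)
Lemma complex_linear_sum (F : Cn R m -> R[i]) :
  (forall a u v, F (a *: u + v) = a%:C * F u + F v) ->
  (forall a, F (Jstd a) = 'i * F a) ->
  forall a, F a = \sum_k F (cdelta k) * cval a k.
Proof.
move=> Fl FJ a.
have F0 : F 0 = 0.
  have := Fl 1 0 0; rewrite scaler0 addr0 mul1r => /eqP.
  by rewrite -subr_eq0 opprD addNKr oppr_eq0 => /eqP.
have FS n (c d : 'I_n -> R) (u v : 'I_n -> Cn R m) :
    F (\sum_k (c k *: u k + d k *: v k)) = \sum_k ((c k)%:C * F (u k) + (d k)%:C * F (v k)).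
  elim: n c d u v => [|n IH] c d u v; first by rewrite !big_ord0.
  rewrite !big_ord_recl -addrA Fl Fl addrA; congr (_ + _).
  exact: (IH (fun k => c (lift ord0 k)) (fun k => d (lift ord0 k))).
have aE : a = \sum_k (a.1 0 k *: cdelta k + a.2 0 k *: Jstd (cdelta k)).
  apply: Cn_eqP => j.
  have cvS n (u : 'I_n -> Cn R m) : cval (\sum_k u k) j = \sum_k cval (u k) j.
    by apply: (big_morph (fun u => cval u j)); [move=> ? ?; exact: cvalD|exact: cval0].
  rewrite cvS (bigD1 j) //= big1 ?addr0.
    rewrite cvalD !cvalZ cval_Jstd cval_cdelta eqxx !mulr1 mulrC /cval.
    rewrite -complexiE; apply/eqP; rewrite eq_complex /= !mul0r !mul1r.
    by rewrite subr0 !addr0 !add0r !eqxx.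
  move=> k kj; rewrite cvalD !cvalZ cval_Jstd cval_cdelta eq_sym (negbTE kj).
  by rewrite !mulr0 addr0.
rewrite {1}aE FS; apply: eq_bigr => k _.
have -> : cval a k = (a.1 0 k)%:C + 'i * (a.2 0 k)%:C.
  rewrite -complexiE; apply/eqP; rewrite eq_complex /= !mul0r !mul1r.
  by rewrite subr0 !addr0 !add0r !eqxx.
rewrite FJ; ring.
Qed.

End ComplexVectors.

(** * Curves with prescribed derivative *)

Section ZeroDerivative.
Variable R : realType.

Lemma derive0_const (V : normedModType R) {FV : findim V} (I : set R) (f : R -> V) a b :
  is_interval I -> I a -> I b ->
  (forall t, I t -> differentiable f t /\ 'D_1 f t = 0) -> f a = f b.
Proof.
move=> itv; wlog ab : a b / a < b => [H Ia Ib df|Ia Ib df].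
  by have [ab|ba|->//] := ltgtP a b; [exact: H|symmetry; exact: H].
have [[n [e [l [ll el]]]]] := FV.
suff H i : l i (f a) = l i (f b) by rewrite (el (f a)) (el (f b)); apply: eq_bigr => i _; rewrite H.
have Iab t : a <= t <= b -> I t by move=> tab; exact: itv tab.
have D t : a <= t <= b -> differentiable (l i \o f) t /\ 'D_1 (l i \o f) t = 0.
  move=> /Iab/df[dft Dft]; have [dl dlE] := ll i (f t).
  have dc := differentiable_comp dft dl; split=> //.
  rewrite deriveE// (diff_comp dft dl) /= dlE -deriveE// Dft.
  by have [_ <-] := ll i 0; rewrite linear0.
have [||c _] := @MVT R (l i \o f) (fun=> 0) a b ab.
- move=> t; rewrite in_itv /= => /andP[at_ tb].
  have [|dt Dt] := D t; first by rewrite !ltW.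
  by split; [exact: diff_derivable|exact: Dt].
- apply: continuous_in_subspaceT => t; rewrite inE /= in_itv /= => tab.
  by apply: differentiable_continuous; have [] := D t tab.
by rewrite mul0r => /eqP; rewrite subr_eq0 => /eqP.
Qed.

(** The product of [r] with t |-> exp (-t) has zero derivative. *)
Lemma expR_ode (r : R -> R) : (forall t : R, is_derive t 1 r (r t)) ->
  forall t, r t = expR t * r 0.
Proof.
move=> dr t; pose h : R -> R := (r * (expR \o -%R)).
have dh (s : R) : is_derive s 1 h 0.
  have dN : is_derive s 1 (expR \o -%R : R -> R) (- expR (- s)).
    have dE : differentiable (expR : R -> R) (- s) by apply/derivable1_diffP; exact: derivable_expR.
    have -> : expR \o -%R = (fun t : R => expR (t *: (-1 : R) + 0)).
      by apply/funext => u; rewrite /= addr0 /GRing.scale /= mulrN1.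
    have sE : s *: (-1 : R) + 0 = - s by rewrite addr0 /GRing.scale /= mulrN1.
    have dE' : differentiable (expR : R -> R) (s *: (-1 : R) + 0) by rewrite sE.
    apply: is_derive_eq (derive_line dE') _.
    by rewrite sE (derive_real _ dE); have [_ ->] := is_derive_expR (- s); rewrite scaleN1r.
  apply: is_derive_eq (is_deriveM (dr s) dN) _.
  by rewrite /GRing.scale /= mulrN [expR _ * _]mulrC addNr.
have -> : r t = expR t * h t.
  by rewrite /h /= -[(r * _) t]/(r t * expR (- t)) expRN mulrCA divff ?mulr1// gt_eqF// expR_gt0.
congr (_ * _); rewrite (@is_derive_0_is_cst _ h t 0)//.
by rewrite -[h 0]/(r 0 * expR (- 0)) oppr0 expR0 mulr1.
Qed.

End ZeroDerivative.

Section LocallyConstant.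
Variables (R : realType) (V : normedModType R) (T : topologicalType) (M : manifold V T).
Hypothesis HM : is_manifold M.
Context {FV : findim V}.

Lemma smooth_map_chart x : carrier M x ->
  smooth_map (restr_mfd M (mdom M x)) (triv_mfd setT) (chart M x).
Proof.
move=> Mx; split=> //; first by move=> y [_]; exact: chart_continuous.
move=> y v [My _] _ k; have [_ [_ /(_ y x My Mx k)]] := HM.
by apply: Ck_sub => u [p [[py px] _] <-]; exists p.
Qed.

Lemma derive_chart0 (W : normedModType R) {FW : findim W} (U : set W) (G : W -> T) x u a :
  open U -> smooth_map (triv_mfd U) M G -> carrier M x -> U u -> mdom M x (G u) ->
  mderiv (triv_mfd setT) M G u a = 0 ->
  differentiable (chart M x \o G) u /\ 'D_a (chart M x \o G) u = 0.
Proof.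
move=> oU Gs Mx Uu Gu Ga; pose O := U `&` G @^-1` mdom M x.
have oO : open O by exact: (open_chart_dom HM oU Gs Mx).
have dg : differentiable (chart M x \o G) u.
  by have [+ _] := smooth_chart_map Gs Mx 1; apply.
split=> //.
have HO : is_manifold (triv_mfd O) by exact: triv_is_manifold.
have HD : is_manifold (restr_mfd M (mdom M x)).
  by apply: restr_is_manifold => //; exact: open_dom.
have HT : is_manifold (triv_mfd (setT : set V)) by apply/triv_is_manifold/openT.
have Gs' : smooth_map (triv_mfd O) (restr_mfd M (mdom M x)) G.
  have [GM Gc Gd] := Gs; split.
  - by move=> v [Uv Gv]; split=> //; exact: GM.
  - by move=> v [Uv _]; exact: Gc.
  move=> v y [Uv _] [My _] k; apply: Ck_sub (Gd v y Uv My k) => w [p [[Up _] [py _]] <-].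
  by exists p.
have := mderiv_smooth_comp HO HD HT a Gs' (smooth_map_chart Mx) (conj Uu Gu).
rewrite -[mderiv (triv_mfd O) (restr_mfd _ _) G u a]/(mderiv (triv_mfd setT) M G u a).
by rewrite Ga mderiv0 deriveE.
Qed.

(** The set of times at which the curve sits at [G 0] is closed because the space is Hausdorff, and
    open because in a chart the curve has zero derivative on a small ball; the line is connected. *)
Lemma mderiv0_const (G : R -> T) : hausdorff_space T ->
  smooth_map (triv_mfd setT) M G -> (forall t, mderiv (triv_mfd setT) M G t 1 = 0) ->
  forall t, G t = G 0.
Proof.
move=> hT Gs G0 t; have [GM Gc _] := Gs.
have Gcont : continuous G by move=> s; exact: Gc.
have oT := @openT R.
suff : [set s | G s = G 0] = [set: R] by move=> E; have : [set: R] t by []; rewrite -E.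
have cR : connected [set: R] by apply/connected_intervalP.
apply: cR => //.
- by exists 0.
- exists [set s | G s = G 0]; last by rewrite setTI.
  rewrite openE => s Gs0; rewrite /interior /=.
  have MG := GM s I; have GG := dom_refl HM MG.
  have nD : \forall u \near s, mdom M (G s) (G u).
    by apply: (Gcont s); apply: open_nbhs_nbhs; split=> //; exact: open_dom.
  have /nbhs_ballP[d /= d0 dP] := nD.
  apply/nbhs_ballP; exists d => //= u us.
  rewrite /= -{}Gs0 -(chartK HM MG (dP u us)) -[RHS](chartK HM MG GG); congr (chartV _ _ _).
  apply: (@derive0_const _ _ _ (ball s d) (chart M (G s) \o G)) => //.
  + move=> x y; rewrite -ball_normE /= => xs ys z /andP[xz zy].
    move: xs ys; rewrite !ltr_norml => /andP[x1 x2] /andP[y1 y2].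
    by apply/andP; split; lra.
  + exact: ballxx.
  + by move=> v vs; apply: (derive_chart0 oT Gs MG) => //; exact: dP.
exists [set s | G s = G 0]; last by rewrite setTI.
have cG : closed [set G 0] by apply: accessible_closed_set1; exact: hausdorff_accessible.
have h : closed (G @^-1` [set G 0]) by apply: preimage_closed cG => u _; exact: Gcont.
exact: h.
Qed.

End LocallyConstant.

(* [I] is used below for an interval. *)
Local Notation I0 := Logic.I.

(** * Toric Sasaki cones *)

Section ToricCone.
Variables (R : realType) (m : nat) (S : topologicalType).
Variable MS : manifold 'rV[R]_(2 * m - 1)%N S.
Hypotheses (S_mfd : is_manifold MS) (S_full : carrier MS = setT).
Hypothesis S_hausdorff : hausdorff_space S.
Variable g : S -> 'rV[R]_(2 * m - 1)%N -> 'rV[R]_(2 * m - 1)%N -> R.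
Variable J : S * R -> 'rV[R]_(2 * m - 1)%N * R -> 'rV[R]_(2 * m - 1)%N * R.
Hypothesis S_sasaki : sasaki MS g J.
Variables (A : Cn R m -> S * R -> S * R) (p0 : S * R).
Hypothesis A_action : complex_torus_action MS A J p0.

Local Notation M := (cone_mfd MS).
Local Notation VC := ('rV[R]_(2 * m - 1)%N * R)%type.
Local Notation TC := (triv_mfd (setT : set (Cn R m))).

Lemma cone_is_manifold : is_manifold M.
Proof. by apply: prod_is_manifold => //; apply/triv_is_manifold/open_gt. Qed.
Let HM := cone_is_manifold.

Lemma Cn_is_manifold : is_manifold TC.
Proof. exact/triv_is_manifold/openT. Qed.
Let HT := Cn_is_manifold.

Lemma carrier_cone p : carrier M p <-> 0 < p.2.
Proof. by split=> [[]//|p2]; split=> //; rewrite S_full. Qed.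

Let HP : is_manifold (prod_mfd TC M). Proof. exact: prod_is_manifold. Qed.

Definition orbit_map (z : Cn R m) (p : S * R) := A (cexpv z) p.
Local Notation B := orbit_map.

Lemma orbit_map0 p : carrier M p -> B 0 p = p.
Proof. by have [[_ A1 _] _] := A_action; move=> Mp; rewrite /B cexpv0 A1. Qed.

Lemma orbit_mapD z w p : carrier M p -> B (z + w) p = B z (B w p).
Proof.
have [[_ _ AM] _] := A_action; move=> Mp.
by rewrite /B cexpvD AM//; exact: ctorus_cexpv.
Qed.

Let Psi (q : Cn R m * (S * R)) := (cexpv q.1, q.2).

Let MT := prod_mfd (triv_mfd (@ctorus R m)) M.
Let HMT : is_manifold MT.
Proof. by apply: prod_is_manifold => //; apply/triv_is_manifold/ctorus_open. Qed.

Let cexpv_map : smooth_map TC (triv_mfd (@ctorus R m)) (@cexpv R m).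
Proof.
apply: smooth_map_triv; [exact: openT|by move=> z _; exact: ctorus_cexpv|].
exact: cexpv_smooth.
Qed.

Let HCT : is_manifold (triv_mfd (@ctorus R m)).
Proof. exact/triv_is_manifold/ctorus_open. Qed.

Let Psi_smooth : smooth_map (prod_mfd TC M) MT Psi.
Proof.
apply: smooth_map_pair => //.
  exact: (smooth_map_comp HP HT HCT (smooth_map_fst HT HM) cexpv_map).
exact: smooth_map_snd.
Qed.

Let A_smooth : smooth_map MT M (fun q => A q.1 q.2).
Proof. by have [[[]]] := A_action. Qed.

Lemma orbit_map_smooth : smooth_map (prod_mfd TC M) M (fun q => B q.1 q.2).
Proof. exact: (smooth_map_comp HP HMT HM Psi_smooth A_smooth). Qed.

Lemma carrier_orbit_map z p : carrier M p -> carrier M (B z p).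
Proof. by move=> Mp; have [BM _ _] := orbit_map_smooth; exact: (BM (z, p) (conj I Mp)). Qed.

(** The joint holomorphy of the action survives the passage to logarithmic coordinates because the
    exponential is holomorphic. *)
Lemma mderiv_orbit_map_Jstd q a v : carrier M q.2 ->
  mderiv (prod_mfd TC M) M (fun q => B q.1 q.2) q (Jstd a, J q.2 v) =
  J (B q.1 q.2) (mderiv (prod_mfd TC M) M (fun q => B q.1 q.2) q (a, v)).
Proof.
move=> Mq; have Mq' : carrier (prod_mfd TC M) q by [].
have E (w : (Cn R m * VC)%type) : mderiv (prod_mfd TC M) M (fun q => B q.1 q.2) q w =
    mderiv MT M (fun q => A q.1 q.2) (Psi q) ('d (@cexpv R m) (q.1) (w.1), w.2).
  apply: etrans (mderiv_smooth_comp HP HMT HM w Psi_smooth A_smooth Mq') _.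
  congr (mderiv _ _ _ _ _).
  have s1 : smooth_map (prod_mfd TC M) (triv_mfd (@ctorus R m)) (@cexpv R m \o fst).
    exact: (smooth_map_comp HP HT HCT (smooth_map_fst HT HM) cexpv_map).
  have s2 : smooth_map (prod_mfd TC M) M snd by exact: smooth_map_snd.
  apply: etrans (mderiv_pair w (smooth_mdiff HP HCT s1 Mq') (smooth_mdiff HP HM s2 Mq')) _.
  rewrite (mderiv_snd HM w Mq'); congr (_, _).
  apply: etrans (mderiv_smooth_comp HP HT HCT w (smooth_map_fst HT HM) cexpv_map Mq') _.
  by rewrite (mderiv_fst HT w Mq').
have [[[_ Ah] _ _] _] := A_action.
rewrite !E /= diff_cexpv_Jstd.
by rewrite (Ah (Psi q) (_, v))//; split=> //; exact: ctorus_cexpv.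
Qed.

(* [orbit_field a] is the vector field generated by the element [a] of the Lie
   algebra of the complex torus, and [orbit_diff z] the differential of the
   action of [exp z]. *)
Definition orbit_field (a : Cn R m) (p : S * R) : VC := mderiv TC M (fun z => B z p) 0 a.
Definition orbit_diff (z : Cn R m) (p : S * R) (v : VC) : VC := mderiv M M (B z) p v.
Local Notation X := orbit_field.
Local Notation D := orbit_diff.

Lemma orbit_smooth p : carrier M p -> smooth_map TC M (fun z => B z p).
Proof.
move=> Mp; apply: (smooth_map_comp HT HP HM (F := fun z => (z, p)) _ orbit_map_smooth).
apply: smooth_map_pair => //; first exact: smooth_map_id.
exact: smooth_map_cst.
Qed.

Lemma orbit_map_smooth2 z : smooth_map M M (B z).
Proof.
apply: (smooth_map_comp HM HP HM (F := fun p => (z, p)) _ orbit_map_smooth).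
apply: smooth_map_pair => //; first exact: smooth_map_cst.
exact: smooth_map_id.
Qed.

Lemma mderiv_orbit z p a : carrier M p ->
  mderiv TC M (fun z => B z p) z a =
  mderiv (prod_mfd TC M) M (fun q => B q.1 q.2) (z, p) (a, 0).
Proof.
move=> Mp; have s1 := smooth_map_id HT; have s2 : smooth_map TC M (fun=> p).
  exact: smooth_map_cst.
have sp := smooth_map_pair HT HT HM s1 s2.
apply: etrans (mderiv_smooth_comp HT HP HM a sp orbit_map_smooth (I : carrier TC z)) _.
congr (mderiv _ _ _ _ _).
apply: etrans (mderiv_pair a (smooth_mdiff HT HT s1 (I : carrier TC z)) (smooth_mdiff HT HM s2 (I : carrier TC z))) _.
by rewrite mderiv_id// mderiv_cst.
Qed.

Lemma orbit_diffE z p v : carrier M p ->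
  D z p v = mderiv (prod_mfd TC M) M (fun q => B q.1 q.2) (z, p) (0, v).
Proof.
move=> Mp; have s1 := smooth_map_id HM; have s2 : smooth_map M TC (fun=> z).
  exact: smooth_map_cst.
have sp := smooth_map_pair HM HT HM s2 s1.
apply: etrans (mderiv_smooth_comp HM HP HM v sp orbit_map_smooth Mp) _.
congr (mderiv _ _ _ _ _).
apply: etrans (mderiv_pair v (smooth_mdiff HM HT s2 Mp) (smooth_mdiff HM HM s1 Mp)) _.
by rewrite mderiv_id// mderiv_cst.
Qed.

(** By the group law, the orbit map of [p] near [z] is the orbit map of [B z p] near 0, translated
    by [z]. *)
Lemma mderiv_orbit_field z p a : carrier M p ->
  mderiv TC M (fun z => B z p) z a = X a (B z p).
Proof.
move=> Mp; have s1 : smooth_map TC TC (fun y => y - z).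
  apply: smooth_map_triv; [exact: openT|by []|move=> k].
  by apply: CkD; [exact: openT|exact: Ck_clinear (@clinear_id _ _)|exact: Ck_cst].
have s2 := orbit_smooth (carrier_orbit_map z Mp).
have E : (fun y => B y p) = (fun y => B y (B z p)) \o (fun y => y - z).
  by apply/funext => y; rewrite /= -orbit_mapD// subrK.
rewrite {1}E; apply: etrans (mderiv_smooth_comp HT HT HM a s1 s2 (I : carrier TC z)) _.
rewrite subrr; congr (mderiv _ _ _ _ _).
have [d dE] : is_diff z (fun y : Cn R m => y - z) id.
  have -> : (fun y : Cn R m => y - z) = id + cst (- z) by [].
  by apply: is_diff_eq (is_diffD (is_diff_id z) (is_diff_cst (- z) z)) _; rewrite addr0.
by rewrite -[mderiv _ _ _ _ _]/('d (fun y : Cn R m => y - z) z a) dE.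
Qed.

Lemma mderiv_orbit_map z p a v : carrier M p ->
  mderiv (prod_mfd TC M) M (fun q => B q.1 q.2) (z, p) (a, v) = X a (B z p) + D z p v.
Proof.
move=> Mp; rewrite -mderiv_orbit_field// mderiv_orbit// orbit_diffE// -mderivD.
by congr (mderiv _ _ _ _ _); rewrite -[RHS]/(a + 0, 0 + v) addr0 add0r.
Qed.

Lemma J_linear p a u v : carrier M p -> J p (a *: u + v) = a *: J p u + J p v.
Proof. by have [_ [_ [+ _] _ _]] := S_sasaki => + Mp; move=> /(_ p Mp)[+ _]; apply. Qed.

Lemma J_invol p v : carrier M p -> J p (J p v) = - v.
Proof. by have [_ [_ [+ _] _ _]] := S_sasaki => + Mp; move=> /(_ p Mp)[_]; apply. Qed.

Lemma J0 p : carrier M p -> J p 0 = 0.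
Proof.
move=> Mp; have := J_linear 1 0 0 Mp; rewrite !scale1r !addr0 => /eqP.
by rewrite -subr_eq0 opprD addNKr oppr_eq0 => /eqP.
Qed.

Lemma JZ p a u : carrier M p -> J p (a *: u) = a *: J p u.
Proof. by move=> Mp; have := J_linear a u 0 Mp; rewrite J0// !addr0. Qed.

Lemma JD p u v : carrier M p -> J p (u + v) = J p u + J p v.
Proof. by move=> Mp; have := J_linear 1 u v Mp; rewrite !scale1r. Qed.

Lemma orbit_field_J a p : carrier M p -> X (Jstd a) p = J p (X a p).
Proof.
move=> Mp; have := @mderiv_orbit_map_Jstd (0, p) a 0 Mp.
rewrite J0// !mderiv_orbit_map// /= orbit_map0// /D.
by rewrite !mderiv0 !addr0.
Qed.

Lemma orbit_diff_J z p v : carrier M p -> D z p (J p v) = J (B z p) (D z p v).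
Proof.
move=> Mp; have := @mderiv_orbit_map_Jstd (z, p) 0 v Mp.
have -> : Jstd (0 : Cn R m) = 0 by rewrite /Jstd /= oppr0.
by rewrite !mderiv_orbit_map// /X !mderiv0 !add0r.
Qed.

Lemma orbit_field_linear a u v p : X (a *: u + v) p = a *: X u p + X v p.
Proof. exact: mderivP. Qed.

(** The group is commutative, so its generators are invariant under its action. *)
Lemma orbit_diff_field z a p : carrier M p -> D z p (X a p) = X a (B z p).
Proof.
move=> Mp; have E : B z \o (fun y => B y p) = (fun y => B y (B z p)).
  by apply/funext => y; rewrite /= -!orbit_mapD// addrC.
have e := mderiv_smooth_comp HT HM HM a (orbit_smooth Mp) (orbit_map_smooth2 z) (I : carrier TC 0).
rewrite (orbit_map0 Mp) in e; apply: etrans (esym e) _.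
exact: (congr1 (fun F => mderiv TC M F 0 a) E).
Qed.

Lemma orbit_diffK z p v : carrier M p -> D (- z) (B z p) (D z p v) = v.
Proof.
move=> Mp.
have := mderiv_smooth_comp HM HM HM v (orbit_map_smooth2 z) (orbit_map_smooth2 (- z)) Mp.
rewrite -/(D (- z) _ _) -/(D z p v) => <-.
have idE q : carrier M q -> id q = (B (- z) \o B z) q.
  by move=> Mq; rewrite /= -orbit_mapD// addNr orbit_map0.
have [_ ->] := near_mderiv HM Mp (open_carrier HM) Mp idE (smooth_mdiff HM HM (smooth_map_id HM) Mp).
by rewrite mderiv_id.
Qed.

Lemma orbit_diffD z w p v : carrier M p -> D (z + w) p v = D z (B w p) (D w p v).
Proof.
move=> Mp; have e := mderiv_smooth_comp HM HM HM v (orbit_map_smooth2 w) (orbit_map_smooth2 z) Mp.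
apply: etrans e.
have idE q : carrier M q -> (B z \o B w) q = B (z + w) q by move=> Mq; rewrite orbit_mapD.
have sc : smooth_map M M (B z \o B w).
  exact: (smooth_map_comp HM HM HM (orbit_map_smooth2 w) (orbit_map_smooth2 z)).
have [_ E] := near_mderiv HM Mp (open_carrier HM) Mp idE (smooth_mdiff HM HM sc Mp).
by rewrite /D E.
Qed.

Lemma mderiv_orbit_curve (I : set R) (zc : R -> Cn R m) p t u s : open I -> I t ->
  carrier M p -> differentiable zc t ->
  mdiff (prod_mfd M (triv_mfd I)) M (fun q => B (zc q.2) q.1) (p, t) /\
  mderiv (prod_mfd M (triv_mfd I)) M (fun q => B (zc q.2) q.1) (p, t) (u, s) =
  X (s *: 'D_1 zc t) (B (zc t) p) + D (zc t) p u.
Proof.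
move=> oI It Mp dz.
have HI : is_manifold (triv_mfd I) by exact: triv_is_manifold.
have HMI : is_manifold (prod_mfd M (triv_mfd I)) by exact: prod_is_manifold.
have Mpt : carrier (prod_mfd M (triv_mfd I)) (p, t) by [].
have d1 : mdiff (prod_mfd M (triv_mfd I)) M fst (p, t).
  have sf : smooth_map (prod_mfd M (triv_mfd I)) M fst by exact: smooth_map_fst.
  have h := smooth_mdiff HMI HM sf Mpt.
  exact: h.
have d2 : mdiff (prod_mfd M (triv_mfd I)) (triv_mfd I) snd (p, t).
  have sf : smooth_map (prod_mfd M (triv_mfd I)) (triv_mfd I) snd by exact: smooth_map_snd.
  have h := smooth_mdiff HMI HI sf Mpt.
  exact: h.
have [zc_c zc_d zc_E] := mderiv_comp (G := zc) (M3 := TC) HMI HI Mpt It d2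
  (differentiable_continuous dz) dz.
have dPsi := mdiff_pair (conj zc_c zc_d) d1.
have sB := smooth_mdiff HP HM orbit_map_smooth (conj I0 Mp : carrier (prod_mfd TC M) (zc t, p)).
have [cB dB E] := mderiv_comp (G := fun q => B q.1 q.2) HMI HP Mpt
  (conj I0 Mp : carrier (prod_mfd TC M) (zc t, p)) dPsi sB.1 sB.2.
split; first by split.
apply: etrans (E (u, s)) _.
rewrite -mderiv_orbit_map//; congr (mderiv _ _ _ _ _).
apply: etrans (mderiv_pair (u, s) (conj zc_c zc_d) d1) _.
rewrite (mderiv_fst HM _ Mpt); congr (_, _).
apply: etrans (zc_E (u, s)) _; rewrite (mderiv_snd HI _ Mpt) /=.
by rewrite -[mderiv _ _ _ _ _]/('d zc t s) -deriveE// (derive_real _ dz).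
Qed.

Lemma ray_smooth a p : carrier M p ->
  smooth_map (triv_mfd (setT : set R)) M (fun t : R => B (t *: a) p).
Proof.
move=> Mp; have HR : is_manifold (triv_mfd (setT : set R)) by exact/triv_is_manifold/openT.
apply: (smooth_map_comp HR HT HM (F := fun t : R => t *: a) _ (orbit_smooth Mp)).
apply: smooth_map_triv => //; first exact: openT.
by move=> k; apply: Ck_clinear; exact: clinear_scalel.
Qed.

Lemma mderiv_ray a p (t : R) : carrier M p ->
  mderiv (triv_mfd (setT : set R)) M (fun t : R => B (t *: a) p) t 1 = X a (B (t *: a) p).
Proof.
move=> Mp; have HR : is_manifold (triv_mfd (setT : set R)) by exact/triv_is_manifold/openT.
have sl : smooth_map (triv_mfd (setT : set R)) TC (fun t : R => t *: a).
  apply: smooth_map_triv => //; first exact: openT.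
  by move=> k; apply: Ck_clinear; exact: clinear_scalel.
have e := mderiv_smooth_comp HR HT HM (1 : R) sl (orbit_smooth Mp) (I0 : carrier (triv_mfd setT) t).
apply: etrans e _; rewrite mderiv_orbit_field//; congr (X _ _).
have [dl dlE] := clinear_scalel a t.
by rewrite -[mderiv _ _ _ _ _]/('d (fun t : R => t *: a) t 1) dlE scale1r.
Qed.

Lemma fundamental_fieldE v p : carrier M p -> fundamental_field MS A v p = X (0, v) p.
Proof.
move=> Mp; rewrite /fundamental_field /velocity.
have -> : (fun t => A (texp (t *: v)) p) = (fun t : R => B (t *: ((0, v) : Cn R m)) p).
  apply/funext => t; rewrite /B /texp; congr (A (cexpv _) p).
  by rewrite -[RHS]/(t *: 0, t *: v) scaler0.
apply: etrans (mderiv_ray _ _ Mp) _; congr (X _ _).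
by rewrite scale0r orbit_map0.
Qed.

(** * The Reeb direction and the flow of dilations *)

Section Reeb.
Variable xi : 'rV[R]_m.
Hypothesis xi_reeb : forall p, carrier M p -> reeb J p = fundamental_field MS A xi p.

(** The Reeb field is J (r d/dr), and (0, xi) is i times (xi, 0); as the generators are compatible
    with J, it can be cancelled from both sides. *)
Lemma orbit_field_reeb p : carrier M p -> X (xi, 0) p = (0, p.2).
Proof.
move=> Mp; have := xi_reeb Mp; rewrite fundamental_fieldE// /reeb.
have -> : ((0, xi) : Cn R m) = Jstd ((xi, 0) : Cn R m) by rewrite /Jstd /= oppr0.
rewrite orbit_field_J// => /(congr1 (J p)); rewrite !J_invol//.
by move/oppr_inj.
Qed.

(** Integration of the radial field r d/dr: the component in S has zero derivative, and the radius
    solves r' = r. *)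
Lemma orbit_map_dilation s p : carrier M p -> B (s *: (xi, 0)) p = dilation (expR s) p.
Proof.
move=> Mp; pose c (t : R) := B (t *: ((xi, 0) : Cn R m)) p.
have HR : is_manifold (triv_mfd (setT : set R)) by exact/triv_is_manifold/openT.
have HR0 : is_manifold (triv_mfd [set r : R | 0 < r]) by exact/triv_is_manifold/open_gt.
have cs : smooth_map (triv_mfd setT) M c by exact: ray_smooth.
have Mc t : carrier M (c t) by exact: carrier_orbit_map.
have cD t : mderiv (triv_mfd setT) M c t 1 = (0, (c t).2).
  by rewrite /c mderiv_ray// orbit_field_reeb//; exact: carrier_orbit_map.
have c0 : c 0 = p by rewrite /c scale0r orbit_map0.
have s1 : smooth_map M MS fst by exact: smooth_map_fst.
have s2 : smooth_map M (triv_mfd [set r : R | 0 < r]) snd by exact: smooth_map_snd.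
have e1 : (c s).1 = (c 0).1.
  have cs1 : smooth_map (triv_mfd setT) MS (fst \o c) by exact: (smooth_map_comp HR HM S_mfd cs s1).
  apply: (mderiv0_const S_mfd S_hausdorff cs1) => t.
  have e := mderiv_smooth_comp HR HM S_mfd (1 : R) cs s1 (I0 : carrier (triv_mfd setT) t).
  by apply: etrans e _; rewrite cD; apply: etrans (mderiv_fst S_mfd _ (Mc t)) _.
have e2 : (c s).2 = expR s * (c 0).2.
  apply: (expR_ode (r := fun t => (c t).2)) => t.
  have e := mderiv_smooth_comp HR HM HR0 (1 : R) cs s2 (I0 : carrier (triv_mfd setT) t).
  rewrite cD in e; have e' := etrans e (mderiv_snd HR0 _ (Mc t)).
  have [_ d] := smooth_mdiff HR HR0 (smooth_map_comp HR HM HR0 cs s2) (I0 : carrier (triv_mfd setT) t).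
  have d' : differentiable (snd \o c) t by exact: d.
  split; first exact: diff_derivable.
  by rewrite deriveE.
by rewrite /dilation -/(c s) [c s]surjective_pairing e1 e2 c0.
Qed.

Lemma orbit_diff_dilation s p v : carrier M p ->
  D (s *: (xi, 0)) p v = (v.1, expR s * v.2).
Proof.
move=> Mp.
have [_ E] := near_mderiv HM Mp (open_carrier HM) Mp (fun q Mq => orbit_map_dilation s Mq)
  (smooth_mdiff HM HM (orbit_map_smooth2 _) Mp).
rewrite /D -E {E}; have [MSp Mr] := Mp.
pose f (w : VC) : VC := (w.1, expR s * w.2).
have lf : clinear f.
  apply: clinear_pair; first exact: clinear_fst.
  have lm : clinear (fun r : R => expR s * r).
    have -> : (fun r : R => expR s * r) = (fun r : R => r *: expR s).
      by apply/funext => r; rewrite mulrC.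
    exact: clinear_scalel.
  exact: clinear_comp (@clinear_snd R _ _) lm.
rewrite /mderiv.
have n1 : \forall w \near chart M p p,
    f w = (chart M (dilation (expR s) p) \o dilation (expR s) \o chartV M p) w.
  apply: filterS (open_nbhs_nbhs (conj (open_chart_img HM Mp) (chart_img_chart (dom_refl HM Mp)))).
  move=> w [q [q1 q2] <-]; rewrite /f /=.
  by rewrite (chartK S_mfd MSp q1).
have [_ ->] := near_eq_diff n1 (lf (chart M p p)).1.
by rewrite (lf (chart M p p)).2.
Qed.

Lemma orbit_field0 p : X 0 p = 0. Proof. exact: mderiv0. Qed.

Hypothesis S_toric : toric MS A g.
Local Notation G := (cone_metric g).
Local Notation omega := (kahler_form J G).

Let K : kahler M m J G. Proof. by have [] := S_sasaki. Qed.

(** The imaginary part acts by isometries, and the dilation by exp s multiplies both r^2 g and dr^2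
    by exp (2 s). *)
Lemma metric_orbit_map s y p u v : carrier M p ->
  G (B (s *: xi, y) p) (D (s *: xi, y) p u) (D (s *: xi, y) p v) = expR s ^+ 2 * G p u v.
Proof.
move=> Mp; have -> : ((s *: xi, y) : Cn R m) = s *: ((xi, 0) : Cn R m) + (0, y).
  by rewrite -[RHS]/(s *: xi + 0, s *: 0 + y) scaler0 addr0 add0r.
have Mq := carrier_orbit_map (0, y) Mp.
rewrite orbit_mapD// !orbit_diffD// orbit_map_dilation// !orbit_diff_dilation//.
have [_ + _ _] := S_toric => /(_ (cexpv ((0, y) : Cn R m)) p u v (torus_cexpv y) Mp).
rewrite -[A _ p]/(B (0, y) p) -[mderiv M M _ p u]/(D (0, y) p u) -[mderiv M M _ p v]/(D (0, y) p v).
rewrite /cone_metric => <- /=.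
set r := (B (0, y) p).2; set gg := g _ _ _; set a := (D _ _ u).2; set b := (D _ _ v).2.
have swap (e x h c d : R) : (e * x) ^+ 2 * h + e * c * (e * d) = e ^+ 2 * (x ^+ 2 * h + c * d) by ring.
exact: swap.
Qed.

Lemma omega_orbit_map s y p u v : carrier M p ->
  omega (B (s *: xi, y) p) (D (s *: xi, y) p u) (D (s *: xi, y) p v) = expR s ^+ 2 * omega p u v.
Proof. by move=> Mp; rewrite /kahler_form -orbit_diff_J// metric_orbit_map. Qed.

Lemma cone_metric_bilinear : bilinear2 M G. Proof. exact: metric_bilinear K. Qed.

Lemma omega_bilinear : bilinear2 M omega. Proof. exact: kahler_form_bilinear K. Qed.

(* The form is closed, invariant under the compact torus and homogeneous of
   degree 2 under the flow of the radial field: evaluate [d omega = 0] on the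
   radial field and two generators of the compact torus. *)
Lemma torus_orbit_isotropic p a b : carrier M p -> omega p (X (0, a) p) (X (0, b) p) = 0.
Proof.
move=> Mp; pose P := pull2 M omega (fun z => B z p).
have PE z c d : P c d z = omega (B z p) (X c (B z p)) (X d (B z p)).
  by rewrite /P /pull2 !mderiv_orbit_field.
have oC : open [set: Cn R m] by exact: openT.
have P1 c d : Ck 1 setT (P c d).
  apply: (pull2_Ck HM omega_bilinear oC (orbit_smooth Mp)) => x a' b' Mx.
  exact: kahler_form_smooth K _ _ _ _ Mx.
have dP c d : differentiable (P c d) 0 by have [+ _] := P1 c d; apply.
(* The generators are invariant, so their pairing scales as the form itself. *)
have PT s y c d : P c d (s *: xi, y) = expR s ^+ 2 * P c d 0.
  rewrite !PE orbit_map0// -(omega_orbit_map s y)//.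
  by rewrite !orbit_diff_field.
have D0 y c d : 'D_((0, y) : Cn R m) (P c d) 0 = 0.
  have dP' : differentiable (P c d) ((0 : R) *: ((0, y) : Cn R m) + 0) by rewrite scale0r addr0.
  have [_] := derive_line dP'; rewrite scale0r addr0 => <-.
  have -> : (fun t : R => P c d (t *: ((0, y) : Cn R m) + 0)) = cst (P c d 0).
    apply/funext => t; have := PT 0 (t *: y) c d.
    rewrite expR0 expr1n mul1r scale0r => <-; congr (P c d _).
    by rewrite addr0 -[LHS]/(t *: 0, t *: y) scaler0.
  exact: derive_cst.
have Dxi c d : 'D_((xi, 0) : Cn R m) (P c d) 0 = 2 * P c d 0.
  have dP' : differentiable (P c d) ((0 : R) *: ((xi, 0) : Cn R m) + 0) by rewrite scale0r addr0.
  have [_] := derive_line dP'; rewrite scale0r addr0 => <-.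
  have -> : (fun t : R => P c d (t *: ((xi, 0) : Cn R m) + 0)) =
      (fun t : R => expR t * expR t * P c d 0).
    apply/funext => t; have := PT t 0 c d.
    rewrite expr2 => <-; congr (P c d _).
    by rewrite addr0 -[LHS]/(t *: xi, t *: 0) scaler0.
  have eE : is_derive (0 : R) (1 : R) (expR : R -> R) (expR 0) by exact: is_derive_expR.
  have [_ ->] := is_deriveM (is_deriveM eE eE) (is_derive_cst (P c d 0) (0 : R) (1 : R)).
  have two (x e : R) : e = 1 -> e * e * 0 + x * (e * e + e * e) = 2 * x by move=> ->; ring.
  by apply: two; exact: expR0.
have wc : closed2 M omega by have [] := K.
(* The last two derivatives vanish by invariance under the compact torus, and the first one is twice
   the pairing by homogeneity of degree 2. *)
have cl : 'D_((xi, 0) : Cn R m) (P (0, a) (0, b)) 0 + 'D_((0, a) : Cn R m) (P (0, b) (xi, 0)) 0 +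
    'D_((0, b) : Cn R m) (P (xi, 0) (0, a)) 0 = 0.
  apply: (closed2_pull2 HM omega_bilinear oC (orbit_smooth Mp)) => //.
    by move=> q u v Mq; apply: (kahler_form_anti K).
  by move=> x a' b' Mx; exact: kahler_form_smooth K _ _ _ _ Mx.
move: cl; rewrite Dxi !D0 !addr0 PE orbit_map0// => /eqP.
by rewrite mulf_eq0 pnatr_eq0 /= => /eqP.
Qed.

(** * Density of the open orbit *)

Definition on_open_orbit (q : S * R) : Prop := exists z, q = B z p0.

Lemma carrier_p0 : carrier M p0. Proof. by have [_ []] := A_action. Qed.

Lemma on_open_orbit_carrier q : on_open_orbit q -> carrier M q.
Proof. by move=> [z ->]; exact/carrier_orbit_map/carrier_p0. Qed.

Lemma open_orbit_meets p (O : set (S * R)) : carrier M p -> nbhs p O ->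
  exists q, O q /\ on_open_orbit q.
Proof.
move=> Mp nO; have [_ [_ _ dense _]] := A_action.
have [q [[w wt <-] Oq]] := dense p Mp O nO.
by exists (A w p0); split=> //; have [z <-] := cexpv_surj wt; exists z.
Qed.

(* Identities between continuous objects need only be checked on the dense open
   orbit, where the vector fields of the complex torus span the tangent space. *)
Lemma open_orbit_density p (f : VC -> R) : carrier M p -> {for chart M p p, continuous f} ->
  (forall u, chart_img M p u -> on_open_orbit (chartV M p u) -> f u = 0) ->
  f (chart M p p) = 0.
Proof.
move=> Mp fc f0; apply/eqP/negPn/negP => fp.
have pp := dom_refl HM Mp.
have n1 : \forall u \near chart M p p, f u != 0.
  by apply: (fc [set x | x != 0]); apply: open_nbhs_nbhs; split; [exact: open_neq|].
have n2 : \forall q \near p, f (chart M p q) != 0 by exact: (chart_continuous HM Mp pp) n1.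
have n3 : \forall q \near p, mdom M p q by apply: open_nbhs_nbhs; split; [exact: open_dom|].
have [q [[fq pq] oq]] := open_orbit_meets Mp (filterI n2 n3).
move: fq; rewrite f0 ?eqxx//; first exact: chart_img_chart.
by rewrite chartK.
Qed.

Lemma open_orbit_eq (T : topologicalType) (F1 F2 : S * R -> T) : hausdorff_space T ->
  (forall p, carrier M p -> {for p, continuous F1}) ->
  (forall p, carrier M p -> {for p, continuous F2}) ->
  (forall q, on_open_orbit q -> F1 q = F2 q) -> forall p, carrier M p -> F1 p = F2 p.
Proof.
move=> hT c1 c2 F12 p Mp; apply: contrapT => /eqP ne.
move: hT; rewrite open_hausdorff => /(_ _ _ ne) [].
move=> [W1 W2] /= [h1 h2] [ ? ? /eqP W12].
rewrite !inE in h1 h2.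
have n1 : \forall q \near p, W1 (F1 q) by apply: (c1 p Mp); exact: open_nbhs_nbhs.
have n2 : \forall q \near p, W2 (F2 q) by apply: (c2 p Mp); exact: open_nbhs_nbhs.
have [q [[q1 q2] oq]] := open_orbit_meets Mp (filterI n1 n2).
rewrite F12// in q1.
by have : (W1 `&` W2) (F2 q) by []; rewrite W12.
Qed.

Lemma mderiv_comp_chartV (F : S * R -> S * R) x u a : smooth_map M M F -> carrier M x ->
  chart_img M x u ->
  mderiv (triv_mfd setT) M (F \o chartV M x) u a =
  mderiv M M F (chartV M x u) (mderiv (triv_mfd setT) M (chartV M x) u a).
Proof.
move=> Fs Mx ux; have HC : is_manifold (triv_mfd (chart_img M x)).
  by apply/triv_is_manifold/open_chart_img.
exact: (mderiv_smooth_comp HC HM HM a (smooth_map_chartV HM Mx) Fs ux).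
Qed.

Lemma smooth_comp_chartV (F : S * R -> S * R) x : smooth_map M M F -> carrier M x ->
  smooth_map (triv_mfd (chart_img M x)) M (F \o chartV M x).
Proof.
move=> Fs Mx; have HC : is_manifold (triv_mfd (chart_img M x)).
  by apply/triv_is_manifold/open_chart_img.
exact: (smooth_map_comp HC HM HM (smooth_map_chartV HM Mx) Fs).
Qed.

(** The two vectors are extended as constants in the chart centred at [p]; the defect of isometry is
    then a continuous real function of the coordinates, zero on the dense orbit. *)
Lemma metric_density (F : S * R -> S * R) : smooth_map M M F ->
  (forall q u v, on_open_orbit q -> G (F q) (mderiv M M F q u) (mderiv M M F q v) = G q u v) ->
  forall p u v, carrier M p -> G (F p) (mderiv M M F p u) (mderiv M M F p v) = G p u v.
Proof.
move=> Fs Fo p u v Mp.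
have oC : open (chart_img M p) by exact: open_chart_img.
have gs x a b : carrier M x -> Ck 0 (chart_img M x) (coord2 M G x a b).
  by move=> Mx; have [[_ gs] _ _ _] := K; exact: gs.
have s1 := smooth_comp_chartV Fs Mp; have s2 := smooth_map_chartV HM Mp.
pose f w := pull2 M G (F \o chartV M p) u v w - pull2 M G (chartV M p) u v w.
have pp := dom_refl HM Mp; have cp := chart_img_chart pp.
have fE w : chart_img M p w -> f w =
    G (F (chartV M p w)) (mderiv M M F (chartV M p w) (mderiv (triv_mfd setT) M (chartV M p) w u))
                      (mderiv M M F (chartV M p w) (mderiv (triv_mfd setT) M (chartV M p) w v))
    - G (chartV M p w) (mderiv (triv_mfd setT) M (chartV M p) w u)
                       (mderiv (triv_mfd setT) M (chartV M p) w v).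
  by move=> wp; rewrite /f /pull2 !mderiv_comp_chartV.
apply/eqP; rewrite -subr_eq0; apply/eqP.
have <- : f (chart M p p) = G (F p) (mderiv M M F p u) (mderiv M M F p v) - G p u v.
  by rewrite fE// !mderiv_chartV// chartK.
apply: open_orbit_density => //.
  have c1 : Ck 0 (chart_img M p) (pull2 M G (F \o chartV M p) u v).
    by apply: (pull2_Ck HM cone_metric_bilinear oC s1); exact: gs.
  have c2 : Ck 0 (chart_img M p) (pull2 M G (chartV M p) u v).
    by apply: (pull2_Ck HM cone_metric_bilinear oC s2); exact: gs.
  by apply: continuousB; [exact: c1|exact: c2].
by move=> w wp oo; rewrite fE// Fo// subrr.
Qed.

(** * The holomorphic volume form and the complex torus *)

Section VolumeForm.
Variables (gamma : 'rV[int]_m) (Omega : S * R -> ('I_m -> VC) -> R[i]).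
Hypothesis Omega_gamma : toric_volume_form MS A J p0 gamma Omega.

(** The character of the complex torus given by [gamma], in logarithmic coordinates. *)
Definition weight (z : Cn R m) : R[i] := cexp (\sum_k (gamma 0 k)%:~R * cval z k).

Lemma weightD z w : weight (z + w) = weight z * weight w.
Proof.
rewrite /weight -cexpD -big_split /=; congr (cexp _); apply: eq_bigr => k _.
by rewrite cvalD mulrDr.
Qed.

Lemma volume_orbit_field z (a : 'I_m -> Cn R m) :
  Omega (B z p0) (fun k => X (a k) (B z p0)) = weight z * \det (\matrix_(j, k) cval (a k) j).
Proof.
have -> : (fun k => X (a k) (B z p0)) = (fun k => mderiv TC M (fun y => B y p0) z (a k)).
  by apply/funext => k; apply/esym/mderiv_orbit_field; exact: carrier_p0.
by have [_ OE] := Omega_gamma; exact: (OE z a).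
Qed.

(** Used with [Phi] the multiplication by a weight, for the complex torus, and with [Phi] the
    conjugation, for [sigma]. *)
Lemma volume_density (F : S * R -> S * R) (Phi : R[i] -> R[i]) : smooth_map M M F ->
  (forall (U : set VC) f, complex_continuous U f -> complex_continuous U (fun u => Phi (f u))) ->
  (forall q v, on_open_orbit q ->
    Omega (F q) (fun k => mderiv M M F q (v k)) = Phi (Omega q v)) ->
  forall p v, carrier M p -> Omega (F p) (fun k => mderiv M M F p (v k)) = Phi (Omega p v).
Proof.
move=> Fs Phic Fo p v Mp.
have oC : open (chart_img M p) by exact: open_chart_img.
have [_ [_ JM _ _]] := S_sasaki; have [Omh _] := Omega_gamma.
have s1 := smooth_comp_chartV Fs Mp; have s2 := smooth_map_chartV HM Mp.
have c1 : complex_continuous (chart_img M p) (fun w => Omega (F (chartV M p w))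
    (fun k => mderiv (triv_mfd setT) M (F \o chartV M p) w (v k))).
  by apply: (volume_form_continuous HM JM Omh oC s1 v).
have c2 : complex_continuous (chart_img M p) (fun w => Phi (Omega (chartV M p w)
    (fun k => mderiv (triv_mfd setT) M (chartV M p) w (v k)))).
  by apply: Phic; apply: (volume_form_continuous HM JM Omh oC s2 v).
pose f w := Omega (F (chartV M p w)) (fun k => mderiv (triv_mfd setT) M (F \o chartV M p) w (v k))
  - Phi (Omega (chartV M p w) (fun k => mderiv (triv_mfd setT) M (chartV M p) w (v k))).
have pp := dom_refl HM Mp; have cp := chart_img_chart pp.
have fc : complex_continuous (chart_img M p) f.
  have c3 := complex_continuousM (@complex_continuous_cst R VC (chart_img M p) (-1)) c2.
  by apply: complex_continuous_ext (complex_continuousD c1 c3) => w; rewrite mulN1r.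
have fE w : chart_img M p w -> f w =
  Omega (F (chartV M p w)) (fun k => mderiv M M F (chartV M p w) (mderiv (triv_mfd setT) M (chartV M p) w (v k)))
  - Phi (Omega (chartV M p w) (fun k => mderiv (triv_mfd setT) M (chartV M p) w (v k))).
  move=> wp; rewrite /f; congr (Omega _ _ - _).
  by apply/funext => k; rewrite mderiv_comp_chartV.
have [fr fi] := fc _ cp.
have f0 w : chart_img M p w -> on_open_orbit (chartV M p w) -> f w = 0.
  by move=> wp oo; rewrite fE// Fo// subrr.
have r0 : complex.Re (f (chart M p p)) = 0.
  by apply: (open_orbit_density (f := fun w => complex.Re (f w))) => // w wp oo; rewrite f0.
have i0 : complex.Im (f (chart M p p)) = 0.
  by apply: (open_orbit_density (f := fun w => complex.Im (f w))) => // w wp oo; rewrite f0.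
apply/eqP; rewrite -subr_eq0; apply/eqP.
have : f (chart M p p) = 0.
  by apply/eqP; rewrite eq_complex r0 i0 !eqxx.
rewrite fE// chartK// => <-; congr (Omega _ _ - Phi (Omega _ _)).
  by apply/funext => k; rewrite mderiv_chartV.
by apply/funext => k; rewrite mderiv_chartV.
Qed.

(** On the generators of the m real coordinate directions, Omega_gamma is a nonzero exponential; in
    holomorphic coordinates it is a multiple of the determinant of their matrix [Z], which is
    therefore invertible and yields the coefficients. *)
Lemma orbit_field_span q v : on_open_orbit q -> exists a, v = X a q.
Proof.
move=> oq; have Mq := on_open_orbit_carrier oq; have [z0 qE] := oq.
have [_ [_ [_ Jz] _ _]] := S_sasaki; have [U [z [Uq Uz]]] := Jz q Mq.
have [Omh _] := Omega_gamma; have [h [_ /(_ q Uq)[h0 OE]]] := Omh _ _ Uz.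
have [zV [_ _ dK1 _]] := holo_coord_inverse HM Uz.
have [_ _ _ [_ zh] _] := Uz.
pose dz := mderiv M (triv_mfd (setT : set (Cn R m))) z q.
have dzJ w : dz (J q w) = Jstd (dz w) by exact: (zh q w (conj Mq Uq)).
pose Z := \matrix_(j < m, k < m) cval (dz (X (cdelta R k) q)) j.
have ZE a j : cval (dz (X a q)) j = \sum_k Z j k * cval a k.
  rewrite (complex_linear_sum (F := fun a => cval (dz (X a q)) j)).
  - by apply: eq_bigr => k _; rewrite mxE.
  - by move=> c u w; rewrite orbit_field_linear /dz mderivP cvalD cvalZ.
  - by move=> w; rewrite orbit_field_J// dzJ cval_Jstd.
have Zu : Z \in unitmx.
  rewrite unitmxE unitfE; apply/eqP => Z0.
  have := volume_orbit_field z0 (@cdelta R m); rewrite -qE OE.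
  have -> : \det (\matrix_(j < m, k < m) cval (cdelta R k) j) = 1 :> R[i].
    transitivity (\det (1%:M : 'M[R[i]]_m)); last exact: det1.
    by congr (\det _); apply/matrixP => j k; rewrite !mxE cval_cdelta.
  rewrite -/Z Z0 mulr0 mulr1 => /esym/eqP.
  by rewrite (negbTE (cexp_neq0 _)).
pose y := \col_j cval (dz v) j; pose a := mkCn (fun k => (invmx Z *m y) k 0).
exists a; rewrite -(dK1 q v Uq) -(dK1 q (X a q) Uq); congr (mderiv _ _ _ _ _).
apply: Cn_eqP => j; rewrite -/dz ZE.
have -> : \sum_k Z j k * cval a k = (Z *m (invmx Z *m y)) j 0.
  by rewrite [RHS]mxE; apply: eq_bigr => k _; rewrite cval_mkCn.
by rewrite mulmxA mulmxV// mul1mx mxE.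
Qed.

Lemma orbit_field_span_family q (v : 'I_m -> VC) : on_open_orbit q ->
  exists a : 'I_m -> Cn R m, v = fun k => X (a k) q.
Proof.
move=> oq; have [a aE] := fin_all_exists (fun k => orbit_field_span (v k) oq).
by exists a; apply/funext.
Qed.

Lemma volume_orbit_map z p v : carrier M p ->
  Omega (B z p) (fun k => D z p (v k)) = weight z * Omega p v.
Proof.
apply: (volume_density (Phi := fun x => weight z * x) (orbit_map_smooth2 z)).
  by move=> U f fc; apply: complex_continuousM => //; exact: complex_continuous_cst.
move=> q {}v oq; have Mq := on_open_orbit_carrier oq.
have [a ->] := orbit_field_span_family v oq; have [w qE] := oq.
have -> : (fun k => mderiv M M (B z) q (X (a k) q)) = (fun k => X (a k) (B (z + w) p0)).
  apply/funext => k; apply: etrans (orbit_diff_field z (a k) Mq) _; congr (X _ _).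
  by rewrite qE orbit_mapD//; exact: carrier_p0.
rewrite qE -orbit_mapD; last exact: carrier_p0.
by rewrite !volume_orbit_field weightD mulrA.
Qed.

Lemma cone_metric_gt0 p v : carrier M p -> v != 0 -> 0 < G p v v.
Proof. by have [[gb _] _ _ _] := K; move=> Mp; have [_ _] := gb p Mp; apply. Qed.

Lemma cone_metric_ge0 p v : carrier M p -> 0 <= G p v v.
Proof.
move=> Mp; have [->|v0] := eqVneq v 0; last by rewrite ltW// cone_metric_gt0.
have [wl _] := cone_metric_bilinear Mp.
have := wl 1 0 0 (0 : VC); rewrite scaler0 addr0 mul1r => /eqP.
by rewrite -subr_eq0 opprD addNKr oppr_eq0 => /eqP ->.
Qed.

Lemma cone_metric_sym p u v : carrier M p -> G p u v = G p v u.
Proof. by have [[gb _] _ _ _] := K; move=> Mp; have [_ + _] := gb p Mp; apply. Qed.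

Lemma cone_metricJ p u v : carrier M p -> G p (J p u) (J p v) = G p u v.
Proof. by have [_ _ gJ _] := K; exact: gJ. Qed.

(** The off-diagonal block of the Kaehler form on the frame w followed by J w is the Gram matrix of
    w, because omega(u, J v) = g(J u, J v) = g(u, v). *)
Lemma volume_modulus psi p (w : 'I_m -> VC) : acy_function M J G Omega psi -> carrier M p ->
  (forall j k, omega p (w j) (w k) = 0) ->
  Omega p w * (Omega p w)^* =
  (expR (m%:R * psi p) ^+ 2 * \det (\matrix_(j, k) G p (w j) (w k)))%:C.
Proof.
move=> acy Mp w0; have [_ [_ [_ Jz] _ _]] := S_sasaki; have [U [z [Up Uz]]] := Jz p Mp.
have [Omh _] := Omega_gamma; have [h [_ /(_ p Up)[h0 OE]]] := Omh _ _ Uz.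
have [_ _ _ [_ zh] _] := Uz.
pose zt j v := cval (mderiv M (triv_mfd (setT : set (Cn R m))) z p v) j.
have OE' : Omega p = fun v => h p * \det (\matrix_(j, k) zt j (v k)) by apply/funext => v; exact: OE.
have ac := acy p Mp; rewrite OE' in ac *.
have Gr := cone_metric_bilinear; have [Gl _] := Gr p Mp.
have GN u v : G p (- u) v = - G p u v.
  have := Gl (-1) u 0 v; have := Gl 1 0 0 v; rewrite scaler0 !addr0 scaleN1r => + ->; lra.
apply: (norm_volume_form (w := omega p) (J := J p) 0 ac) => //.
- move=> j u; rewrite /zt -cval_Jstd; congr (cval _ j).
  exact: (zh p u (conj Mp Up)).
- by move=> j k; rewrite -(w0 j k) /kahler_form cone_metricJ.
- by move=> j k; rewrite mxE /kahler_form cone_metricJ.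
- by move=> j k; rewrite mxE /kahler_form J_invol// GN cone_metric_sym.
move=> y; have := cone_metric_ge0 (\sum_j y 0 j *: w j) Mp.
rewrite (bilinear2_sum Gr)// => h1; apply: le_trans h1 _.
rewrite mxE exchange_big /=; rewrite le_eqVlt; apply/orP; left; apply/eqP; apply: eq_bigr => k _.
rewrite !mxE big_distrl /=; apply: eq_bigr => j _; rewrite !mxE.
by rewrite mulrAC.
Qed.

(** * The real structure *)

Section RealStructure.
Variable sigma : S * R -> S * R.
Hypothesis sigma_real : real_structure MS A J p0 sigma.

Let sigma_smooth : smooth_map M M sigma. Proof. by have [[]] := sigma_real. Qed.

Lemma carrier_sigma p : carrier M p -> carrier M (sigma p).
Proof. by have [+ _ _] := sigma_smooth; apply. Qed.

Lemma sigma_open_orbit z : sigma (B z p0) = B (cbar z) p0.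
Proof.
have [_ _ s0] := sigma_real; rewrite /B s0; last exact: ctorus_cexpv.
by rewrite cconj_cexpv.
Qed.

Lemma cbarD z w : cbar (z + w) = cbar z + cbar w :> Cn R m.
Proof. by rewrite /cbar /= opprD. Qed.

Lemma sigma_orbit_map z p : carrier M p -> sigma (B z p) = B (cbar z) (sigma p).
Proof.
have s1 : smooth_map M M (sigma \o B z).
  exact: (smooth_map_comp HM HM HM (orbit_map_smooth2 z) sigma_smooth).
have s2 : smooth_map M M (B (cbar z) \o sigma).
  exact: (smooth_map_comp HM HM HM sigma_smooth (orbit_map_smooth2 (cbar z))).
have c1 q : carrier M q -> {for q, continuous (sigma \o B z)} by have [_ + _] := s1; apply.
have c2 q : carrier M q -> {for q, continuous (B (cbar z) \o sigma)} by have [_ + _] := s2; apply.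
have E q : on_open_orbit q -> sigma (B z q) = B (cbar z) (sigma q).
  move=> [w ->]; rewrite -orbit_mapD; last exact: carrier_p0.
  rewrite !sigma_open_orbit cbarD orbit_mapD//; exact: carrier_p0.
(* Both sides agree on the open orbit; density is applied to each component, in the Hausdorff spaces
   S and R. *)
move=> Mp; rewrite [LHS]surjective_pairing [RHS]surjective_pairing; congr (_, _).
  apply: (open_orbit_eq (F1 := fun q => (sigma (B z q)).1) (F2 := fun q => (B (cbar z) (sigma q)).1) S_hausdorff) => //.
  - by move=> q Mq; exact: (continuous_comp (c1 q Mq) (@cvg_fst _ _ _ _ _)).
  - by move=> q Mq; exact: (continuous_comp (c2 q Mq) (@cvg_fst _ _ _ _ _)).
  - by move=> q /E ->.
have hR : hausdorff_space R := @norm_hausdorff R R.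
have d1 q : carrier M q -> {for q, continuous (fun q => (sigma (B z q)).2)}.
  by move=> Mq; exact: (continuous_comp (c1 q Mq) (@cvg_snd _ _ _ _ _)).
have d2 q : carrier M q -> {for q, continuous (fun q => (B (cbar z) (sigma q)).2)}.
  by move=> Mq; exact: (continuous_comp (c2 q Mq) (@cvg_snd _ _ _ _ _)).
have E2 q : on_open_orbit q -> (sigma (B z q)).2 = (B (cbar z) (sigma q)).2 by move=> /E ->.
exact: (open_orbit_eq hR d1 d2 E2 Mp).
Qed.

Local Notation dsigma := (mderiv M M sigma).

Lemma dsigma_orbit_field a q : carrier M q -> dsigma q (X a q) = X (cbar a) (sigma q).
Proof.
move=> Mq; have Msq := carrier_sigma Mq.
have E : sigma \o (fun y => B y q) = (fun y => B y (sigma q)) \o @cbar R m.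
  by apply/funext => y; rewrite /= sigma_orbit_map.
have lc : clinear (@cbar R m).
  apply: clinear_pair; first exact: clinear_fst.
  exact: (clinear_comp (@clinear_snd R 'rV[R]_m 'rV[R]_m) (@clinear_opp R 'rV[R]_m)).
have sc : smooth_map TC TC (@cbar R m).
  by apply: smooth_map_triv => //; [exact: openT|move=> k; exact: Ck_clinear].
have e1 := mderiv_smooth_comp HT HM HM a (orbit_smooth Mq) sigma_smooth (I0 : carrier TC 0).
have e2 := mderiv_smooth_comp HT HT HM a sc (orbit_smooth Msq) (I0 : carrier TC 0).
rewrite (orbit_map0 Mq) in e1; apply: etrans (esym e1) _.
apply: etrans (congr1 (fun F => mderiv TC M F 0 a) E) _; apply: etrans e2 _.
have c0 : cbar (0 : Cn R m) = 0 by rewrite /cbar /= oppr0.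
rewrite c0; congr (X _ _).
by rewrite -[LHS]/('d (@cbar R m) 0 a) (lc 0).2.
Qed.

Lemma orbit_field_pair a p : carrier M p -> X a p = X (a.1, 0) p + X (0, a.2) p.
Proof.
move=> Mp; rewrite -[X (a.1, 0) p]scale1r -orbit_field_linear scale1r; congr (X _ _).
by case: a => a1 a2; rewrite -[RHS]/(a1 + 0, 0 + a2) addr0 add0r.
Qed.

Lemma orbit_fieldN a p : X (- a) p = - X a p.
Proof. exact: mderivN. Qed.

(** Real generators are -J times imaginary ones, so this product is, up to sign, the Kaehler form on
    two generators of the compact torus. *)
Lemma metric_real_imaginary p a b : carrier M p -> G p (X (a, 0) p) (X (0, b) p) = 0.
Proof.
move=> Mp; have -> : ((a, 0) : Cn R m) = - Jstd ((0, a) : Cn R m).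
  by rewrite /Jstd /= -[RHS]/(- - a, - 0) opprK oppr0.
rewrite orbit_fieldN orbit_field_J//; have [wl _] := cone_metric_bilinear Mp.
have := wl (-1) (J p (X (0, a) p)) 0 (X (0, b) p); rewrite scaleN1r addr0 => ->.
rewrite -[G p (J p _) _]/(omega p (X (0, a) p) (X (0, b) p)) torus_orbit_isotropic//.
have := wl 1 0 0 (X (0, b) p); rewrite scaler0 addr0 mul1r mulr0 add0r => /eqP.
by rewrite -subr_eq0 opprD addNKr oppr_eq0 => /eqP.
Qed.

(* On the open orbit, [sigma q] and [q] differ by an element of the compact
   torus, and the real and imaginary directions are orthogonal. *)
Lemma sigma_isometry p u v : carrier M p -> G (sigma p) (dsigma p u) (dsigma p v) = G p u v.
Proof.
apply: metric_density => // q {}u {}v oq; have Mq := on_open_orbit_carrier oq.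
have [a ->] := orbit_field_span u oq; have [b ->] := orbit_field_span v oq.
rewrite !dsigma_orbit_field//.
have [w qE] := oq.
(* The conjugate of [w] is [w] minus 2i times its imaginary part. *)
have sq : sigma q = B (0, - (w.2 + w.2)) q.
  rewrite qE sigma_open_orbit -orbit_mapD; last exact: carrier_p0.
  congr (B _ _); case: w {qE} => w1 w2; rewrite /cbar /=.
  by rewrite -[RHS]/(0 + w1, - (w2 + w2) + w2) add0r opprD subrK.
have := metric_orbit_map 0 (- (w.2 + w.2)) (X (cbar a) q) (X (cbar b) q) Mq.
rewrite scale0r !orbit_diff_field// -sq expR0 expr1n mul1r => ->.
rewrite (orbit_field_pair (cbar a))// (orbit_field_pair (cbar b))//.
rewrite (orbit_field_pair a)// (orbit_field_pair b)//= /cbar /=.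
have N c : X (0, - c) q = - X (0, c) q.
  by rewrite -orbit_fieldN; congr (X _ _); rewrite -[RHS]/(- 0, - c) oppr0.
rewrite !N; have [wl wr] := cone_metric_bilinear Mq.
have D1 x y z t : G q (x + y) (z + t) = G q x z + G q x t + (G q y z + G q y t).
  have l := wl 1 x y; have r := wr 1 z t.
  by rewrite !scale1r in l r; rewrite l !r !mul1r.
have g0 z : G q 0 z = 0.
  have := wl 1 0 0 z; rewrite scaler0 addr0 mul1r => /eqP.
  by rewrite -subr_eq0 opprD addNKr oppr_eq0 => /eqP.
have Nl x z : G q (- x) z = - G q x z.
  by have := wl (-1) x 0 z; rewrite scaleN1r addr0 g0 addr0 mulN1r.
have Nr x z : G q z (- x) = - G q z x by rewrite !(cone_metric_sym z)// Nl.
rewrite !D1 !Nl !Nr opprK.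
rewrite (cone_metric_sym (X (0, a.2) q))// (metric_real_imaginary b.1 a.2)//.
by rewrite metric_real_imaginary// !oppr0.
Qed.

(** An antiholomorphic isometry reverses the sign of the Kaehler form, while it fixes the two
    vectors. *)
Lemma real_isotropic p u v : carrier M p -> sigma p = p -> dsigma p u = u -> dsigma p v = v ->
  omega p u v = 0.
Proof.
move=> Mp sp su sv; have [[_ sJ] _ _] := sigma_real.
have : omega p u v = - omega p u v.
  rewrite {1}/kahler_form -sigma_isometry// sJ// sp su sv.
  have [wl _] := cone_metric_bilinear Mp.
  have := wl (-1) (J p u) 0 v; rewrite scaleN1r addr0 => ->.
  have := wl 1 0 0 v; rewrite scaler0 addr0 mul1r /kahler_form; lra.
lra.
Qed.

Lemma weight_cbar z : weight (cbar z) = (weight z)^*.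
Proof.
rewrite /weight -cexp_conj rmorph_sum /=; congr (cexp _); apply: eq_bigr => k _.
by rewrite cval_cbar rmorphM /= rmorph_int.
Qed.

(** On the open orbit, both the determinant and the character are conjugated, the coefficients of
    [gamma] being real. *)
Lemma volume_sigma p v : carrier M p -> Omega (sigma p) (fun k => dsigma p (v k)) = (Omega p v)^*.
Proof.
apply: (volume_density (Phi := fun x => x^*)) => //.
  move=> U f fc u Uu; have [f1 f2] := fc u Uu; split.
    by rewrite (_ : (fun x => _) = (fun x => complex.Re (f x)))//; apply/funext => x; case: (f x).
  rewrite (_ : (fun x => _) = - (fun x => complex.Im (f x))); first exact: continuousN.
  by apply/funext => x; rewrite -[RHS]/(- complex.Im (f x)); case: (f x).
move=> q {}v oq; have Mq := on_open_orbit_carrier oq.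
have [a ->] := orbit_field_span_family v oq; have [w qE] := oq.
have -> : (fun k => dsigma q (X (a k) q)) = (fun k => X (cbar (a k)) (sigma q)).
  by apply/funext => k; exact: dsigma_orbit_field.
rewrite {}qE sigma_open_orbit.
apply: etrans (volume_orbit_field (cbar w) (fun k => cbar (a k))) _.
apply: etrans (congr1 (fun x => x^*) (esym (volume_orbit_field w a))).
have cM (x y x' y' : R[i]) : x' = x^* -> y' = y^* -> x' * y' = (x * y)^*.
  by move=> -> ->; rewrite rmorphM.
apply: cM; first exact: weight_cbar.
rewrite -det_map_mx; congr (\det _); apply/matrixP => j k; rewrite !mxE.
exact: cval_cbar.
Qed.

Lemma volume_real p v : carrier M p -> sigma p = p -> (forall k, dsigma p (v k) = v k) ->
  complex.Im (Omega p v) = 0.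
Proof.
move=> Mp sp sv; have := volume_sigma v Mp; rewrite sp.
have -> : (fun k => dsigma p (v k)) = v by apply/funext.
case: (Omega p v) => x y [] /= => e; lra.
Qed.

Lemma dsigma_radial p : carrier M p -> sigma p = p -> dsigma p (0, p.2) = (0, p.2).
Proof.
move=> Mp sp; rewrite -orbit_field_reeb// dsigma_orbit_field// sp; congr (X _ _).
by rewrite /cbar /= oppr0.
Qed.

(** * Linear algebra at a real point *)

Section Pointwise.
Variables (p : S * R).
Hypotheses (Mp : carrier M p) (sp : sigma p = p).
Local Notation Rad := ((0, p.2) : VC).

Let metricZl a u v : G p (a *: u) v = a * G p u v.
Proof.
have [wl _] := cone_metric_bilinear Mp; have := wl a u 0 v; rewrite addr0 => ->.
have := wl 1 0 0 v; rewrite scaler0 addr0 mul1r => /eqP.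
by rewrite -subr_eq0 opprD addNKr oppr_eq0 => /eqP ->; rewrite addr0.
Qed.

Let metricDl u v x : G p (u + v) x = G p u x + G p v x.
Proof. by have [wl _] := cone_metric_bilinear Mp; have := wl 1 u v x; rewrite scale1r mul1r. Qed.

Let metricDr u v x : G p x (u + v) = G p x u + G p x v.
Proof. by rewrite !(cone_metric_sym x)// metricDl. Qed.

Let metricZr a u v : G p v (a *: u) = a * G p v u.
Proof. by rewrite !(cone_metric_sym v)// metricZl. Qed.

Let metricN u v : G p (- u) v = - G p u v.
Proof. by rewrite -scaleN1r metricZl mulN1r. Qed.

Lemma metric_radial v : G p v Rad = v.2 * p.2.
Proof.
have [[gb _] _] := S_sasaki; have [gl gs _] := gb p.1 Mp.1.
have g0 : g p.1 v.1 0 = 0.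
  by rewrite gs; have := gl 1 0 0 v.1; rewrite scaler0 addr0 mul1r; lra.
by rewrite /cone_metric /= g0 mulr0 add0r.
Qed.

Lemma metric_Jl u v : G p (J p u) v = - G p u (J p v).
Proof. by rewrite -(cone_metricJ (J p u))// J_invol// metricN. Qed.

Lemma metric_radial_J : G p Rad (J p Rad) = 0.
Proof.
have := metric_Jl Rad Rad; rewrite (cone_metric_sym (J p Rad))//.
by set y := G p _ _; lra.
Qed.

Section RealTangent.
Variable u : VC.
Hypotheses (su : dsigma p u = u) (u2 : u.2 = 0).

(** The radial vector is itself real, since it is generated by the real element (xi, 0); this is the
    isotropy of real vectors. *)
Lemma metric_real_J_radial : G p u (J p Rad) = 0.
Proof.
have := real_isotropic Mp sp su (dsigma_radial Mp sp).
by rewrite /kahler_form metric_Jl => /eqP; rewrite oppr_eq0 => /eqP.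
Qed.

Lemma metric_real_radial : G p u Rad = 0.
Proof. by rewrite metric_radial u2 mul0r. Qed.

(** The product with the Reeb vector kills [u] and the radial part, leaving s b r^2. *)
Lemma flow_direction_neq0 s a b : b != 0 ->
  u + s *: (a *: Rad + b *: J p Rad) = 0 -> s = 0 /\ u = 0.
Proof.
move=> b0 e; have := congr1 (fun v => G p v (J p Rad)) e.
rewrite metricDl metricZl metricDl !metricZl metric_real_J_radial metric_radial_J cone_metricJ//.
rewrite -[X in _ = G p X _](scale0r (0 : VC)) metricZl mul0r mulr0 !add0r metric_radial /=.
have p2 : p.2 != 0 by rewrite gt_eqF//; exact/carrier_cone.
move/eqP; rewrite !mulf_eq0 (negbTE b0) (negbTE p2) !orbF => /eqP s0.
by move: e; rewrite s0 scale0r addr0.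
Qed.

End RealTangent.

(** The added direction is the same for both vectors, so it pairs to zero with itself; the mixed
    terms vanish because [u] and [v] are orthogonal to the radial and to the Reeb vector. *)
Lemma flow_isotropic u v s s' a b :
  dsigma p u = u -> u.2 = 0 -> dsigma p v = v -> v.2 = 0 ->
  omega p (u + s *: (a *: Rad + b *: J p Rad)) (v + s' *: (a *: Rad + b *: J p Rad)) = 0.
Proof.
move=> su u2 sv v2; have JZ' c w : J p (c *: w) = c *: J p w by rewrite JZ.
rewrite /kahler_form !(JD _ _ Mp) !JZ' !(JD _ _ Mp) !JZ' J_invol//.
have uv : G p (J p u) v = 0 by apply: (real_isotropic Mp sp su sv).
have uR : G p (J p u) Rad = 0 by apply: (real_isotropic Mp sp su (dsigma_radial Mp sp)).
have JRv : G p (J p Rad) v = 0 by rewrite cone_metric_sym// metric_real_J_radial.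
have Rv : G p Rad v = 0 by rewrite cone_metric_sym// metric_real_radial.
have JRR : G p (J p Rad) Rad = 0 by rewrite cone_metric_sym// metric_radial_J.
rewrite !(metricDl, metricDr, metricZl, metricZr, metricN) uv uR JRv Rv JRR.
rewrite metric_radial_J !cone_metricJ// metric_real_radial//.
by rewrite !(mulr0, add0r, addr0, oppr0); ring.
Qed.

Section Frame.
Variables (u : 'I_m -> VC) (s : 'I_m -> R) (a b : R).
Hypotheses (su : forall k, dsigma p (u k) = u k) (u2 : forall k, (u k).2 = 0).
Local Notation x := (fun k => u k + s k *: (a *: Rad + b *: J p Rad)).

(* In holomorphic coordinates the frame is a rank one perturbation of [u]; the
   complex functional [H] kills the real directions [u k] but not [Rad], which
   makes the determinant linear in the coefficient of the perturbation. *)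
Lemma volume_flow_frame :
  Omega p x = (a +i* b) * Omega p (fun k => u k + s k *: Rad).
Proof.
have [_ [_ [_ Jz] _ _]] := S_sasaki; have [U [z [Up Uz]]] := Jz p Mp.
have [Omh _] := Omega_gamma; have [h [_ /(_ p Up)[h0 OE]]] := Omh _ _ Uz.
have [zV [_ _ dK1 dK2]] := holo_coord_inverse HM Uz.
have [_ _ _ [_ zh] _] := Uz.
pose dz := mderiv M (triv_mfd (setT : set (Cn R m))) z p.
pose dzV := mderiv (triv_mfd (setT : set (Cn R m))) M zV (z p).
have dzJ w : dz (J p w) = Jstd (dz w) by exact: (zh p w (conj Mp Up)).
have dzK w : dzV (dz w) = w by exact: dK1.
have dzVJ w : dzV (Jstd w) = J p (dzV w).
  by rewrite -[RHS]dzK dzJ; congr (dzV (Jstd _)); rewrite /dz /dzV dK2.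
(* The hermitian product with the radial vector, the sign of the imaginary part being the one that
   makes it complex linear in [v]. *)
pose H v : R[i] := G p v Rad +i* G p v (J p Rad).
pose F w := H (dzV w).
have FE w : F w = \sum_k F (cdelta R k) * cval w k.
  apply: complex_linear_sum => [c v y|v].
    rewrite /F /H /dzV mderivP !metricDl !metricZl.
    by apply/eqP; rewrite eq_complex /= !mul0r subr0 addr0 !eqxx.
  rewrite /F /H dzVJ metric_Jl cone_metricJ//.
  by apply/eqP; rewrite -complexiE eq_complex /= !mul0r !mul1r sub0r add0r !eqxx.
have Hu k : H (u k) = 0 by rewrite /H metric_real_radial// metric_real_J_radial.
have HR : H Rad != 0.
  rewrite /H metric_radial_J metric_radial eq_complex /= eqxx andbT mulf_neq0// gt_eqF//; exact/carrier_cone.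
pose l := \row_j F (cdelta R j).
have lE w : (l *m \col_j cval (dz w) j) 0 0 = H w.
  rewrite -[in RHS](dzK w) -/(F _) FE mxE; apply: eq_bigr => j _; by rewrite !mxE.
pose Um := \matrix_(j < m, k < m) cval (dz (u k)) j.
pose sm : 'rV[R[i]]_m := \row_k (s k)%:C.
have lU : l *m Um = 0.
  apply/rowP => k; rewrite [RHS]mxE -(Hu k) -lE !mxE; apply: eq_bigr => j _; by rewrite !mxE.
have lb : (l *m \col_j cval (dz Rad) j) 0 0 != 0 by rewrite lE.
have key := det_scale_direction sm (a +i* b) lU lb.
have dzP c v w : dz (c *: v + w) = c *: dz v + dz w by exact: mderivP.
have dzZ c v : dz (c *: v) = c *: dz v by exact: mderivZ.
rewrite !OE mulrCA; congr (_ * _).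
rewrite (_ : \matrix_(j, k) _ = Um + (a +i* b) *: (\col_j cval (dz Rad) j *m sm)); last first.
  apply/matrixP => j k; rewrite !mxE big_ord1 !mxE -/dz.
  rewrite [in LHS]addrC dzP cvalD cvalZ addrC; congr (_ + _).
  rewrite dzP dzZ dzJ cvalD !cvalZ cval_Jstd -complexiE; case: (cval (dz _) j) => y1 y2.
  by apply/eqP; rewrite eq_complex /=; apply/andP; split; apply/eqP; ring.
rewrite {}key; congr (_ * \det _); apply/matrixP => j k; rewrite !mxE big_ord1 !mxE -/dz.
by rewrite [in RHS]addrC dzP cvalD cvalZ addrC mulrC.
Qed.

Lemma volume_real_frame : complex.Im (Omega p (fun k => u k + s k *: Rad)) = 0.
Proof.
apply: volume_real => // k; rewrite addrC mderivP su; congr (_ *: _ + _).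
exact: dsigma_radial.
Qed.

End Frame.
End Pointwise.

(** * Level sets of the moment map in the Reeb direction *)

Section Moment.
Variable mu : S * R -> 'rV[R]_m.
Hypothesis mu_moment : moment_map MS A g J mu.

(** Since eta(xi) = 1. Hence the level set of [xi] at c lies in the slice of radius sqrt (2 c),
    which is what distinguishes zeta = xi. *)
Lemma moment_reeb p : carrier M p -> dot (mu p) xi = 2^-1 * p.2 ^+ 2.
Proof.
move=> Mp; rewrite mu_moment// -xi_reeb// /contact_form /reeb cone_metricJ//.
have r0 : 0 < p.2 by exact/carrier_cone.
have [[gb _] _] := S_sasaki; have [gl _ _] := gb p.1 Mp.1.
have g0 : g p.1 0 0 = 0.
  have := gl 1 0 0 0; rewrite scaler0 addr0 mul1r => /eqP.
  by rewrite -subr_eq0 opprD addNKr oppr_eq0 => /eqP.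
rewrite /cone_metric /= g0 mulr0 add0r -expr2 divff ?mulr1//.
by rewrite expf_neq0// gt_eqF.
Qed.

Lemma moment_image_reeb_gt0 y : (mu @` carrier M) y -> 0 < dot y xi.
Proof.
move=> [p Mp <-]; rewrite moment_reeb// mulr_gt0 ?invr_gt0// exprn_gt0//.
exact/carrier_cone.
Qed.

Section Level.
Variables (c : R) (I : set R).
Hypothesis I_open : open I.
Local Notation L := (real_level_set MS sigma mu xi c `*` I).
Local Notation MI := (prod_mfd M (triv_mfd I)).

Let HI : is_manifold (triv_mfd I). Proof. exact: triv_is_manifold. Qed.
Let HMI : is_manifold MI. Proof. exact: prod_is_manifold. Qed.

(** A curve in the level set is fixed by [sigma] and has constant radius; both identities are
    differentiated at 0. *)
Lemma level_tangent q v : tangent_to MI L q v ->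
  [/\ carrier M q.1, sigma q.1 = q.1, I q.2, dsigma q.1 v.1 = v.1 & v.1.2 = 0].
Proof.
move=> [e [cc [e0 cs cL c0 cv]]].
have E0 : `|0 : R| < e by rewrite normr0.
have [[Mq sq lq] Iq] := cL 0 E0; rewrite c0 in Mq sq lq Iq.
pose E : set R := [set t | `|t| < e].
have oE : open E.
  rewrite (_ : E = ball (0 : R) e); first exact: ball_open.
  by apply/seteqP; split=> t; rewrite -ball_normE /= sub0r normrN.
have HE : is_manifold (triv_mfd E) by exact: triv_is_manifold.
have sf : smooth_map MI M fst by exact: smooth_map_fst.
have s1 : smooth_map (triv_mfd E) M (fst \o cc) by exact: (smooth_map_comp HE HMI HM cs sf).
have e1 : mderiv (triv_mfd E) M (fst \o cc) 0 1 = v.1.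
  have Mc : carrier MI (cc 0) by rewrite c0.
  apply: etrans (mderiv_smooth_comp HE HMI HM (1 : R) cs sf (E0 : carrier (triv_mfd E) 0)) _.
  by apply: etrans (mderiv_fst HM _ Mc) _; rewrite -cv.
have c10 : (fst \o cc) 0 = q.1 by rewrite /= c0.
split=> //.
  have e2 := mderiv_smooth_comp HE HM HM (1 : R) s1 sigma_smooth (E0 : carrier (triv_mfd E) 0).
  rewrite e1 c10 in e2; rewrite -e2 -e1.
  have fE t : E t -> (fst \o cc) t = (sigma \o (fst \o cc)) t.
    by move=> Et; have [[_ /= -> _] _] := cL t Et.
  by have [_ ->] := near_mderiv HE (E0 : carrier (triv_mfd E) 0) oE E0 fE
    (smooth_mdiff HE HM s1 (E0 : carrier (triv_mfd E) 0)).
have HR0 : is_manifold (triv_mfd [set r : R | 0 < r]) by exact/triv_is_manifold/open_gt.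
have sn : smooth_map M (triv_mfd [set r : R | 0 < r]) snd by exact: smooth_map_snd.
have e2 := mderiv_smooth_comp HE HM HR0 (1 : R) s1 sn (E0 : carrier (triv_mfd E) 0).
rewrite e1 c10 in e2.
have <- : mderiv M (triv_mfd [set r : R | 0 < r]) snd q.1 v.1 = v.1.2.
  exact: (mderiv_snd HR0 _ Mq).
rewrite -{}e2.
have q0 : 0 < q.1.2 by exact/carrier_cone.
have sc : smooth_map (triv_mfd E) (triv_mfd [set r : R | 0 < r]) (fun=> q.1.2).
  exact: smooth_map_cst.
have fE t : E t -> q.1.2 = (snd \o (fst \o cc)) t.
  move=> Et; have [[Mt _ /= lt] _] := cL t Et.
  move: lt; rewrite -{}lq !moment_reeb// => /mulfI h.
  have := h; rewrite invr_eq0 pnatr_eq0 => /(_ isT)/eqP.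
  rewrite eqrXn2 ?ltW//; first by move/eqP.
  exact/carrier_cone.
have [_ ->] := near_mderiv HE (E0 : carrier (triv_mfd E) 0) oE E0 fE
    (smooth_mdiff HE HR0 sc (E0 : carrier (triv_mfd E) 0)).
exact: mderiv_cst.
Qed.

(* The orbit of [p] under the real torus leaves the level set; dilations bring it
   back, at the cost of a radial correction of the velocity. *)
Lemma orbit_ray_tangent p t a : L (p, t) ->
  tangent_to MI L (p, t) (((X (a, 0) p).1, 0), (X (a, 0) p).2 / p.2).
Proof.
move=> Lpt; have [[Mp sp lp] It] := Lpt.
have r0 : 0 < p.2 by exact/carrier_cone.
(* With this velocity along [I], adding [s] times the radial vector to the slice component gives
   back [X (a, 0) p]. *)
set s := (X (a, 0) p).2 / p.2.
have oT := @openT R.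
have HR : is_manifold (triv_mfd (setT : set R)) by exact: triv_is_manifold.
have lc : clinear (fun x : R => x *: s) by exact: clinear_scalel.
have dc : is_derive (0 : R) (1 : R) (fun x : R => x *: s + t) s.
  have [dl dlE] := lc 0.
  have d1 : is_derive (0 : R) (1 : R) (fun x : R => x *: s) s.
    by split; [exact: diff_derivable|rewrite deriveE// dlE scale1r].
  by apply: is_derive_eq (is_deriveD d1 (is_derive_cst t (0 : R) (1 : R))) _; rewrite addr0.
have /nbhs_ballP[e /= e0 eI] : \forall x \near (0 : R), I (x *: s + t).
  have cc : {for (0 : R), continuous (fun x : R => x *: s + t)}.
    by apply/differentiable_continuous/derivable1_diffP; have [] := dc.
  by apply: cc; apply: open_nbhs_nbhs; split; rewrite //= scale0r add0r.
pose E : set R := [set x | `|x| < e].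
have EI x : E x -> I (x *: s + t).
  by move=> xe; apply: eI; rewrite -ball_normE /= sub0r normrN.
have E0 : E 0 by rewrite /E /= normr0.
have oE : open E.
  rewrite (_ : E = ball (0 : R) e); first exact: ball_open.
  by apply/seteqP; split=> x; rewrite -ball_normE /= sub0r normrN.
have HE : is_manifold (triv_mfd E) by exact: triv_is_manifold.
pose ray (x : R) := B (x *: ((a, 0) : Cn R m)) p.
pose c1 x : S * R := ((ray x).1, p.2).
have rays : smooth_map (triv_mfd E) M ray.
  by apply: smooth_map_triv_sub (ray_smooth (a, 0) Mp).
have HR0 : is_manifold (triv_mfd [set r : R | 0 < r]) by exact/triv_is_manifold/open_gt.
have sf : smooth_map M MS fst by exact: smooth_map_fst.
have s1 : smooth_map (triv_mfd E) MS (fst \o ray) by exact: (smooth_map_comp HE HM S_mfd rays sf).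
have s2 : smooth_map (triv_mfd E) (triv_mfd [set r : R | 0 < r]) (fun=> p.2).
  exact: smooth_map_cst.
have s12 : smooth_map (triv_mfd E) M c1 by exact: smooth_map_pair.
have s3 : smooth_map (triv_mfd E) (triv_mfd I) (fun x : R => x *: s + t).
  apply: smooth_map_triv => // k.
  by apply: CkD => //; [exact: Ck_clinear|exact: Ck_cst].
have sall : smooth_map (triv_mfd E) MI (fun x => (c1 x, x *: s + t)) by exact: smooth_map_pair.
exists e, (fun x => (c1 x, x *: s + t)); split=> //.
- move=> x xe; split; last exact: EI.
  have Mray : carrier M (ray x) by exact: carrier_orbit_map.
  have rr0 : 0 < (ray x).2 by exact/carrier_cone.
  have Mc : carrier M (c1 x) by exact/carrier_cone.
  (* Restoring the radius is the action of a real multiple of [xi], so it keeps the curve fixed by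
     [sigma]. *)
  have cE : c1 x = B (ln (p.2 / (ray x).2) *: (xi, 0)) (ray x).
    rewrite orbit_map_dilation// lnK; last by rewrite posrE divr_gt0.
    by rewrite /dilation /c1 divfK// gt_eqF.
  have cb b : cbar ((b, 0) : Cn R m) = (b, 0) by rewrite /cbar /= oppr0.
  have cbZ y b : cbar (y *: ((b, 0) : Cn R m)) = y *: (b, 0).
    by rewrite -[y *: _]/(y *: b, y *: 0) scaler0 cb.
  split=> //.
    by rewrite cE sigma_orbit_map// cbZ /ray sigma_orbit_map// cbZ sp.
  by rewrite -lp !moment_reeb.
- by rewrite /c1 /ray scale0r orbit_map0// scale0r add0r -surjective_pairing.
have E0' : carrier (triv_mfd E) 0 by [].
have m12 := smooth_mdiff HE HM s12 E0'.
have m3 := smooth_mdiff HE HI s3 E0'.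
rewrite /velocity; apply: etrans (mderiv_pair (1 : R) m12 m3) _; congr (_, _).
  have m1 := smooth_mdiff HE S_mfd s1 E0'; have m2 := smooth_mdiff HE HR0 s2 E0'.
  apply: etrans (mderiv_pair (1 : R) m1 m2) _; congr (_, _); last exact: mderiv_cst.
  apply: etrans (mderiv_smooth_comp HE HM S_mfd (1 : R) rays sf E0') _.
  have Mr0 : carrier M (ray 0) by exact: carrier_orbit_map.
  apply: etrans (mderiv_fst S_mfd _ Mr0) _; congr fst.
  apply: etrans (mderiv_ray (a, 0) 0 Mp) _.
  by rewrite scale0r orbit_map0.
have [d dE] := dc.
by rewrite -[mderiv _ _ _ _ _]/('d (fun x : R => x *: s + t) 0 1) -deriveE//; apply/derivable1_diffP.
Qed.

(** The point is taken on the open orbit, and the frame is such that u_k + s_k r d/dr is the k-th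
    real coordinate generator; Omega_gamma takes the value of a character on these generators. *)
Lemma level_frame t : 0 < c -> I t -> exists p (u : 'I_m -> VC) (s : 'I_m -> R),
  [/\ L (p, t), forall k, tangent_to MI L (p, t) (u k, s k) &
      Omega p (fun k => u k + s k *: (0, p.2)) != 0].
Proof.
move=> c0 It; have Mp0 := carrier_p0; have r0 : 0 < p0.2 by exact/carrier_cone.
(* The dilation bringing the real point [p0] to the radius sqrt (2 c), where half the squared radius
   is c. *)
pose z : Cn R m := ln (Num.sqrt (2 * c) / p0.2) *: (xi, 0).
have sc : 0 < Num.sqrt (2 * c) by rewrite sqrtr_gt0 mulr_gt0.
have Mp : carrier M (B z p0) by exact: carrier_orbit_map.
have p2 : (B z p0).2 = Num.sqrt (2 * c).
  rewrite /z orbit_map_dilation// /dilation lnK ?posrE ?divr_gt0//=.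
  by rewrite divfK// gt_eqF.
have Lp : L (B z p0, t).
  split=> //; split=> //=.
    rewrite sigma_open_orbit /z; congr (B _ _).
    by rewrite -[ln _ *: _]/(ln (Num.sqrt (2 * c) / p0.2) *: xi, ln (Num.sqrt (2 * c) / p0.2) *: 0) scaler0 /cbar /= oppr0.
  rewrite moment_reeb// p2 sqr_sqrtr; last by rewrite mulr_ge0// ltW.
  by rewrite mulrA mulVf ?mul1r// pnatr_eq0.
exists (B z p0), (fun k => ((X (cdelta R k) (B z p0)).1, 0)), (fun k => (X (cdelta R k) (B z p0)).2 / (B z p0).2).
have dE k : cdelta R k = ((\row_j (j == k)%:R, 0) : Cn R m).
  apply: Cn_eqP => j; rewrite cval_cdelta /cval !mxE; by case: eqP.
split=> //.
  by move=> k; rewrite dE; exact: orbit_ray_tangent.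
rewrite (_ : (fun k => _) = (fun k => X (cdelta R k) (B z p0))); last first.
  apply/funext => k; set v := X _ _; set r := (B z p0).2.
  rewrite -[LHS]/(v.1 + (v.2 / r) *: 0, 0 + (v.2 / r) * r) scaler0 addr0 add0r divfK.
    by rewrite -surjective_pairing.
  by rewrite /r p2 gt_eqF.
rewrite volume_orbit_field (_ : \matrix_(j, k) _ = 1%:M).
  by rewrite det1 mulr1 cexp_neq0.
by apply/matrixP => j k; rewrite !mxE cval_cdelta.
Qed.

(** * The level set moved by dilations and the compact torus *)

Section Flow.
Variables (f rho : R -> R) (nu : 'rV[R]_m).
Hypotheses (f_smooth : smooth_on I f) (rho_smooth : smooth_on I rho).
Hypothesis rho_gt0 : forall t, I t -> 0 < rho t.

Definition flow_log (t : R) : Cn R m := (ln (rho t) *: xi, f t *: xi + nu).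
Definition flow (q : (S * R) * R) : S * R :=
  dilation (rho q.2) (A (cmul (texp (f q.2 *: xi)) (texp nu)) q.1).

Lemma flow_orbit q : carrier M q.1 -> I q.2 -> flow q = B (flow_log q.2) q.1.
Proof.
move=> Mq /rho_gt0 r0.
have -> : flow_log q.2 = ln (rho q.2) *: (xi, 0) + (((0, f q.2 *: xi) : Cn R m) + (0, nu)).
  rewrite -[RHS]/(ln (rho q.2) *: xi + (0 + 0), ln (rho q.2) *: 0 + (f q.2 *: xi + nu)).
  by rewrite scaler0 !addr0 add0r.
rewrite orbit_mapD// orbit_map_dilation; last exact: carrier_orbit_map.
by rewrite /flow /texp -cexpvD lnK.
Qed.

Lemma kappa_derivable t : I t -> derivable (fun t => ln (rho t)) t 1.
Proof.
move=> It; have [dr _] := rho_smooth 1.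
apply/derivable1_diffP; apply: (@differentiable_comp R R R R rho (@ln R)); first exact: dr.
by apply/derivable1_diffP; have [] := is_derive1_ln (rho_gt0 It).
Qed.

Lemma flow_log_derive t : I t -> differentiable flow_log t /\
  'D_1 flow_log t = ('D_1 (fun t => ln (rho t)) t *: xi, 'D_1 f t *: xi).
Proof.
move=> It; have [df _] := f_smooth 1.
have dk : is_derive t 1 (fun t => ln (rho t)) ('D_1 (fun t => ln (rho t)) t).
  exact/derivableP/kappa_derivable.
have df' : is_derive t 1 f ('D_1 f t) by exact/derivableP/diff_derivable/df.
set k' := 'D_1 (fun t => _) t in dk *; set f' := 'D_1 f t in df' *.
have lin (h : R -> R) h' (a : Cn R m) : is_derive t 1 h h' ->
    is_derive t 1 (fun t => h t *: a) (h' *: a).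
  move=> dh; have [dl dlE] := clinear_scalel a (h t).
  have dh' : differentiable h t by exact/derivable1_diffP.
  have dc := differentiable_comp dh' dl; split; first exact: diff_derivable.
  by rewrite deriveE// (diff_comp dh' dl) /= dlE -deriveE// derive_val.
have E : flow_log = (fun t => ln (rho t) *: ((xi, 0) : Cn R m)) +
    ((fun t => f t *: ((0, xi) : Cn R m)) + cst ((0, nu) : Cn R m)).
  apply/funext => s; rewrite -[RHS]/(ln (rho s) *: xi + (f s *: 0 + 0), ln (rho s) *: 0 + (f s *: xi + nu)).
  by rewrite !scaler0 !addr0 add0r.
have [d dE] : is_derive t 1 flow_log (k' *: ((xi, 0) : Cn R m) + (f' *: ((0, xi) : Cn R m) + 0)).
  rewrite E; have d1 := lin _ _ ((xi, 0) : Cn R m) dk; have d2 := lin _ _ ((0, xi) : Cn R m) df'.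
  exact: is_deriveD d1 (is_deriveD d2 (is_derive_cst ((0, nu) : Cn R m) t 1)).
split; first exact/derivable1_diffP.
rewrite dE -[LHS]/(k' *: xi + (f' *: 0 + 0), k' *: 0 + (f' *: xi + 0)).
by rewrite !scaler0 !addr0 add0r.
Qed.

(** The velocity of [flow_log] is (kappa' + i f') xi, whose generator is kappa' r d/dr + f' J (r
    d/dr); by invariance, this generator at the image point is the differential of the action on its
    value at [p]. *)
Lemma mderiv_flow p t u s : carrier M p -> I t ->
  mderiv MI M flow (p, t) (u, s) = D (flow_log t) p
    (u + s *: ('D_1 (fun t => ln (rho t)) t *: (0, p.2) + 'D_1 f t *: J p (0, p.2))).
Proof.
move=> Mp It; have [dz dzE] := flow_log_derive It.
have [db dbE] := mderiv_orbit_curve u s I_open It Mp dz.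
have FB q : carrier MI q -> B (flow_log q.2) q.1 = flow q by move=> [Mq Iq]; rewrite flow_orbit.
have Mpt : carrier MI (p, t) by [].
have [_ ->] := near_mderiv HMI Mpt (open_carrier HMI) Mpt FB db.
apply: etrans dbE _; rewrite dzE -orbit_diff_field// -orbit_field_reeb//.
rewrite -orbit_field_J//.
set k' := 'D_1 (fun t => _) t; set f' := 'D_1 f t.
have -> : s *: ((k' *: xi, f' *: xi) : Cn R m) =
    s *: (k' *: ((xi, 0) : Cn R m) + f' *: Jstd ((xi, 0) : Cn R m)).
  rewrite /Jstd /= oppr0 -[RHS]/(s *: (k' *: xi + f' *: 0), s *: (k' *: 0 + f' *: xi)).
  by rewrite !scaler0 addr0 add0r.
rewrite addrC -[LHS]mderivD; congr (mderiv _ _ _ _ (_ + _)).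
have lz a b : X (a *: b) p = a *: X b p by have := orbit_field_linear a b 0 p; rewrite addr0 orbit_field0 addr0.
have ld a b : X (a + b) p = X a p + X b p by have := orbit_field_linear 1 a b p; rewrite !scale1r.
by rewrite lz ld !lz.
Qed.

(** * The phase and the Lagrangian angle *)

Section Phase.
Variable theta0 : R.
Let N : R := \sum_k (gamma 0 k)%:~R * xi 0 k.
Let theta : R := \sum_k (gamma 0 k)%:~R * nu 0 k.
Definition flow_phase t : R[i] :=
  cexp (0 +i* (theta - theta0)) * cexp (N%:C * (ln (rho t) +i* f t)).
Definition flow_speed t : R[i] := 'D_1 (fun t => ln (rho t)) t +i* 'D_1 f t.

Lemma flow_phaseE t :
  flow_phase t = cexp ((N * ln (rho t)) +i* (theta - theta0 + N * f t)).
Proof.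
rewrite /flow_phase -cexpD; congr cexp.
by apply/eqP; rewrite eq_complex /=; apply/andP; split; apply/eqP; ring.
Qed.

(** The factor e^{i theta_0} is split off so that the special Lagrangian condition becomes the
    reality of what remains. *)
Lemma weight_flow t : weight (flow_log t) = cexp (0 +i* theta0) * flow_phase t.
Proof.
rewrite flow_phaseE /weight -cexpD; congr cexp.
have -> : \sum_k (gamma 0 k)%:~R * cval (flow_log t) k =
    N%:C * (ln (rho t) +i* f t) + theta%:C * (0 +i* 1).
  rewrite /N /theta !rmorph_sum /= !mulr_suml -big_split /=; apply: eq_bigr => k _.
  rewrite /cval !mxE -(rmorph_int (real_complex R)) /=.
  by apply/eqP; rewrite eq_complex /=; apply/andP; split; apply/eqP; ring.
by apply/eqP; rewrite eq_complex /=; apply/andP; split; apply/eqP; ring.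
Qed.

Lemma Im_flow_phase_const : N != 0 -> is_interval I ->
  (exists k, forall t, I t -> complex.Im (flow_phase t) = k) <->
  (forall t, I t -> complex.Im (flow_speed t * flow_phase t) = 0).
Proof.
move=> N0 itv.
have dphi t : I t -> is_derive t 1 (fun t => complex.Im (flow_phase t))
    (N * complex.Im (flow_speed t * flow_phase t)).
  move=> It; have dk : is_derive t 1 (fun t => ln (rho t)) ('D_1 (fun t => ln (rho t)) t).
    exact/derivableP/kappa_derivable.
  have [df _] := f_smooth 1.
  have df' : is_derive t 1 f ('D_1 f t) by exact/derivableP/diff_derivable/df.
  have dNk := is_deriveZ N dk.
  have dNf := is_deriveD (is_derive_cst (theta - theta0) t 1) (is_deriveZ N df').
  have := Im_cexp_derive dNk dNf.
  have -> : (fun t => complex.Im (flow_phase t)) = (fun t => complex.Im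
      (cexp ((N \*: (fun t => ln (rho t))) t +i* (cst (theta - theta0) + (N \*: f)) t))).
    by apply/funext => u; rewrite flow_phaseE.
  move=> h; apply: is_derive_eq h _; rewrite add0r flow_phaseE /flow_speed.
  case: (cexp _) => a b; rewrite /GRing.scale /=; ring.
split=> [[k kE] t It|H].
  have [_ d0] := dphi t It; apply/eqP; have := d0; rewrite (_ : 'D_1 _ t = 0).
    by move=> /esym/eqP; rewrite mulf_eq0 (negbTE N0).
  have n0 : \forall u \near t, cst k u = complex.Im (flow_phase u).
    by apply: filterS (open_nbhs_nbhs (conj I_open It)) => u /kE.
  by rewrite -(near_eq_derive _ n0); exact: derive_cst.
(* On an empty interval any constant serves. *)
have [[t0 It0]|nI] := pselect (exists t, I t); last first.
  by exists 0 => t It; exfalso; apply: nI; exists t.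
exists (complex.Im (flow_phase t0)) => t It.
apply: (derive0_const (f := fun t => complex.Im (flow_phase t)) itv It It0) => s Is; have [d1 d2] := dphi s Is.
by split; [exact/derivable1_diffP|rewrite d2 H// mulr0].
Qed.

Lemma mderiv_flow_tangent q v : tangent_to MI L q v ->
  mderiv MI M flow q v = D (flow_log q.2) q.1
    (v.1 + v.2 *: ('D_1 (fun t => ln (rho t)) q.2 *: (0, q.1.2) + 'D_1 f q.2 *: J q.1 (0, q.1.2))).
Proof.
move=> tv; have [Mq sq Iq sv v2] := level_tangent tv.
by case: q v {tv sv v2} => p t [u s] in Mq sq Iq *; rewrite mderiv_flow.
Qed.

Lemma flow_isotropic_immersion q u v : tangent_to MI L q u -> tangent_to MI L q v ->
  omega (flow q) (mderiv MI M flow q u) (mderiv MI M flow q v) = 0.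
Proof.
move=> tu tv; rewrite !mderiv_flow_tangent//.
have [Mq sq Iq su u2] := level_tangent tu; have [_ _ _ sv v2] := level_tangent tv.
by rewrite flow_orbit// omega_orbit_map// flow_isotropic// mulr0.
Qed.

(** The differential of the action is inverted by that of the opposite element, and the hypothesis
    f' != 0 makes the remaining Reeb component detect the velocity along [I]. *)
Lemma flow_lagrangian : (forall t, I t -> 'D_1 f t != 0) ->
  lagrangian_immersion M J MI G L flow.
Proof.
move=> f0 q Lq; split=> [v tv|]; last exact: flow_isotropic_immersion.
have [Mq sq Iq sv v2] := level_tangent tv.
rewrite mderiv_flow_tangent// => /(congr1 (D (- flow_log q.2) (B (flow_log q.2) q.1))).
rewrite orbit_diffK// [RHS]mderiv0 => /(flow_direction_neq0 Mq sq sv (f0 _ Iq))[s0 u0].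
by rewrite [v]surjective_pairing s0 u0.
Qed.

Lemma volume_flow q v : L q -> (forall k, tangent_to MI L q (v k)) ->
  Omega (flow q) (fun k => mderiv MI M flow q (v k)) =
  cexp (0 +i* theta0) * (flow_speed q.2 * flow_phase q.2) *
  (complex.Re (Omega q.1 (fun k => (v k).1 + (v k).2 *: (0, q.1.2))))%:C.
Proof.
move=> [[Mq sq _] Iq] tv; have tvk k := level_tangent (tv k).
have sv k : dsigma q.1 (v k).1 = (v k).1 by have [] := tvk k.
have v2 k : (v k).1.2 = 0 by have [] := tvk k.
rewrite (_ : (fun k => _) = fun k => D (flow_log q.2) q.1 ((v k).1 + (v k).2 *:
    ('D_1 (fun t => ln (rho t)) q.2 *: (0, q.1.2) + 'D_1 f q.2 *: J q.1 (0, q.1.2)))); last first.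
  by apply/funext => k; rewrite mderiv_flow_tangent.
rewrite flow_orbit// volume_orbit_map// volume_flow_frame// weight_flow -/(flow_speed _).
have := volume_real_frame Mq sq (fun k => (v k).2) sv.
case: (Omega q.1 _) => x y /= ->.
have swap (e h k d : R[i]) : e * h * (k * d) = e * (k * h) * d by ring.
exact: swap.
Qed.

(** For necessity, one frame with nonzero real factor over each t is enough. For sufficiency, the
    reality condition only gives the phase; the modulus required by the Lagrangian angle comes from
    [volume_modulus]. *)
Lemma special_lagrangian_flow psi : acy_function M J G Omega psi -> 0 < c ->
  (forall t, I t -> 'D_1 f t != 0) ->
  special_lagrangian M J MI G Omega psi L flow theta0 <->
  (forall t, I t -> complex.Im (flow_speed t * flow_phase t) = 0).
Proof.
move=> acy c0 f0; split=> [[_ [th thL]] t It|Im0].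
  have [p [u [s [Lpt tus Om0]]]] := level_frame c0 It.
  have [ang [k thk]] := thL _ Lpt.
  have [b e] := ang (fun k => (u k, s k)) tus.
  rewrite volume_flow// {}thk /= in e.
  have [[Mp sp _] _] := Lpt.
  have tk j := level_tangent (tus j).
  have su j : dsigma p (u j) = u j by have [] := tk j.
  have := volume_real_frame Mp sp s su => Im0.
  move: e Om0; set d := complex.Re _; rewrite eq_complex Im0 eqxx andbT -/d => e d0.
  (* Once e^{i theta_0} is cancelled, the right side is real, as the remaining angle is a multiple
     of pi. *)
  have {}e : flow_speed t * flow_phase t * d%:C = ((-1) ^+ b * cexp ((m%:R * psi (flow (p, t))) +i* (k%:~R * pi))) *
      (Num.sqrt (\det (\matrix_(i, j) G (flow (p, t)) (mderiv MI M flow (p, t) (u i, s i))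
          (mderiv MI M flow (p, t) (u j, s j)))))%:C.
    apply: (mulfI (cexp_neq0 (0 +i* theta0))); rewrite mulrA {}e.
    rewrite (_ : _ +i* (theta0 + _) = (0 +i* theta0) + ((m%:R * psi (flow (p, t))) +i* (k%:~R * pi))); last first.
      by apply/eqP; rewrite eq_complex /= add0r !eqxx.
    rewrite cexpD; have swap (e h k' l : R[i]) : e * (h * k') * l = h * (e * k' * l) by ring.
    exact: swap.
  move: e; move: (flow_speed t * flow_phase t) => [x y] /(congr1 (@complex.Im R)).
  rewrite /cexp sin_intpi; move: (Num.sqrt _) => r.
  have -> : (-1) ^+ b = ((-1) ^+ b : R)%:C :> R[i] by rewrite rmorphXn rmorphN rmorph1.
  rewrite /= !(mulr0, mul0r, addr0, add0r, subr0) => /eqP.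
  by rewrite mulf_eq0 (negbTE d0) orbF => /eqP.
split; first exact: flow_lagrangian.
exists (fun=> theta0) => q Lq; split; last by exists 0; rewrite mul0r addr0.
move=> v tv w; have [[Mq sq _] Iq] := Lq.
have MF : carrier M (flow q) by rewrite flow_orbit//; exact: carrier_orbit_map.
(* The image frame is isotropic, so the modulus of Omega_gamma on it is e^{m psi} times its
   Riemannian volume. *)
have : Omega (flow q) w * (Omega (flow q) w)^* = (expR (m%:R * psi (flow q)) ^+ 2 *
    \det (\matrix_(j, k) G (flow q) (w j) (w k)))%:C.
  exact: (volume_modulus acy MF (fun j k => flow_isotropic_immersion (tv j) (tv k))).
have OE : Omega (flow q) w = _ := volume_flow Lq tv.
rewrite {}OE.
set d := complex.Re _; set B := \det _; set e := expR _.
have -> : flow_speed q.2 * flow_phase q.2 = (complex.Re (flow_speed q.2 * flow_phase q.2))%:C.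
  by have := Im0 _ Iq; case: (_ * _) => x y /= ->.
move: (complex.Re (flow_speed q.2 * flow_phase q.2)) => h.
have e0 : 0 < e by exact: expR_gt0.
have -> : cexp ((m%:R * psi (flow q)) +i* theta0) = e%:C * cexp (0 +i* theta0).
  by rewrite /cexp /= expR0 mul1r.
have n1 : cexp (0 +i* theta0) * (cexp (0 +i* theta0))^* = 1 :> R[i].
  apply: etrans (congr1 (fun z => _ * z) (esym (cexp_conj _))) _.
  by rewrite -cexpD -[RHS]cexp0; congr cexp; apply/eqP; rewrite eq_complex /= addr0 subrr !eqxx.
have -> : cexp (0 +i* theta0) * h%:C * d%:C * (cexp (0 +i* theta0) * h%:C * d%:C)^* = ((h * d) ^+ 2)%:C.
  have norm1 (z : R[i]) (x y : R) : z * z^* = 1 ->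
      z * x%:C * y%:C * (z * x%:C * y%:C)^* = ((x * y) ^+ 2)%:C.
    case: z => z1 z2 /eqP; rewrite eq_complex /= => /andP[/eqP e1 _].
    apply/eqP; rewrite eq_complex /=; apply/andP; split; apply/eqP; last by ring.
    by rewrite -[RHS]mul1r -e1; ring.
  exact: norm1 n1.
move/(congr1 (@complex.Re R)) => /= hd.
have sB : Num.sqrt B = `|h * d| / e.
  have -> : B = (`|h * d| / e) ^+ 2.
    rewrite exprMn real_normK ?num_real// hd exprVn mulrAC divff ?mul1r//.
    by rewrite expf_neq0// gt_eqF.
  by rewrite sqrtr_sqr ger0_norm// divr_ge0// ltW.
(* The density is defined up to sign, and the boolean absorbs the sign of the real number
   [h * d]. *)
exists (h * d < 0); rewrite sB.
have -> : cexp (0 +i* theta0) * h%:C * d%:C = cexp (0 +i* theta0) * (h * d)%:C.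
  by rewrite rmorphM mulrA.
have -> : (h * d)%:C = (-1) ^+ (h * d < 0)%R * e%:C * (`|h * d| / e)%:C :> R[i].
  rewrite -mulrA -rmorphM /= mulrCA divff ?mulr1; last by rewrite gt_eqF.
  case: ltrP => hd0; first by rewrite ltr0_norm// expr1 mulN1r rmorphN opprK.
  by rewrite ger0_norm// expr0 mul1r.
have swap (x y z k : R[i]) : x * (y * z * k) = y * (z * x) * k by ring.
exact: swap.
Qed.

End Phase.

End Flow.

End Level.
End Moment.

End RealStructure.

End VolumeForm.

End Reeb.

End ToricCone.

(** Its pairing with every normal is 1, so [gamma] satisfies the inequalities of the cone, and it is
    nonzero as soon as there is a facet. This is the source of N > 0. *)
Lemma int_vec_in_cone (R : realType) (m d : nat) (lam : 'I_d -> 'rV[int]_m)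
    (Delta : set 'rV[R]_m) (gamma : 'rV[int]_m) : (0 < m)%N ->
  good_cone lam Delta -> (forall i, \sum_k gamma 0 k * lam i 0 k = 1) ->
  Delta (int_vec R gamma).
Proof.
move=> m0 [_ _ sc _ ->] gl.
have d1 i : dot (int_vec R gamma) (int_vec R (lam i)) = 1.
  rewrite /dot -[RHS](rmorph1 (intmul 1)) -(gl i) rmorph_sum; apply: eq_bigr => k _.
  by rewrite !mxE rmorphM.
split; first by move=> i; rewrite d1.
case: d lam sc gl d1 => [|d] lam sc gl d1.
  (* Without facets, strong convexity fails. *)
  have c0 (y : 'rV[R]_m) : y = 0 by apply: sc => -[].
  have /rowP/(_ (Ordinal m0)) := c0 (const_mx 1).
  by rewrite !mxE => /eqP; rewrite oner_eq0.
apply/eqP => g0; have := d1 ord0; rewrite g0 /dot big1 => [/eqP|k _]; last by rewrite mxE mul0r.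
by rewrite eq_sym oner_eq0.
Qed.

Theorem theorem6p2 (R : realType) (m : nat) (m_gt0 : (0 < m)%N)
  (S : topologicalType) (MS : manifold 'rV[R]_(2 * m - 1)%N S)
  (S_mfd : is_manifold MS) (S_full : carrier MS = setT)
  (S_hausdorff : hausdorff_space S) (S_countable : @second_countable S)
  (g : S -> 'rV[R]_(2 * m - 1)%N -> 'rV[R]_(2 * m - 1)%N -> R)
  (J : S * R -> 'rV[R]_(2 * m - 1)%N * R -> 'rV[R]_(2 * m - 1)%N * R)
  (S_sasaki : sasaki MS g J)
  (A : Cn R m -> S * R -> S * R) (p0 : S * R)
  (A_action : complex_torus_action MS A J p0)
  (S_toric : toric MS A g)
  (xi : 'rV[R]_m)
  (xi_reeb : forall p, carrier (cone_mfd MS) p ->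
     reeb J p = fundamental_field MS A xi p)
  (sigma : S * R -> S * R) (sigma_real : real_structure MS A J p0 sigma)
  (mu : S * R -> 'rV[R]_m) (mu_moment : moment_map MS A g J mu)
  (d : nat) (lam : 'I_d -> 'rV[int]_m)
  (Delta : set 'rV[R]_m) (Delta_image : Delta = mu @` carrier (cone_mfd MS))
  (Delta_good : good_cone lam Delta)
  (gamma : 'rV[int]_m)
  (gamma_lam : forall i, \sum_k gamma 0 k * lam i 0 k = 1)
  (Omega : S * R -> ('I_m -> 'rV[R]_(2 * m - 1)%N * R) -> R[i])
  (Omega_gamma : toric_volume_form MS A J p0 gamma Omega)
  (psi : S * R -> R)
  (psi_acy : acy_function (cone_mfd MS) J (cone_metric g) Omega psi)
  (zeta : 'rV[R]_m) (c : R)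
  (H_meets : (interior Delta `&` [set y | dot y zeta = c]) !=set0)
  (zeta_transverse : forall y, Delta y -> dot y zeta = c ->
     ~ facet_span lam y zeta)
  (I : set R) (I_open : open I) (I_interval : is_interval I)
  (f rho : R -> R) (f_smooth : smooth_on I f) (rho_smooth : smooth_on I rho)
  (rho_gt0 : forall t, I t -> 0 < rho t)
  (f'_neq0 : forall t, I t -> derive1 f t != 0)
  (nu : 'rV[R]_m)
  (zeta_xi : zeta = xi) (theta0 : R) :
  let tau t := cmul (texp (f t *: zeta)) (texp nu) in
  let L := real_level_set MS sigma mu zeta c `*` I in
  let F (q : (S * R) * R) := dilation (rho q.2) (A (tau q.2) q.1) in
  let N : R := \sum_k (gamma 0 k)%:~R * zeta 0 k in
  let theta : R := \sum_k (gamma 0 k)%:~R * nu 0 k in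
  let kappa t := ln (rho t) in
  special_lagrangian (cone_mfd MS) J (prod_mfd (cone_mfd MS) (triv_mfd I))
    (cone_metric g) Omega psi L F theta0
  <->
  exists k : R, forall t, I t ->
    complex.Im (cexp (0 +i* (theta - theta0)) *
                cexp (N%:C * (kappa t +i* f t))) = k.
Proof.
subst zeta => tau L F N theta kappa.
have Delta_gt0 y : Delta y -> 0 < dot y xi.
  by rewrite Delta_image; exact: (moment_image_reeb_gt0 S_full S_sasaki xi_reeb mu_moment).
(* A point of the hyperplane inside the moment cone is the moment image of a point of C(S), where c
   is half a squared radius. *)
have c0 : 0 < c.
  have [y [/interior_subset Dy <-]] := H_meets; exact: Delta_gt0.
have N0 : N != 0.
  (* [gamma] lies in the moment cone, where [dot y xi] is half a squared radius. *)
  rewrite gt_eqF// (_ : N = dot (int_vec R gamma) xi).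
    exact/Delta_gt0/(int_vec_in_cone m_gt0 Delta_good gamma_lam).
  by apply: eq_bigr => k _; rewrite mxE.
have f0 t : I t -> 'D_1 f t != 0 by move=> It; rewrite -derive1E; exact: f'_neq0.
apply: iff_trans (special_lagrangian_flow S_mfd S_full S_hausdorff S_sasaki A_action xi_reeb
  S_toric Omega_gamma sigma_real mu_moment I_open nu f_smooth rho_smooth rho_gt0 theta0
  psi_acy c0 f0) _.
exact: iff_sym (Im_flow_phase_const I_open nu f_smooth rho_smooth rho_gt0 theta0 N0 I_interval).
Qed.
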